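(* Let $m\in\mathbb{R}$, let $S\in\mathbb{Z}\setminus\{-1,0\}$, and let $W=(W_1,W_2)$ be a nonlinearity satisfying the standing structural assumptions described in the context (polynomial type, gauge property with vorticity $S$), together with the bounds: there are $C>0$ and $p\ge p_*$ such that $|W_1|+|W_2|\le C|\phi|^p$ and $|\partial_r W_1|+|\partial_r W_2|\le C|\phi|^{p-1}|\nabla\phi|$ whenever $|\phi|<1$, where (i) $p_*=5$ in the massless case $m=0$; (ii) $p_*=7$ in the massive case $m\neq 0$. Then there exists $\varepsilon>0$ such that the following holds. Let $$\phi=(\phi_1,\phi_2)\in C^1_{loc}\left(\mathbb{R};L^2(\mathbb{R}^2;\mathbb{C})^2\right)\cap C_{loc}\left(\mathbb{R};H^1(\mathbb{R}^2;\mathbb{C})^2\right)$$ be any radial global solution to the 2D Dirac equation with vorticity $S$ (that is, $\psi=(\phi_1(t,r)e^{iS\theta},\, i\phi_2(t,r)e^{i(S+1)\theta})$ solves the 2D nonlinear Dirac equation, equivalently $(\phi_1,\phi_2)$ solves the radial system in the context) such that $$\sup_{t\ge 0}\|\phi(t)\|_{H^1\cap L^\infty}<\varepsilon .$$ Then for every $R>0$, $$\lim_{t\to\infty}\|\phi(t)\|_{L^2(B(0,R))}=0 .$$ Consequently, there exist neither small standing solitons nor small breather solutions (in this class of solutions) of the 2D nonlinear Dirac equation within the ball $|x|<R$.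
   Context: **Equation.** For a spinor $\psi=(\psi_1,\psi_2):\mathbb{R}\times\mathbb{R}^2\to\mathbb{C}^2$ and mass $m\in\mathbb{R}$, the 2D nonlinear Dirac equation is $$i(\partial_t\psi_1+\partial_x\psi_2)+\partial_y\psi_2+m\psi_1=W_1,\qquad i(\partial_t\psi_2+\partial_x\psi_1)-\partial_y\psi_1-m\psi_2=W_2,$$ where $(W_1,W_2)=(W_1,W_2)(\psi_1,\overline{\psi_1},\psi_2,\overline{\psi_2})$ is a polynomial-type nonlinearity. It is massless if $m=0$ and massive if $m\ne0$. **Gauge property (with vorticity $S$).** For all $\theta$, $$W(e^{iS\theta}\psi_1,e^{-iS\theta}\overline{\psi_1},ie^{i(S+1)\theta}\psi_2,(-i)e^{-i(S+1)\theta}\overline{\psi_2})=(e^{iS\theta}W_1,\ ie^{i(S+1)\theta}W_2)(\psi_1,\overline{\psi_1},\psi_2,\overline{\psi_2}).$$ **Radial reduction.** In polar coordinates $(r,\theta)$, solutions of the form $\psi=(\phi_1(t,r)e^{iS\theta},\,i\phi_2(t,r)e^{i(S+1)\theta})$, $\phi_1,\phi_2\in\mathbb{C}$, correspond to solutions of $$i\partial_t\phi_1=\left(\partial_r+\tfrac{S+1}{r}\right)\phi_2-m\phi_1+W_1,\qquad i\partial_t\phi_2=-\left(\partial_r-\tfrac{S}{r}\right)\phi_1+m\phi_2+W_2,$$ with $W_j=W_j(\phi_1,\overline{\phi_1},\phi_2,\overline{\phi_2})$. The integer $S$ is called the vorticity. ''Radial global solution'' means such a $\phi=(\phi_1,\phi_2)$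 defined for all times. **Notation.** With $\phi_j=\phi_{j1}+i\phi_{j2}$ (real and imaginary parts), $|\phi|^2=\phi_{11}^2+\phi_{12}^2+\phi_{21}^2+\phi_{22}^2$ and $|\nabla\phi|^2=(\partial_r\phi_{11})^2+(\partial_r\phi_{12})^2+(\partial_r\phi_{21})^2+(\partial_r\phi_{22})^2$. For radial functions, $\|f\|_{L^2}^2=\int_0^\infty |f(r)|^2\,r\,dr$ and $\|\phi\|_{H^1}^2=\int_0^\infty(|\nabla\phi|^2+|\phi|^2)\,r\,dr$; $\|\cdot\|_{H^1\cap L^\infty}=\|\cdot\|_{H^1}+\|\cdot\|_{L^\infty}$. $B(0,R)\subset\mathbb{R}^2$ is the ball of radius $R$ centered at $0$. Standing solitons are nonzero solutions $e^{-i\omega t}Q(r)$, $\omega\in\mathbb{R}$; breathers are nonzero time-periodic solutions. *)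

(* Defs.v *)
From HB Require Import structures.
From mathcomp Require Import all_boot all_order all_algebra.
From mathcomp Require Import all_classical all_reals all_analysis.
From mathcomp Require Import ess_sup_inf.
From mathcomp Require Export complex.
(* mpoly is not imported: its notations clash with those of analysis. *)
From mathcomp Require mpoly.

Set Implicit Arguments.
Unset Strict Implicit.
Unset Printing Implicit Defensive.

Import Order.TTheory GRing.Theory Num.Theory.
Import numFieldNormedType.Exports.

Local Open Scope classical_set_scope.
Local Open Scope ring_scope.
Local Open Scope complex_scope.

Section Defs.
Context {R : realType}.

Local Notation mu := (@lebesgue_measure R).
Local Notation halfline := (`]0%R, +oo[%classic : set R).

Definition spinor := (R[i] * R[i])%type.

Definition spscale (c : R[i]) (z : spinor) : spinor := (c * z.1, c * z.2).

Definition cis (a : R) : R[i] := cos a +i* sin a.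

(* The real components phi_11, phi_12, phi_21, phi_22. *)
Definition comp11 (f : R -> spinor) (r : R) : R := complex.Re (f r).1.
Definition comp12 (f : R -> spinor) (r : R) : R := complex.Im (f r).1.
Definition comp21 (f : R -> spinor) (r : R) : R := complex.Re (f r).2.
Definition comp22 (f : R -> spinor) (r : R) : R := complex.Im (f r).2.

Definition forall_comp (P : (R -> R) -> Prop) (f : R -> spinor) : Prop :=
  [/\ P (comp11 f), P (comp12 f), P (comp21 f) & P (comp22 f)].

(* The argument D is the operator d/dr, applied to each real component: the
   classical derivative derive1 or the weak one wderiv below. *)
Definition comp_map (D : (R -> R) -> R -> R) (f : R -> spinor) (r : R) : spinor :=
  (D (comp11 f) r +i* D (comp12 f) r, D (comp21 f) r +i* D (comp22 f) r).

Definition spnorm (z : spinor) : R :=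
  Num.sqrt (complex.Re z.1 ^+ 2 + complex.Im z.1 ^+ 2
            + complex.Re z.2 ^+ 2 + complex.Im z.2 ^+ 2).

(* Radial functions on the plane are given by their profile on ]0, +oo[.  The
   weak derivative is the one-dimensional one on ]0, +oo[; since a point has
   zero capacity in the plane, f(|x|) is in H^1(R^2) exactly when f and its
   weak derivative on ]0, +oo[ are square integrable for r dr. *)
Definition test_function (chi : R -> R) : Prop :=
  [/\ (forall x, derivable chi x 1), continuous (derive1 chi) &
      exists a b : R, 0 < a /\ forall x, x \notin `[a, b] -> chi x = 0].

Definition is_weak_derivative (u g : R -> R) : Prop :=
  [/\ locally_integrable halfline u, locally_integrable halfline g &
      forall chi : R -> R, test_function chi ->
        \int[mu]_(r in halfline) (u r * derive1 chi r)
        = - \int[mu]_(r in halfline) (g r * chi r)].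

(* Weak derivatives are unique up to a null set; 0 if there is none. *)
Definition wderiv (u : R -> R) : R -> R :=
  xget (cst 0) [set g | is_weak_derivative u g].

Definition weakly_derivable (u : R -> R) : Prop :=
  exists g, is_weak_derivative u g.

(* 'L2norm `]0, rho[ f' is the L^2 norm on the ball B(0, rho), and
   'L2norm `]0, +oo[ f' that on the whole plane. *)
Definition L2norm (A : set R) (f : R -> spinor) : \bar R :=
  sqrte (\int[mu]_(r in A) (spnorm (f r) ^+ 2 * r)%:E)%E.

Definition H1norm (f : R -> spinor) : \bar R :=
  sqrte (\int[mu]_(r in halfline)
    ((spnorm (comp_map wderiv f r) ^+ 2 + spnorm (f r) ^+ 2) * r)%:E)%E.

Definition Linfnorm (f : R -> spinor) : \bar R :=
  ess_sup mu (fun r => (((spnorm \o f) \_ halfline) r)%:E).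

Definition H1Linfnorm (f : R -> spinor) : \bar R :=
  (H1norm f + Linfnorm f)%E.

Definition in_L2 (f : R -> spinor) : Prop :=
  forall_comp (measurable_fun halfline) f /\ (L2norm halfline f < +oo)%E.

Definition in_H1 (f : R -> spinor) : Prop :=
  [/\ in_L2 f, forall_comp weakly_derivable f & (H1norm f < +oo)%E].

Definition continuous_in_H1 (phi : R -> R -> spinor) : Prop :=
  (forall t, in_H1 (phi t)) /\
  forall t, H1norm (phi s - phi t) @[s --> t] --> 0%E.

Definition continuous_in_L2 (phi : R -> R -> spinor) : Prop :=
  (forall t, in_L2 (phi t)) /\
  forall t, L2norm halfline (phi s - phi t) @[s --> t] --> 0%E.

(* phi is C^1 with values in L^2, with time derivative dphi. *)
Definition C1_in_L2 (phi dphi : R -> R -> spinor) : Prop :=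
  [/\ (forall t, in_L2 (phi t)), continuous_in_L2 dphi &
      forall t,
        L2norm halfline
          (fun r => spscale (h^-1)%:C (phi (t + h) r - phi t r) - dphi t r)
          @[h --> 0^'] --> 0%E].

(* W(z1, w1, z2, w2) for a polynomial W in four variables; the nonlinearity is
   obtained by substituting w1 = conj z1 and w2 = conj z2. *)
Definition eval4 (W : mpoly.mpoly 4 R[i]) (z1 w1 z2 w2 : R[i]) : R[i] :=
  mpoly.meval (tnth [tuple z1; w1; z2; w2]) W.

Definition nonlin (W : mpoly.mpoly 4 R[i]) (z : spinor) : R[i] :=
  eval4 W z.1 (z.1^*) z.2 (z.2^*).

Definition gauge_property (S : int) (W1 W2 : mpoly.mpoly 4 R[i]) : Prop :=
  forall (theta : R) (z1 z2 : R[i]),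
    let e1 := cis (S%:~R * theta) in
    let e1' := cis (- (S%:~R * theta)) in
    let e2 := cis ((S + 1)%:~R * theta) in
    let e2' := cis (- ((S + 1)%:~R * theta)) in
    let W1z := eval4 W1 z1 (z1^*) z2 (z2^*) in
    let W2z := eval4 W2 z1 (z1^*) z2 (z2^*) in
    eval4 W1 (e1 * z1) (e1' * z1^*) ('i * e2 * z2) (- 'i * e2' * z2^*)
      = e1 * W1z /\
    eval4 W2 (e1 * z1) (e1' * z1^*) ('i * e2 * z2) (- 'i * e2' * z2^*)
      = 'i * e2 * W2z.

Definition cmod (z : R[i]) : R :=
  Num.sqrt (complex.Re z ^+ 2 + complex.Im z ^+ 2).

Definition cderive1 (f : R -> R[i]) (r : R) : R[i] :=
  derive1 (fun s => complex.Re (f s)) r +i* derive1 (fun s => complex.Im (f s)) r.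

Definition power_bound (C p : R) (W1 W2 : mpoly.mpoly 4 R[i]) : Prop :=
  forall z : spinor, spnorm z < 1 ->
    cmod (nonlin W1 z) + cmod (nonlin W2 z) <= C * spnorm z `^ p.

Definition derivative_bound (C p : R) (W1 W2 : mpoly.mpoly 4 R[i]) : Prop :=
  forall (f : R -> spinor) (r : R), 0 < r ->
    forall_comp (fun u => derivable u r 1) f -> spnorm (f r) < 1 ->
    cmod (cderive1 (nonlin W1 \o f) r) + cmod (cderive1 (nonlin W2 \o f) r)
      <= C * spnorm (f r) `^ (p - 1) * spnorm (comp_map (@derive1 R _) f r).

Definition critical_power (m : R) : R := if m == 0 then 5 else 7.

Definition radial_dirac (m : R) (S : int) (W1 W2 : mpoly.mpoly 4 R[i])
    (phi dphi : R -> R -> spinor) : Prop :=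
  forall t : R, {ae mu, forall r : R, 0 < r ->
    let z := phi t r in
    let dt := dphi t r in
    let dr := comp_map wderiv (phi t) r in
    'i * dt.1 = (dr.2 + ((S + 1)%:~R / r)%:C * z.2) - m%:C * z.1
                + nonlin W1 z /\
    'i * dt.2 = - (dr.1 - (S%:~R / r)%:C * z.1) + m%:C * z.2
                + nonlin W2 z}.

Definition radial_global_solution (m : R) (S : int)
    (W1 W2 : mpoly.mpoly 4 R[i]) (phi : R -> R -> spinor) : Prop :=
  continuous_in_H1 phi /\
  exists dphi, C1_in_L2 phi dphi /\ radial_dirac m S W1 W2 phi dphi.

Definition small (eps : R) (phi : R -> R -> spinor) : Prop :=
  (ereal_sup [set H1Linfnorm (phi t) | t in `[0%R, +oo[%classic] < eps%:E)%E.

(* Within B(0, rho), phi is nonzero and of the form e^(- i omega t) Q(r). *)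
Definition standing_soliton_in_ball (rho : R) (phi : R -> R -> spinor) : Prop :=
  exists (omega : R) (Q : R -> spinor),
    ~ {ae mu, forall r, 0 < r < rho -> Q r = 0} /\
    forall t, {ae mu, forall r, 0 < r < rho ->
      phi t r = spscale (cis (- (omega * t))) (Q r)}.

Definition breather_in_ball (rho : R) (phi : R -> R -> spinor) : Prop :=
  ~ (forall t, {ae mu, forall r, 0 < r < rho -> phi t r = 0}) /\
  exists2 T : R, 0 < T &
    forall t, {ae mu, forall r, 0 < r < rho -> phi (t + T) r = phi t r}.

End Defs.

Arguments spinor : clear implicits.

(* Main.v *)
(* Written in the four real unknowns u_i, the system is u' = L u + w(u), where L is
   the radial Dirac operator.  For X = psi d/dr + chi, with psi = r^2 / (1 + r)^2 and
   chi making X antisymmetric for r dr, the virial functional sum_i <L u_i, X u_i> is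
   bounded by the H^1 norm.  As the square of L acts on each component as a Bessel
   operator of angular momentum S or S + 1 (nonzero by assumption) minus the constant
   m^2, the linear part of its time derivative is at most
     - sum_i int (2 r^2 (1+r)^-3 (u_i')^2 + (1+r)^-2 u_i^2 / 4) dr,
   and the nonlinear part is absorbed because |u| <= 2 eps (1+r)^(-1/2) and
   |w'| <= C |u|^(p-1) |u'|, the exponent 5 (or 7, to beat the factor r in front of m)
   giving the weight (1+r)^-2 (or (1+r)^-3).

   Since u is only of class H^1, the functional is evaluated on the Steklov means of
   u over [r, r+h]; by Cauchy-Schwarz u varies by at most (h/r)^(1/2) on that interval,
   so that all errors are O(h^(1/2)) uniformly in time.  Hence the weighted L^2 norm is
   integrable in time; being Lipschitz in time, it tends to 0.  A soliton or a breather
   has constant or periodic local L^2 norm, hence vanishes. *)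
Require Import Defs.
From mathcomp Require Import all_boot all_order all_algebra.
From mathcomp Require Import all_classical all_reals all_analysis.
From mathcomp Require Import measurable_realfun ess_sup_inf ring lra.
From mathcomp Require mpoly.

Set Implicit Arguments.
Unset Strict Implicit.
Unset Printing Implicit Defensive.

Import Order.TTheory GRing.Theory Num.Theory.
Import numFieldNormedType.Exports.

Local Open Scope classical_set_scope.
Local Open Scope ring_scope.

(** * Integrable functions *)

(** For [u' = L u] the derivative of the functional is [<L L u, X u> + <L u, X L u>]. The second
    pairing vanishes since [X] is antisymmetric, and the first splits into scalar virial identities
    because [L L] is diagonal; by the same antisymmetry the mass drops out of them. Their
    zeroth-order coefficient at the origin is [K - 3/4] with [K = S^2] or [(S + 1)^2]: this is where
    the vorticities 0 and -1 are lost.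

    The functional is quadratic in [u] and its r-derivative, while the time derivative of [u] is
    only in L^2(r dr). On Steklov means the r-derivative becomes a difference quotient, a bounded
    operator of L^2(r dr), so the functional can be differentiated in time. The price is that means
    commute neither with [1/r] nor with the nonlinearity; these errors are of size
    [h^(1/2) r^(-3/2)], and they are integrable because [psi] vanishes to second order at 0.

    No pointwise information is available at 0 or at infinity, so a boundary term [Phi] is discarded
    through the integrability of [Phi / r]. *)

Ltac pos := repeat first
  [ exact: sqr_ge0 | exact: normr_ge0 | assumption | by apply: ltW | apply: exprn_ge0
  | apply: mulr_ge0 | apply: addr_ge0 | by [] | rewrite invr_ge0 ].

Section Integration.
Context {R : realType}.
Local Notation mu := (@lebesgue_measure R).
Implicit Types (D : set R) (f g : R -> R).

Lemma aeS (P Q : R -> Prop) : (forall x, P x -> Q x) ->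
  {ae mu, forall x, P x} -> {ae mu, forall x, Q x}.
Proof. move=> PQ; apply: (@filterS _ _ (ae_filter_ringOfSetsType mu)); exact: PQ. Qed.

Lemma aeS2 (P1 P2 Q : R -> Prop) : (forall x, P1 x -> P2 x -> Q x) ->
  {ae mu, forall x, P1 x} -> {ae mu, forall x, P2 x} -> {ae mu, forall x, Q x}.
Proof. move=> PQ; apply: (@filterS2 _ _ (ae_filter_ringOfSetsType mu)); exact: PQ. Qed.

Definition igr D f := mu.-integrable D (EFin \o f).

Lemma igr_meas D f : igr D f -> measurable_fun D f.
Proof. by move/integrableP => [/measurable_EFinP]. Qed.

Lemma igrD D f g : measurable D -> igr D f -> igr D g -> igr D (fun x => f x + g x).
Proof. by move=> mD If Ig; have := @integrableD _ _ _ mu D mD _ _ If Ig. Qed.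

Lemma igrZ D c f : measurable D -> igr D f -> igr D (fun x => c * f x).
Proof. by move=> mD If; exact: (@integrableZl _ _ _ mu D mD c (EFin \o f) If). Qed.

Lemma igrB D f g : measurable D -> igr D f -> igr D g -> igr D (fun x => f x - g x).
Proof. by move=> mD If Ig; have := @integrableB _ _ _ mu D mD _ _ If Ig. Qed.

Lemma igr_norm D f : igr D f -> igr D (fun x => `|f x|).
Proof. exact: integrable_norm. Qed.

Lemma igr0 D : igr D (fun=> 0).
Proof. exact: integrable0. Qed.

Lemma igrS D E f : measurable D -> measurable E -> D `<=` E -> igr E f -> igr D f.
Proof. by move=> mD mE DE; exact: (@integrableS _ _ _ mu). Qed.

Lemma igr_eq D f g : measurable D -> {in D, f =1 g} -> igr D f -> igr D g.
Proof.
move=> mD fg If; apply: (@eq_integrable _ _ _ mu D mD (EFin \o f)) => // x xD.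
by rewrite /= fg.
Qed.

Lemma igr_le D f g : measurable D -> measurable_fun D f ->
  (forall x, D x -> `|f x| <= g x) -> igr D g -> igr D f.
Proof.
move=> mD mf fg Ig; apply: (@le_integrable _ _ _ mu _ mD _ (EFin \o g)) => //.
  exact/measurable_EFinP.
by move=> x Dx /=; rewrite lee_fin (le_trans (fg x Dx))// ler_norm.
Qed.

Lemma igr_sum D (I : Type) (s : seq I) (F : I -> R -> R) : measurable D ->
  (forall i, igr D (F i)) -> igr D (fun x => \sum_(i <- s) F i x).
Proof.
move=> mD IF; elim: s => [|i s IHs].
  by apply: igr_eq mD _ (igr0 D) => x _; rewrite big_nil.
apply: igr_eq mD _ (igrD mD (IF i) IHs) => x _.
by rewrite big_cons.
Qed.

Lemma Rint_sum D (I : Type) (s : seq I) (F : I -> R -> R) : measurable D ->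
  (forall i, igr D (F i)) ->
  \int[mu]_(x in D) (\sum_(i <- s) F i x) = \sum_(i <- s) \int[mu]_(x in D) F i x.
Proof.
move=> mD IF; elim: s => [|i s IHs].
  rewrite big_nil; under eq_Rintegral do rewrite big_nil.
  by rewrite Rintegral_cst// mul0r.
rewrite big_cons -IHs -RintegralD//; [|exact: IF|exact: igr_sum].
by apply: eq_Rintegral => x _; rewrite big_cons.
Qed.

Lemma RintZ D c f : measurable D -> igr D f ->
  \int[mu]_(x in D) (c * f x) = c * \int[mu]_(x in D) f x.
Proof. by move=> mD If; rewrite RintegralZl. Qed.

Lemma RintD D f g : measurable D -> igr D f -> igr D g ->
  \int[mu]_(x in D) (f x + g x) = \int[mu]_(x in D) f x + \int[mu]_(x in D) g x.
Proof. by move=> mD If Ig; rewrite RintegralD. Qed.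

Lemma RintB D f g : measurable D -> igr D f -> igr D g ->
  \int[mu]_(x in D) (f x - g x) = \int[mu]_(x in D) f x - \int[mu]_(x in D) g x.
Proof. by move=> mD If Ig; rewrite RintegralB. Qed.

Lemma le_Rint D f g : measurable D -> igr D f -> igr D g ->
  (forall x, D x -> f x <= g x) ->
  \int[mu]_(x in D) f x <= \int[mu]_(x in D) g x.
Proof. by move=> mD If Ig fg; apply: le_Rintegral. Qed.

Lemma igr_fin D f : measurable D -> igr D f ->
  (\int[mu]_(x in D) (f x)%:E \is a fin_num)%E.
Proof. by move=> mD If; exact: (@integrable_fin_num _ _ _ mu D mD _ If). Qed.

Lemma EFin_Rint D f : measurable D -> igr D f ->
  (\int[mu]_(x in D) f x)%:E = (\int[mu]_(x in D) (f x)%:E)%E.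
Proof. by move=> mD If; rewrite /Rintegral fineK// igr_fin. Qed.

Lemma le_Rint_set D E f : measurable D -> measurable E -> D `<=` E -> igr E f ->
  (forall x, E x -> 0 <= f x) -> \int[mu]_(x in D) f x <= \int[mu]_(x in E) f x.
Proof.
move=> mD mE DE If f0; rewrite -lee_fin EFin_Rint//; last exact: igrS If.
rewrite EFin_Rint//; apply: ge0_subset_integral => //.
by apply/measurable_EFinP; exact: igr_meas If.
Qed.

Lemma norm_Rint_le D f : measurable D -> igr D f ->
  `|\int[mu]_(x in D) f x| <= \int[mu]_(x in D) `|f x|.
Proof. by move=> mD If; exact: le_normr_Rintegral. Qed.

Lemma ae_eq_Rint D f g : measurable D -> measurable_fun D f -> measurable_fun D g ->
  {ae mu, forall x, D x -> f x = g x} ->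
  \int[mu]_(x in D) f x = \int[mu]_(x in D) g x.
Proof.
move=> mD mf mg fg; rewrite /Rintegral; congr fine.
apply: ae_eq_integral => //; try exact/measurable_EFinP.
by apply: aeS fg => x fg Dx /=; rewrite fg.
Qed.

Lemma igr_ae_eq D f g : measurable D -> measurable_fun D g ->
  {ae mu, forall x, D x -> f x = g x} -> igr D f -> igr D g.
Proof.
move=> mD mg fg If; have mf := igr_meas If.
apply/integrableP; split; first exact/measurable_EFinP.
have /integrableP[_] := If; congr (_ < _)%E.
apply: ae_eq_integral => //.
- by apply: measurableT_comp => //; apply/measurable_EFinP.
- by apply: measurableT_comp => //; apply/measurable_EFinP.
- by apply: aeS fg => x fg Dx /=; rewrite fg.
Qed.

(** Almost everywhere [g] agrees with the maximum of [f] and [g], which dominates [f] at every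
    point. *)
Lemma ae_le_Rint D f g : measurable D -> igr D f -> igr D g ->
  {ae mu, forall x, D x -> f x <= g x} ->
  \int[mu]_(x in D) f x <= \int[mu]_(x in D) g x.
Proof.
move=> mD If Ig fg.
have mm : igr D (fun x => Num.max (f x) (g x)).
  apply: (@igr_le _ _ (fun x => `|f x| + `|g x|)) => //.
  - by apply: measurable_maxr => //; exact: igr_meas.
  - move=> x _; rewrite maxEle; case: ifP => _.
      by rewrite lerDr.
    by rewrite lerDl.
  - by apply: igrD => //; exact: igr_norm.
have -> : \int[mu]_(x in D) g x = \int[mu]_(x in D) Num.max (f x) (g x).
  apply: ae_eq_Rint => //; try exact: igr_meas.
  by apply: aeS fg => x fg Dx; rewrite max_r// fg.
by apply: le_Rintegral => // x _; rewrite le_max lexx.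
Qed.

End Integration.

(** * The space L^2(r dr) on the half-line *)

Section WeightedL2.
Context {R : realType}.
Local Notation mu := (@lebesgue_measure R).
Local Notation H := (`]0%R, +oo[%classic : set R).
Implicit Types (v w c : R -> R).

Lemma mH : measurable H.
Proof. exact: measurable_itv. Qed.

Lemma inH (r : R) : H r = (0 < r) :> Prop.
Proof. by rewrite /= in_itv/= andbT. Qed.

Definition sq v := measurable_fun H v /\ igr H (fun r => r * v r ^+ 2).

Definition N2 v : R := \int[mu]_(r in H) (r * v r ^+ 2).

Lemma N2_ge0 v : 0 <= N2 v.
Proof.
by apply: Rintegral_ge0 => r; rewrite inH => r0; rewrite mulr_ge0 ?sqr_ge0// ltW.
Qed.

Lemma measurable_wsq v : measurable_fun H v ->
  measurable_fun H (fun r => r * v r ^+ 2).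
Proof.
by move=> mv; apply: measurable_funM => //; apply: measurable_funX.
Qed.

Lemma sq_le v w (M : R) : measurable_fun H v -> sq w ->
  (forall r : R, 0 < r -> `|v r| <= M * `|w r|) -> sq v /\ N2 v <= M ^+ 2 * N2 w.
Proof.
move=> mv [mw Iw] vw.
have key (r : R) : 0 < r -> r * v r ^+ 2 <= M ^+ 2 * (r * w r ^+ 2).
  move=> r0; rewrite [leRHS]mulrCA ler_pM2l// -[leLHS]real_normK ?num_real//.
  rewrite -[w r ^+ 2]real_normK ?num_real// -exprMn.
  rewrite ler_pXn2r ?nnegrE//; first exact: vw.
  by rewrite (le_trans _ (vw _ r0)).
have Iv : igr H (fun r => r * v r ^+ 2).
  apply: (igr_le mH _ _ (igrZ (M ^+ 2) mH Iw)); first exact: measurable_wsq.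
  move=> r; rewrite inH => r0.
  by rewrite ger0_norm ?key// mulr_ge0 ?sqr_ge0// ltW.
split; first by split.
rewrite /N2 -(RintZ _ mH Iw).
apply: (le_Rint mH Iv (igrZ _ mH Iw)).
by move=> r; rewrite inH; exact: key.
Qed.

Lemma sqM (M : R) c v : measurable_fun H c -> (forall r : R, 0 < r -> `|c r| <= M) ->
  sq v -> sq (fun r => c r * v r) /\ N2 (fun r => c r * v r) <= M ^+ 2 * N2 v.
Proof.
move=> mc cM sv; apply: sq_le => //.
  by apply: measurable_funM => //; case: sv.
by move=> r r0; rewrite normrM ler_wpM2r// cM.
Qed.

Lemma sqZ (a : R) v : sq v -> sq (fun r => a * v r).
Proof. by move=> sv; apply: (proj1 (sqM (M := `|a|) _ _ sv)). Qed.

Lemma N2Z (a : R) v : sq v -> N2 (fun r => a * v r) = a ^+ 2 * N2 v.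
Proof.
move=> [mv Iv]; rewrite /N2 -(RintZ _ mH Iv).
by apply: eq_Rintegral => r _; rewrite exprMn mulrCA.
Qed.

Lemma sqD_le v w : sq v -> sq w ->
  sq (fun r => v r + w r) /\ N2 (fun r => v r + w r) <= 2 * N2 v + 2 * N2 w.
Proof.
move=> [mv Iv] [mw Iw].
have mvw : measurable_fun H (fun r => v r + w r) by exact: measurable_funD.
have Ib : igr H (fun r => 2 * (r * v r ^+ 2) + 2 * (r * w r ^+ 2)).
  by apply: igrD mH _ _; exact: igrZ mH _.
have key (r : R) : 0 < r ->
    r * (v r + w r) ^+ 2 <= 2 * (r * v r ^+ 2) + 2 * (r * w r ^+ 2).
  move=> r0; rewrite (mulrCA 2 r) (mulrCA 2 r) -mulrDr ler_pM2l//.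
  by have := sqr_ge0 (v r - w r); lra.
have I1 : igr H (fun r => r * (v r + w r) ^+ 2).
  apply: igr_le mH _ _ Ib; first exact: measurable_wsq.
  by move=> r; rewrite inH => r0; rewrite ger0_norm ?key// mulr_ge0 ?sqr_ge0 ?ltW.
split; first by split.
rewrite /N2 -(RintZ _ mH Iv) -(RintZ _ mH Iw).
rewrite -(RintD mH (igrZ _ mH Iv) (igrZ _ mH Iw)).
by apply: (le_Rint mH I1 Ib) => r; rewrite inH; exact: key.
Qed.

Lemma sqD v w : sq v -> sq w -> sq (fun r => v r + w r).
Proof. by move=> sv sw; case: (sqD_le sv sw). Qed.

Lemma sqB v w : sq v -> sq w -> sq (fun r => v r - w r).
Proof.
move=> sv sw; have := sqD sv (sqZ (-1) sw).
by congr sq; apply/funext => r; rewrite mulN1r.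
Qed.

Lemma N2_sub_le v w : sq v -> sq w -> N2 (fun r => v r - w r) <= 2 * N2 v + 2 * N2 w.
Proof.
move=> sv sw; have [_] := sqD_le sv (sqZ (-1) sw).
rewrite N2Z// sqrrN expr1n mul1r; congr (_ <= _); congr N2.
by apply/funext => r; rewrite mulN1r.
Qed.

Lemma sq_prod v w : sq v -> sq w -> igr H (fun r => r * (v r * w r)).
Proof.
move=> [mv Iv] [mw Iw].
apply: (igr_le mH _ _ (igrD mH Iv Iw)).
  by apply: measurable_funM => //; exact: measurable_funM.
move=> r; rewrite inH => r0.
rewrite normrM gtr0_norm// -mulrDr ler_pM2l// ler_norml.
by have := sqr_ge0 (v r - w r); have := sqr_ge0 (v r + w r); nra.
Qed.

Definition ip v w : R := \int[mu]_(r in H) (r * (v r * w r)).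

Lemma ipC v w : ip v w = ip w v.
Proof. by apply: eq_Rintegral => r _; rewrite [v r * _]mulrC. Qed.

Lemma ipD v w u : sq v -> sq w -> sq u -> ip (fun r => v r + w r) u = ip v u + ip w u.
Proof.
move=> sv sw su; rewrite /ip -(RintD mH (sq_prod sv su) (sq_prod sw su)).
by apply: eq_Rintegral => r _; rewrite mulrDl mulrDr.
Qed.

Lemma ipZ a v u : sq v -> sq u -> ip (fun r => a * v r) u = a * ip v u.
Proof.
move=> sv su; rewrite /ip -(RintZ _ mH (sq_prod sv su)).
by apply: eq_Rintegral => r _; rewrite -mulrA mulrCA.
Qed.

Lemma ip_young v w (l : R) : 0 < l -> sq v -> sq w ->
  2 * `|ip v w| <= l * N2 v + l^-1 * N2 w.
Proof.
move=> l0 sv sw; have Ivw := sq_prod sv sw.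
have [[mv Iv] [mw Iw]] := (sv, sw).
have {1}-> : 2 = `|2| :> R by rewrite ger0_norm.
rewrite -normrM -(RintZ _ mH Ivw).
apply: le_trans (norm_Rint_le mH (igrZ 2 mH Ivw)) _.
rewrite /N2 -(RintZ _ mH Iv) -(RintZ _ mH Iw).
rewrite -(RintD mH (igrZ _ mH Iv) (igrZ _ mH Iw)).
apply: (le_Rint mH (igr_norm (igrZ 2 mH Ivw)) (igrD mH (igrZ _ mH Iv) (igrZ _ mH Iw))).
move=> r; rewrite inH => r0.
rewrite (mulrCA 2) (mulrCA l) (mulrCA l^-1) -mulrDr normrM gtr0_norm// ler_pM2l//.
have h1 := sqr_ge0 (l * v r - w r); have h2 := sqr_ge0 (l * v r + w r).
rewrite -(ler_pM2l l0) mulrDr (mulrA l l^-1) divff ?gt_eqF// mul1r.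
rewrite -[X in X * `|_|]gtr0_norm// -normrM ler_norml; apply/andP; split; lra.
Qed.

(** Optimization of [ip_young] over its parameter; the best value is [|ip v w| / N2 v]. *)
Lemma ip_CS v w : sq v -> sq w -> `|ip v w| <= Num.sqrt (N2 v) * Num.sqrt (N2 w).
Proof.
move=> sv sw.
have [v0 w0] := (N2_ge0 v, N2_ge0 w).
have Ige0 := normr_ge0 (ip v w).
have key (l : R) : 0 < l -> 2 * l * `|ip v w| <= l ^+ 2 * N2 v + N2 w.
  move=> l0; have := ip_young l0 sv sw; rewrite -(ler_pM2l l0).
  rewrite mulrDr [l * (l^-1 * _)]mulrA divff ?gt_eqF// mul1r expr2; lra.
move: (`|ip v w|) Ige0 key => J J0 key.
rewrite -sqrtrM//; rewrite -(ger0_norm J0) -sqrtr_sqr ler_wsqrtr//.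
have [->|JN0] := eqVneq J 0; first by rewrite expr0n/= mulr_ge0.
have Jp : 0 < J by rewrite lt_def JN0.
(* When [N2 v = 0] no optimal parameter exists; the value [(N2 w + 1) / J] is large enough to
   contradict [J > 0]. *)
have [v00|vpos] := eqVneq (N2 v) 0.
  have := key ((N2 w + 1) / J) (divr_gt0 (ltr_wpDl w0 ltr01) Jp).
  by rewrite v00 mulr0 add0r -mulrA divfK// => h'; lra.
have vp : 0 < N2 v by rewrite lt_def vpos.
have := key (J / N2 v) (divr_gt0 Jp vp).
rewrite -(ler_pM2l vp).
have -> : N2 v * (2 * (J / N2 v) * J) = 2 * J ^+ 2 by field.
have -> : N2 v * ((J / N2 v) ^+ 2 * N2 v + N2 w) = J ^+ 2 + N2 v * N2 w by field.
lra.
Qed.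

Lemma is_derive_cvg (F : R -> R) (t L : R) :
  h^-1 * (F (t + h) - F t) @[h --> 0^'] --> L -> is_derive t 1 F L.
Proof.
move=> FL; have E : (fun h : R => h^-1 *: ((F \o shift t) (h *: 1) - F t))
    = (fun h => h^-1 * (F (t + h) - F t)).
  apply/funext => h; rewrite /= /GRing.scale/= mulr1; congr (_ * (F _ - _)).
  exact: addrC.
apply: DeriveDef; last by rewrite /derive E; apply/cvg_lim.
by rewrite /derivable E; apply/cvg_ex; exists L.
Qed.

(** Differentiability at [t], in the norm of L^2(r dr), of a curve with values in that space. *)
Definition L2d (v : R -> R -> R) (v' : R -> R) (t : R) : Prop :=
  [/\ forall s, sq (v s), sq v' &
      N2 (fun r => h^-1 * (v (t + h) r - v t r) - v' r) @[h --> 0^'] --> 0].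

(** A bounded linear operator commutes with the time derivative. Linearity is asked only on square
    integrable functions and at positive radii, which is all that Steklov means satisfy. *)
Lemma L2d_op (T : (R -> R) -> R -> R) (M : R) (v : R -> R -> R) v' t :
  (forall x, sq x -> sq (T x) /\ N2 (T x) <= M * N2 x) ->
  (forall a x y (r : R), sq x -> sq y -> 0 < r ->
     T (fun s => a * x s + y s) r = a * T x r + T y r) ->
  L2d v v' t -> L2d (fun s => T (v s)) (T v') t.
Proof.
move=> bT lT [sv sv' cv]; split=> [s||]; try by apply: (bT _ _).1.
have sd h : sq (fun r => h^-1 * (v (t + h) r - v t r) - v' r).
  by apply: sqB => //; apply: sqZ; exact: sqB.
have E h : N2 (fun r => h^-1 * (T (v (t + h)) r - T (v t) r) - T v' r)
   = N2 (T (fun r => h^-1 * (v (t + h) r - v t r) - v' r)).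
  apply: eq_Rintegral => r; rewrite inE inH => r0; congr (_ * _ ^+ 2).
  have -> : (fun r => h^-1 * (v (t + h) r - v t r) - v' r)
      = (fun r => h^-1 * v (t + h) r + (- h^-1 * v t r + (-1) * v' r)).
    by apply/funext => s; ring.
  (* Linearity is available in the form [a x + y], so the multiple [-v'] is split as
     [-2 v' + v']. *)
  have T1 : T (fun s => -1 * v' s) r = -1 * T v' r.
    have -> : (fun s => -1 * v' s) = (fun s => -2 * v' s + v' s).
      by apply/funext => s; ring.
    by rewrite (lT (-2) v' v' r)//; ring.
  rewrite (lT h^-1 (v (t + h)) (fun r => - h^-1 * v t r + (-1) * v' r) r)//.
    rewrite (lT (- h^-1) (v t) (fun r => (-1) * v' r) r)//; last exact: sqZ.
    by rewrite T1; ring.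
  by apply: sqD; exact: sqZ.
under eq_fun do rewrite E.
apply: (@squeeze_cvgr _ _ _ _ (fun=> 0)
  (fun h => `|M| * N2 (fun r => h^-1 * (v (t + h) r - v t r) - v' r))).
- apply: nearW => h; rewrite N2_ge0/= (le_trans (bT _ (sd h)).2)//.
  by rewrite ler_wpM2r ?N2_ge0// ler_norm.
- exact: cvg_cst.
- by rewrite -[X in _ --> X](mulr0 `|M|); apply: cvgM => //; exact: cvg_cst.
Qed.

Lemma L2dM (M : R) c (v : R -> R -> R) v' t : measurable_fun H c ->
  (forall r, 0 < r -> `|c r| <= M) -> L2d v v' t ->
  L2d (fun s r => c r * v s r) (fun r => c r * v' r) t.
Proof.
move=> mc cM; apply: (@L2d_op (fun x r => c r * x r) (M ^+ 2)).
  by move=> x; exact: sqM.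
by move=> a x y r _ _ _; ring.
Qed.

Lemma L2dD (v w : R -> R -> R) v' w' t : L2d v v' t -> L2d w w' t ->
  L2d (fun s r => v s r + w s r) (fun r => v' r + w' r) t.
Proof.
move=> [sv sv' cv] [sw sw' cw]; split=> [s||]; try exact: sqD.
apply: (@squeeze_cvgr _ _ _ _ (fun=> 0)
  (fun h => 2 * N2 (fun r => h^-1 * (v (t + h) r - v t r) - v' r)
          + 2 * N2 (fun r => h^-1 * (w (t + h) r - w t r) - w' r))).
- apply: nearW => h; rewrite N2_ge0/=.
  have sd x x' : (forall s, sq (x s)) -> sq x' ->
      sq (fun r => h^-1 * (x (t + h) r - x t r) - x' r).
    by move=> sx sx'; apply: sqB => //; apply: sqZ; exact: sqB.
  have [_ ] := sqD_le (sd v v' sv sv') (sd w w' sw sw').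
  congr (_ <= _); congr N2; apply/funext => r; ring.
- exact: cvg_cst.
- rewrite -[X in _ --> X](addr0 0); apply: cvgD;
  by rewrite -[X in _ --> X](mulr0 2); apply: cvgM => //; exact: cvg_cst.
Qed.

(** Leibniz rule. With [a h] and [b h] the errors of the two difference quotients, the remainder is
    a sum of six pairings, each carrying a factor [a h], [b h] or [h]; Cauchy-Schwarz bounds them by
    norms. *)
Lemma is_derive_ip (v w : R -> R -> R) v' w' t : L2d v v' t -> L2d w w' t ->
  is_derive t (1 : R) (fun s => ip (v s) (w s)) (ip v' (w t) + ip (v t) w').
Proof.
move=> [sv sv' cv] [sw sw' cw]; apply: is_derive_cvg.
pose a h r := h^-1 * (v (t + h) r - v t r) - v' r.
pose b h r := h^-1 * (w (t + h) r - w t r) - w' r.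
have sa h : sq (a h) by apply: sqB => //; apply: sqZ; exact: sqB.
have sb h : sq (b h) by apply: sqB => //; apply: sqZ; exact: sqB.
have vE h : h != 0 -> v (t + h) = (fun r => v t r + h * (v' r + a h r)).
  by move=> h0; apply/funext => r; rewrite /a; field.
have wE h : h != 0 -> w (t + h) = (fun r => w t r + h * (w' r + b h r)).
  by move=> h0; apply/funext => r; rewrite /b; field.
have QE h : h != 0 -> h^-1 * (ip (v (t + h)) (w (t + h)) - ip (v t) (w t))
     - (ip v' (w t) + ip (v t) w')
   = ip (a h) (w t) + h * ip (a h) (b h) + h * ip (a h) w' + h * ip v' (b h)
     + h * ip v' w' + ip (v t) (b h).
  move=> h0; rewrite (vE _ h0) (wE _ h0).
  have s1 := sqD sv' (sa h); have s2 := sqD sw' (sb h).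
  rewrite ipD//; [|exact: sqZ|by apply: sqD => //; exact: sqZ].
  rewrite ipZ//; last by apply: sqD => //; exact: sqZ.
  rewrite ipD//; last by apply: sqD => //; exact: sqZ.
  rewrite !(ipC _ (fun r => w t r + h * (w' r + b h r))).
  do 3 (rewrite (ipD (v := w t))//; last exact: sqZ).
  do 3 (rewrite ipZ//).
  do 3 (rewrite (ipD (v := w') (w := b h))//).
  rewrite !(ipC (w t)) !(ipC w') !(ipC (b h)).
  by field.
pose n x : R := Num.sqrt (N2 x).
pose E h := n (a h) * n (w t) + `|h| * (n (a h) * n (b h)) + `|h| * (n (a h) * n w')
  + `|h| * (n v' * n (b h)) + `|h| * (n v' * n w') + n (v t) * n (b h).
have ca : n (a h) @[h --> 0^'] --> 0.
  by rewrite -[X in _ --> X]sqrtr0; apply: continuous_cvg => //; exact: sqrt_continuous.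
have cb : n (b h) @[h --> 0^'] --> 0.
  by rewrite -[X in _ --> X]sqrtr0; apply: continuous_cvg => //; exact: sqrt_continuous.
have ch : `|h| @[h --> (0:R)^'] --> (0:R).
  rewrite -[X in _ --> X](@normr0 _ R); apply: (cvg_norm (f := id)).
  exact: nbhs_dnbhs.
have cE : E h @[h --> 0^'] --> 0.
  rewrite /E [X in _ --> X](_ : 0 = 0 * n (w t) + 0 * (0 * 0) + 0 * (0 * n w')
    + 0 * (n v' * 0) + 0 * (n v' * n w') + n (v t) * 0); last by ring.
  have c0 (k : R) : (fun _ : R => k) @ (0 : R)^' --> k by exact: cvg_cst.
  exact: (cvgD (cvgD (cvgD (cvgD (cvgD (cvgM ca (c0 _)) (cvgM ch (cvgM ca cb)))
    (cvgM ch (cvgM ca (c0 _)))) (cvgM ch (cvgM (c0 _) cb))) (cvgM ch (c0 _)))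
    (cvgM (c0 _) cb)).
apply/subr_cvg0; apply/norm_cvg0P.
apply: (@squeeze_cvgr _ _ _ _ (fun=> 0) E); [|exact: cvg_cst|exact: cE].
near=> h; rewrite normr_ge0/=.
have h0 : h != 0 by near: h; exact: nbhs_dnbhs_neq.
rewrite QE// /E; do !(apply: le_trans (ler_normD _ _) _; apply: lerD);
  rewrite ?normrM ?ler_wpM2l//; exact: ip_CS.
Unshelve. all: by end_near. Qed.

End WeightedL2.

(** * Primitives of locally integrable functions *)

Section Primitives.
Context {R : realType}.
Local Notation mu := (@lebesgue_measure R).
Local Notation H := (`]0%R, +oo[%classic : set R).
Implicit Types (u v g k f : R -> R) (a b c : R).

Definition locigr g := forall a b, 0 < a -> igr `[a, b] g.

Lemma itvH a b : 0 < a -> `[a, b]%classic `<=` H.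
Proof. by move=> a0 r /=; rewrite !in_itv/= andbT => /andP[ar _]; exact: lt_le_trans ar. Qed.

Lemma mitv a b : measurable (`[a, b]%classic : set R).
Proof. exact: measurable_itv. Qed.

Lemma Rint_chasles f a b c : a <= b -> b <= c -> igr `[a, c] f ->
  \int[mu]_(x in `[a, c]) f x = \int[mu]_(x in `[a, b]) f x + \int[mu]_(x in `[b, c]) f x.
Proof.
move=> ab bc If.
have := @Rintegral_itvB R f (BLeft a) (BRight c) b If.
rewrite !bnd_simp => /(_ ab bc).
rewrite Rintegral_itv_obnd_cbnd; last first.
  apply: igrS If => //; apply: subset_itv => //; rewrite bnd_simp//.
by move=> <-; rewrite addrC subrK.
Qed.

(** [u] is locally absolutely continuous on the open half-line with density [g]. The formula holds
    at every pair of points, so [u] is the continuous representative, while [g] matters only up to a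
    null set. *)
Definition prim u g := locigr g /\
  forall a b, 0 < a -> a <= b -> u b - u a = \int[mu]_(x in `[a, b]) g x.

Lemma prim_meas_dens u g : prim u g -> measurable_fun H g.
Proof.
move=> [Ig _].
have -> : H = \bigcup_n (`[n.+1%:R^-1, n.+1%:R]%classic : set R).
  apply/seteqP; split=> r.
    rewrite inH => r0; pose N := Num.truncn (r + r^-1).
    have N1 : r + r^-1 <= N.+1%:R by rewrite ltW// /N truncnS_gt.
    have i0 : 0 < r^-1 by rewrite invr_gt0.
    exists N => //=; rewrite in_itv/=; apply/andP; split; last by lra.
    by rewrite invf_ple ?posrE//; lra.
  by move=> [n _]; apply: itvH.
apply/measurable_fun_bigcup => [n|n]; first exact: mitv.
by apply: igr_meas; exact: Ig.
Qed.

Lemma prim_cont u g : prim u g -> forall x : R, 0 < x -> {for x, continuous u}.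
Proof.
move=> [Ig ug] x x0; pose a := x / 2; pose b := x + 1.
have a0 : 0 < a by rewrite divr_gt0.
have ab : a <= b by rewrite /a /b; lra.
have := parameterized_integral_continuous ab (Ig a b a0).
have ab' : a < b by rewrite /a /b; lra.
move=> /(continuous_within_itvP _ ab')[+ _ _].
have xab : x \in `]a, b[ by rewrite in_itv/= /a /b; apply/andP; split; lra.
move=> /(_ x xab) cx.
apply: (@cvg_trans _ ((fun y => u a + parameterized_integral mu a y g) @ x)); last first.
  have -> : u x = u a + parameterized_integral mu a x g.
    rewrite /parameterized_integral -ug//; first by rewrite addrC subrK.
    by rewrite /a; lra.
  exact: (cvgD (cvg_cst (u a)) cx).
apply: near_eq_cvg; near=> y.
rewrite /parameterized_integral -ug//; first by rewrite addrC subrK.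
near: y; exists (x - a); first by rewrite /= /a; lra.
by move=> z /=; rewrite ltr_norml => /andP[h1 h2]; lra.
Unshelve. all: by end_near. Qed.

Lemma cont_meas u : (forall x : R, 0 < x -> {for x, continuous u}) -> measurable_fun H u.
Proof.
move=> cu; apply: open_continuous_measurable_fun; first exact: interval_open.
by move=> x; rewrite inE inH; exact: cu.
Qed.

Lemma cont_locigr u : (forall x : R, 0 < x -> {for x, continuous u}) -> locigr u.
Proof.
move=> cu a b a0; apply: continuous_compact_integrable; first exact: segment_compact.
apply: continuous_in_subspaceT => x; rewrite inE /= in_itv/= => /andP[ax _].
by apply: cu; exact: lt_le_trans ax.
Qed.

Lemma prim_meas u g : prim u g -> measurable_fun H u.
Proof. by move=> ug; apply: cont_meas; exact: prim_cont ug. Qed.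

Lemma primD u v g k : prim u g -> prim v k ->
  prim (fun x => u x + v x) (fun x => g x + k x).
Proof.
move=> [Ig ug] [Ik vk]; split=> [a b a0|a b a0 ab].
  by apply: igrD; [exact: mitv|exact: Ig|exact: Ik].
rewrite (RintD (mitv a b) (Ig a b a0) (Ik a b a0)) -ug// -vk//; ring.
Qed.

Lemma primZ c u g : prim u g -> prim (fun x => c * u x) (fun x => c * g x).
Proof.
move=> [Ig ug]; split=> [a b a0|a b a0 ab].
  by apply: igrZ; [exact: mitv|exact: Ig].
rewrite (RintZ _ (mitv a b) (Ig a b a0)) -ug//; ring.
Qed.

Lemma prim_ext u v g k : (forall x : R, 0 < x -> u x = v x) ->
  (forall x : R, 0 < x -> g x = k x) -> prim u g -> prim v k.
Proof.
move=> uv gk [Ig ug].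
have gkab a b : 0 < a -> {in `[a, b]%classic, g =1 k}.
  by move=> a0 x; rewrite inE => /(itvH a0); rewrite inH; exact: gk.
split=> [a b a0|a b a0 ab].
  by apply: igr_eq (Ig a b a0); [exact: mitv|exact: gkab].
rewrite -!uv//; last exact: lt_le_trans ab.
by rewrite ug//; apply: eq_Rintegral; exact: gkab.
Qed.

Lemma prim_C1 u g : (forall x : R, 0 < x -> is_derive x 1 u (g x)) ->
  (forall x : R, 0 < x -> {for x, continuous g}) -> prim u g.
Proof.
move=> dug cg; split; first exact: cont_locigr.
move=> a b a0; rewrite le_eqVlt => /predU1P[<-|ab].
  by rewrite subrr set_itv1 Rintegral_set1.
have cu x : 0 < x -> {for x, continuous u}.
  move=> x0; have du := dug x x0.
  by apply: differentiable_continuous; apply/derivable1_diffP; case: du.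
rewrite /Rintegral (@continuous_FTC2 _ g u a b ab)//.
- apply: continuous_in_subspaceT => x; rewrite inE /= in_itv/= => /andP[ax _].
  by apply: cg; exact: lt_le_trans ax.
- split.
  + move=> x; rewrite in_itv/= => /andP[ax _].
    by case: (dug x (lt_trans a0 ax)).
  + by apply: cvg_at_right_filter; exact: cu.
  + by apply: cvg_at_left_filter; apply: cu; exact: lt_trans ab.
- move=> x; rewrite in_itv/= => /andP[ax _].
  by have du := dug x (lt_trans a0 ax); rewrite derive1E; exact: derive_val.
Qed.

(** Continuous induction: the supremum of the points reached from [a] is itself reached, and the
    local hypothesis there carries the bound further to the right unless this point is [b]. *)
Lemma local_to_global (D V : R -> R) a b : a <= b ->
  (forall x, a <= x <= b -> exists2 d : R, 0 < d &
     forall p q, a <= p -> p <= q -> q <= b -> `|p - x| < d -> `|q - x| < d ->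
       `|D q - D p| <= V q - V p) ->
  `|D b - D a| <= V b - V a.
Proof.
move=> ab loc.
pose S := [set x | a <= x <= b /\ `|D x - D a| <= V x - V a].
have Sa : S a by rewrite /S/= lexx ab !subrr normr0.
have Sb : has_sup S by split; [exists a|exists b => x [/andP[]]].
pose c := sup S.
have ac : a <= c by exact: sup_upper_bound.
have cb : c <= b by apply: ge_sup; [exists a|move=> x [/andP[]]].
have /loc[d d0 dP] : a <= c <= b by rewrite ac cb.
have [y Sy cdy] : exists2 y, S y & c - d < y by exact: sup_adherent.
have yc : y <= c by exact: sup_upper_bound.
have [/andP[ay yb] yV] := Sy.
have step q : c <= q -> q < c + d -> q <= b -> S q.
  move=> cq qd qb; split; first by rewrite (le_trans ac cq).
  have h1 : `|y - c| < d by rewrite ltr_norml; apply/andP; split; lra.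
  have h2 : `|q - c| < d by rewrite ltr_norml; apply/andP; split; lra.
  have h := dP y q ay (le_trans yc cq) qb h1 h2.
  have -> : D q - D a = (D q - D y) + (D y - D a) by ring.
  by apply: le_trans (ler_normD _ _) _; lra.
have [<-|cNb] := eqVneq c b; first by have [] := step c (lexx c) _ cb; lra.
have cltb : c < b by rewrite lt_neqAle cNb.
(* A point strictly beyond the supremum [c] that the local bound still reaches. *)
pose q := Num.min b (c + d / 2).
have cq : c < q by rewrite lt_min cltb/=; lra.
have : q <= c by apply: sup_upper_bound => //; apply: step; rewrite ?(ltW cq)//;
  rewrite ?gt_min ?ge_min ?lexx//; apply/orP; right; lra.
lra.
Qed.

Lemma cont_bounded (w : R -> R) a b : (forall x : R, 0 < x -> {for x, continuous w}) -> 0 < a ->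
  exists M : R, forall x : R, a <= x <= b -> `|w x| <= M.
Proof.
move=> cw a0; have [ab|ba] := leP a b; last first.
  by exists 0 => x /andP[ax xb]; have := le_trans ax xb; rewrite leNgt ba.
have cwab : {within `[a, b], continuous w}.
  apply: continuous_in_subspaceT => x; rewrite inE /= in_itv/= => /andP[ax _].
  by apply: cw; exact: lt_le_trans ax.
have [M1 _ h1] := EVT_max ab cwab; have [M2 _ h2] := EVT_min ab cwab.
exists (`|w M1| + `|w M2|) => x xab.
have := h1 x; have := h2 x; rewrite in_itv/= => /(_ xab) A /(_ xab) B.
rewrite ler_norml; apply/andP; split.
  have := ler_norm (- w M2); rewrite normrN; have := normr_ge0 (w M1); lra.
by have := ler_norm (w M1); have := normr_ge0 (w M2); lra.
Qed.

Lemma locigrM (w : R -> R) f : (forall x : R, 0 < x -> {for x, continuous w}) ->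
  locigr f -> locigr (fun x => f x * w x).
Proof.
move=> cw If a b a0; have [M HM] := cont_bounded b cw a0.
apply: (igr_le (mitv a b) _ _ (igrZ M (mitv a b) (igr_norm (If a b a0)))).
  apply: measurable_funM; first by apply: igr_meas; exact: If.
  by apply: measurable_funS (cont_meas cw); [exact: mH|exact: itvH].
move=> x; rewrite /= in_itv/= => xab.
by rewrite normrM mulrC ler_wpM2r// HM.
Qed.

Lemma norm_sub_half a b c (e : R) :
  `|c - a| < e / 2 -> `|c - b| < e / 2 -> `|a - b| <= e.
Proof.
by rewrite !ltr_norml ler_norml => /andP[? ?] /andP[? ?]; apply/andP; split; lra.
Qed.

(** Integration by parts for absolutely continuous functions, which need not be differentiable
    anywhere in particular. On [[p, q]] the defect [D] of the formula increases by the integral of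
    [g (v q - v) + k (u p - u)], and continuity makes this at most [e] times the increment of [V].
    By [local_to_global] the total defect is at most [e V b], for every [e]. *)
Lemma primM u v g k : prim u g -> prim v k ->
  prim (fun x => u x * v x) (fun x => g x * v x + u x * k x).
Proof.
move=> pu pv; have [[Ig ug] [Ik vk]] := (pu, pv).
have cu := prim_cont pu; have cv := prim_cont pv.
have Igk : locigr (fun x => g x * v x + u x * k x).
  move=> a b a0; apply: igrD; first exact: mitv.
    exact: locigrM.
  have -> : (fun x => u x * k x) = (fun x => k x * u x).
    by apply/funext => x; rewrite mulrC.
  exact: locigrM.
split=> // a b a0 ab.
pose D x := u x * v x - \int[mu]_(y in `[a, x]) (g y * v y + u y * k y).
suff : D b = D a.
  rewrite /D [in X in _ = X]set_itv1 Rintegral_set1 subr0 => h.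
  by rewrite -h; ring.
pose V x := \int[mu]_(y in `[a, x]) (`|g y| + `|k y|).
have IV p q : 0 < p -> igr `[p, q] (fun y => `|g y| + `|k y|).
  by move=> p0; apply: igrD; [exact: mitv|exact: igr_norm (Ig _ _ p0)|exact: igr_norm (Ik _ _ p0)].
have main (e : R) : 0 < e -> `|D b - D a| <= e * V b - e * V a.
  move=> e0; apply: (@local_to_global D (fun x => e * V x) a b ab) => x /andP[ax xb].
  have x0 : 0 < x by exact: lt_le_trans ax.
  have := cu x x0; move/cvgrPdist_lt => /(_ (e / 2) (divr_gt0 e0 (ltr0Sn _ _))).
  have := cv x x0; move/cvgrPdist_lt => /(_ (e / 2) (divr_gt0 e0 (ltr0Sn _ _))).
  move=> cvx cux; have [d /= d0 dP] := filterI cux cvx.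
  exists d => // p q ap pq qb px qx.
  have p0 : 0 < p by exact: lt_le_trans ap.
  have DE : D q - D p = \int[mu]_(y in `[p, q]) (g y * (v q - v y) + k y * (u p - u y)).
    rewrite /D (Rint_chasles ap pq (Igk a q a0)).
    have -> : (fun y => g y * (v q - v y) + k y * (u p - u y))
        = (fun y => (v q * g y + u p * k y) - (g y * v y + u y * k y)).
      by apply/funext => y; ring.
    have I1 := igrZ (v q) (mitv p q) (Ig p q p0).
    have I2 := igrZ (u p) (mitv p q) (Ik p q p0).
    rewrite (RintB (mitv p q) (igrD (mitv p q) I1 I2) (Igk p q p0)).
    rewrite (RintD (mitv p q) I1 I2) (RintZ _ (mitv p q) (Ig p q p0)).
    rewrite (RintZ _ (mitv p q) (Ik p q p0)) -ug// -vk//; ring.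
  have IJ : igr `[p, q] (fun y => g y * (v q - v y) + k y * (u p - u y)).
    have -> : (fun y => g y * (v q - v y) + k y * (u p - u y))
        = (fun y => (v q * g y + u p * k y) - (g y * v y + u y * k y)).
      by apply/funext => y; ring.
    apply: igrB (mitv p q) (igrD (mitv p q) _ _) (Igk p q p0).
      exact: igrZ (mitv p q) (Ig p q p0).
    exact: igrZ (mitv p q) (Ik p q p0).
  rewrite DE -mulrBr /V (Rint_chasles ap pq (IV a q a0)) addrC addKr.
  apply: le_trans (norm_Rint_le (mitv p q) IJ) _.
  rewrite -(RintZ _ (mitv p q) (IV p q p0)).
  apply: le_Rint (igr_norm IJ) (igrZ e (mitv p q) (IV p q p0)) _; first exact: mitv.
  move=> y; rewrite /= in_itv/= => /andP[py yq].
  have near_x z : p <= z -> z <= q -> `|u x - u z| < e / 2 /\ `|v x - v z| < e / 2.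
    move=> pz zq; apply: dP; rewrite /= -normrN opprB.
    move: px qx pz zq; clear; rewrite !ltr_norml => /andP[? ?] /andP[? ?] ? ?.
    by apply/andP; split; lra.
  have [[[u1 v1] [u2 v2]] [u3 v3]] := (near_x y py yq, near_x p (lexx p) pq, near_x q pq (lexx q)).
  apply: le_trans (ler_normD _ _) _; rewrite !normrM mulrDr.
  apply: lerD; rewrite mulrC ler_wpM2r//; first exact: norm_sub_half v3 v1.
  exact: norm_sub_half u2 u1.
have Va : V a = 0 by rewrite /V set_itv1 Rintegral_set1.
have Vb : 0 <= V b by apply: Rintegral_ge0 => y _; rewrite addr_ge0.
apply/eqP; rewrite -subr_eq0 -normr_le0; apply/ler_addgt0Pr => e e0; rewrite add0r.
(* Adding 1 to [V b] covers the case where it is 0. *)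
have := main (e / (V b + 1)); rewrite Va mulr0 subr0 => h.
apply: le_trans (h _) _; first by rewrite divr_gt0//; lra.
rewrite mulrAC ler_pdivrMr; last lra.
by rewrite ler_pM2l//; lra.
Qed.

End Primitives.

(** * Shifts, total derivatives and Steklov means *)

Section Shift.
Context {R : realType}.
Local Notation mu := (@lebesgue_measure R).
Local Notation H := (`]0%R, +oo[%classic : set R).
Implicit Types (u v g k f : R -> R) (a b c h : R).

Definition sh h : measurableTypeR R -> measurableTypeR R := fun x => x + h.

Lemma msh h : measurable_fun [set: measurableTypeR R] (sh h).
Proof. by apply: measurable_funD => //; exact: measurable_cst. Qed.

Lemma sh_preimage h (A : set R) : measurable A -> measurable (sh h @^-1` A).
Proof. by move=> mA; rewrite -[X in measurable X]setTI; exact: msh. Qed.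

(** The image of [mu] under the translation agrees with [mu] on half-open intervals, which determine
    it. *)
Lemma mu_shift h (A : set R) : measurable A -> mu (sh h @^-1` A) = mu A.
Proof.
move=> mA.
pose nu : {measure set (measurableTypeR R) -> \bar R} := pushforward mu (sh h).
rewrite [RHS](@lebesgue_measure_unique R (nu (msh h)))// => X [[x y] _ <-].
rewrite /nu/= /pushforward.
have -> : sh h @^-1` `]x, y] = `]x - h, y - h]%classic.
  by apply/seteqP; split=> z /=; rewrite !in_itv/= /sh ltrBlDr lerBrDr.
by rewrite !lebesgue_measure_itv/= !lte_fin ltrD2r -!EFinB (_ : y - h - (x - h) = y - x)//; ring.
Qed.

Lemma ge0_int_shift h (D : set R) (f : R -> \bar R) : measurable D ->
  measurable_fun D f -> (forall x, D x -> 0 <= f x)%E ->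
  (\int[mu]_(x in sh h @^-1` D) f (x + h)%R = \int[mu]_(x in D) f x)%E.
Proof.
move=> mD mf f0.
have := @ge0_integral_pushforward _ _ _ _ R (sh h) (msh h) mu D f mD mf.
rewrite /comp/= => <-; last by move=> y; rewrite inE; exact: f0.
apply: eq_measure_integral => [|mp A mA _]; first exact: msh.
exact: mu_shift.
Qed.

Lemma meas_shift h (D : set R) f : measurable D -> measurable_fun D f ->
  measurable_fun (sh h @^-1` D) (fun x => f (x + h)).
Proof.
move=> mD mf; apply: (@measurable_comp _ _ _ _ _ _ D _ _ (sh h)) => //.
  by move=> _ [x Dx <-].
by apply: measurable_funTS; exact: msh.
Qed.

Lemma igr_shift h (D : set R) f : measurable D -> igr D f ->
  igr (sh h @^-1` D) (fun x => f (x + h)).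
Proof.
move=> mD If; have mf := igr_meas If.
apply/integrableP; split; first by apply/measurable_EFinP; exact: meas_shift.
have /integrableP[_] := If; congr (_ < _)%E.
rewrite -(ge0_int_shift h mD)//.
by apply: measurableT_comp => //; exact/measurable_EFinP.
Qed.

Lemma Rint_shift h (D : set R) f : measurable D -> igr D f ->
  \int[mu]_(x in sh h @^-1` D) f (x + h) = \int[mu]_(x in D) f x.
Proof.
move=> mD If; have mf : measurable_fun D (EFin \o f) by apply/measurable_EFinP; exact: igr_meas.
rewrite /Rintegral; congr fine; rewrite integralE [RHS]integralE.
congr (_ - _)%E.
  rewrite -(ge0_int_shift h mD); [|exact: measurable_funepos|by move=> x _; exact: funepos_ge0].
  by apply: eq_integral => x _; rewrite !funeposE.
rewrite -(ge0_int_shift h mD); [|exact: measurable_funeneg|by move=> x _; exact: funeneg_ge0].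
by apply: eq_integral => x _; rewrite !funenegE.
Qed.

Lemma sh_itv h a b : sh h @^-1` `[a + h, b + h] = `[a, b]%classic.
Proof. by apply/seteqP; split=> z /=; rewrite !in_itv/= /sh !lerD2r. Qed.

Lemma ae_shift h (P : R -> Prop) : {ae mu, forall x, P x} -> {ae mu, forall x, P (x + h)}.
Proof.
move=> [N [mN N0 PN]]; exists (sh h @^-1` N); split.
- exact: sh_preimage.
- exact: etrans (mu_shift h mN) N0.
- by move=> x /= Px; apply: PN.
Qed.

Lemma prim_shift h u g : 0 <= h -> prim u g ->
  prim (fun x => u (x + h)) (fun x => g (x + h)).
Proof.
move=> h0 [Ig ug]; split=> [a b a0|a b a0 ab].
  rewrite -(sh_itv h); apply: igr_shift; first exact: mitv.
  by apply: Ig; rewrite ltr_wpDr.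
rewrite ug ?lerD2r// ?ltr_wpDr// -(@Rint_shift h); [|exact: mitv|].
  by rewrite sh_itv.
by apply: Ig; rewrite ltr_wpDr.
Qed.

(** The translation brings mass closer to 0, where the weight [r] is smaller, so the norm does not
    increase. *)
Lemma sq_shift h v : 0 <= h -> sq v ->
  sq (fun r => v (r + h)) /\ N2 (fun r => v (r + h)) <= N2 v.
Proof.
move=> h0 [mv Iv].
have HS : H `<=` sh h @^-1` H by move=> r; rewrite /preimage/= !in_itv/= !andbT /sh => r0; lra.
have mv' : measurable_fun H (fun r => v (r + h)).
  by apply: measurable_funS (meas_shift (h := h) (mH (R := R)) mv) => //; exact: sh_preimage.
pose Dh : set R := sh h @^-1` H `&` H.
have mDh : measurable (sh (- h) @^-1` H) by exact: sh_preimage.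
have DhH : sh (- h) @^-1` H `<=` H by move=> r; rewrite /preimage/= !in_itv/= !andbT /sh => r0; lra.
have Iv' : igr (sh (- h) @^-1` H) (fun r => r * v r ^+ 2) by apply: igrS Iv.
have SS : sh h @^-1` (sh (- h) @^-1` H) = H.
  by apply/seteqP; split=> r; rewrite /preimage/= !in_itv/= /sh addrK.
have I2 : igr H (fun r => (r + h) * v (r + h) ^+ 2).
  by rewrite -[X in igr X _]SS; exact: (igr_shift h mDh Iv').
have key (r : R) : 0 < r -> r * v (r + h) ^+ 2 <= (r + h) * v (r + h) ^+ 2.
  by move=> r0; rewrite ler_wpM2r ?sqr_ge0//; lra.
have I1 : igr H (fun r => r * v (r + h) ^+ 2).
  apply: (igr_le (mH (R := R)) _ _ I2); first exact: measurable_wsq.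
  by move=> r; rewrite inH => r0; rewrite ger0_norm ?key// mulr_ge0 ?sqr_ge0 ?ltW.
split=> //; rewrite /N2.
apply: (@le_trans _ _ (\int[mu]_(r in H) ((r + h) * v (r + h) ^+ 2))).
  by apply: le_Rint => //; move=> r; rewrite inH; exact: key.
rewrite -[X in Rintegral _ X _ <= _]SS (Rint_shift h mDh Iv').
apply: le_Rint_set => //.
by move=> r; rewrite inH => r0; rewrite mulr_ge0 ?sqr_ge0 ?ltW.
Qed.

End Shift.

(** * Integrals over the half-line and vanishing of boundary terms *)

Section Halfline.
Context {R : realType}.
Local Notation mu := (@lebesgue_measure R).
Local Notation H := (`]0%R, +oo[%classic : set R).
Implicit Types (u v g k f : R -> R) (a b c h : R).

Definition Hn (n : nat) : set R := `[n.+1%:R^-1, n.+1%:R]%classic.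

Lemma Hn_cover : \bigcup_n Hn n = H.
Proof.
apply/seteqP; split=> r; first by move=> [n _]; apply: itvH.
rewrite inH => r0; pose N := Num.truncn (r + r^-1).
have N1 : r + r^-1 <= N.+1%:R by rewrite ltW// /N truncnS_gt.
have i0 : 0 < r^-1 by rewrite invr_gt0.
exists N => //; rewrite /Hn/= in_itv/=; apply/andP; split; last by lra.
by rewrite invf_ple ?posrE//; lra.
Qed.

Lemma Hn_nd : nondecreasing_seq Hn.
Proof.
apply/nondecreasing_seqP => n; apply/subsetPset; apply: subset_itv; rewrite bnd_simp.
  by rewrite lef_pV2 ?posrE// ler_nat.
by rewrite ler_nat.
Qed.

Lemma mHn n : measurable (Hn n).
Proof. exact: mitv. Qed.

Lemma HnH n : Hn n `<=` H.
Proof. exact: itvH. Qed.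

Lemma Hn_le n : n.+1%:R^-1 <= n.+1%:R :> R.
Proof. by rewrite (@le_trans _ _ 1)// ?invf_le1// ler1n. Qed.

Lemma ge0_igr_H g (M : R) : measurable_fun H g -> (forall x : R, 0 < x -> 0 <= g x) ->
  (forall a b, 0 < a -> a <= b -> igr `[a, b] g /\ \int[mu]_(x in `[a, b]) g x <= M) ->
  igr H g /\ \int[mu]_(x in H) g x <= M.
Proof.
move=> mg g0 gM.
have mge : measurable_fun H (EFin \o g) by exact/measurable_EFinP.
have cv : (\int[mu]_(x in Hn i) (g x)%:E @[i --> \oo] --> \int[mu]_(x in H) (g x)%:E)%E.
  rewrite -Hn_cover; apply: ge0_nondecreasing_set_cvg_integral.
  - exact: Hn_nd.
  - exact: mHn.
  - by move=> i; apply: measurable_funS mge; [exact: mH|exact: HnH].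
  - by move=> i x /HnH; rewrite inH lee_fin; exact: g0.
have IM : (\int[mu]_(x in H) (g x)%:E <= M%:E)%E.
  rewrite -(cvg_lim _ cv)//; apply: lime_le; first by apply/cvg_ex; eexists; exact: cv.
  apply: nearW => n.
  have i0 : 0 < n.+1%:R^-1 :> R by rewrite invr_gt0.
  have [In InM] := gM _ _ i0 (Hn_le n).
  by rewrite -lee_fin in InM; apply: le_trans InM; rewrite (EFin_Rint (mHn n)).
have Ig : igr H g.
  apply/integrableP; split=> //; apply: le_lt_trans (ltry M); apply: le_trans IM.
  apply: ge0_le_integral => //; first exact/measurableT_comp.
  by move=> x; rewrite inH => x0 /=; rewrite ger0_norm// g0.
by split=> //; rewrite -lee_fin (EFin_Rint (mH (R := R))).
Qed.

(** The integral over a compact interval is an increment of [u]. Explicit weights are shown to be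
    integrable in this way, by exhibiting a bounded primitive. *)
Lemma prim_bdd u g (m M : R) : prim u g -> (forall x : R, 0 < x -> 0 <= g x) ->
  (forall x : R, 0 < x -> m <= u x <= M) -> igr H g /\ \int[mu]_(x in H) g x <= M - m.
Proof.
move=> pu g0 ub; apply: ge0_igr_H => //; first exact: prim_meas_dens pu.
move=> a b a0 ab; split; first by case: pu => Ig _; exact: Ig.
case: pu => _ <-//.
by have /andP[? ?] := ub a a0; have /andP[? ?] := ub b (lt_le_trans a0 ab); lra.
Qed.

Lemma ge0_Rint_sub g a b : igr H g -> (forall x : R, 0 < x -> 0 <= g x) -> 0 < a ->
  \int[mu]_(x in `[a, b]) g x <= \int[mu]_(x in H) g x.
Proof.
move=> Ig g0 a0; apply: le_Rint_set => //; first exact: itvH.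
by move=> x; rewrite inH; exact: g0.
Qed.

Lemma ltr_sub_tail (A B C e : R) : A + B - C < e -> C <= A -> B < e.
Proof. lra. Qed.

(** One parameter serves both ends: [[a, b]] only has to contain [[d, d^-1]]. *)
Lemma Rint_tail G (e : R) : igr H G -> 0 < e -> exists2 d : R, 0 < d <= 1 &
  forall a b, 0 < a -> a <= d -> d^-1 <= b ->
    `|\int[mu]_(x in H) G x - \int[mu]_(x in `[a, b]) G x| < e.
Proof.
move=> IG e0.
have IA : igr H (fun x => `|G x|) by exact: igr_norm.
have ma : measurable_fun H (EFin \o (fun x => `|G x|)).
  by apply/measurable_EFinP; exact: igr_meas.
have cv : (\int[mu]_(x in Hn i) (`|G x|)%:E @[i --> \oo] -->
    \int[mu]_(x in H) (`|G x|)%:E)%E.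
  rewrite -Hn_cover; apply: ge0_nondecreasing_set_cvg_integral.
  - exact: Hn_nd.
  - exact: mHn.
  - by move=> i; apply: measurable_funS ma; [exact: mH|exact: HnH].
  - by move=> i x _; rewrite lee_fin.
have cvR : \int[mu]_(x in Hn i) `|G x| @[i --> \oo] --> \int[mu]_(x in H) `|G x|.
  by apply: fine_cvg; rewrite (EFin_Rint (mH (R := R))).
have /cvgrPdist_lt /(_ e e0) [n _ /(_ n (leqnn n))/= nP] := cvR.
exists n.+1%:R^-1; first by rewrite invr_gt0 ltr0n invf_le1// ler1n.
move=> a b a0 ad db; rewrite invrK in db.
have Hnab : Hn n `<=` `[a, b] by apply: subset_itv; rewrite bnd_simp.
have mD : measurable (H `\` `[a, b]) by apply: measurableD; [exact: mH|exact: mitv].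
have HE : `[a, b]%classic `|` (H `\` `[a, b]) = H by apply: setDUK; exact: itvH.
have dis : [disjoint `[a, b]%classic & H `\` `[a, b]].
  by apply/disj_set2P; rewrite setDIK.
have spl f : igr H f -> \int[mu]_(x in H) f x =
    \int[mu]_(x in `[a, b]) f x + \int[mu]_(x in H `\` `[a, b]) f x.
  move=> If; rewrite -[in LHS]HE Rintegral_setU// ?HE//.
have ID f : igr H f -> igr (H `\` `[a, b]) f.
  by apply: igrS => //; exact: subDsetl.
rewrite (spl _ IG) addrC addKr.
apply: le_lt_trans (norm_Rint_le mD (ID _ IG)) _.
have E := spl _ IA.
have le1 : \int[mu]_(x in Hn n) `|G x| <= \int[mu]_(x in `[a, b]) `|G x|.
  have Iab : igr `[a, b] (fun x => `|G x|).
    by apply: igrS IA; [exact: mitv|exact: mH|exact: itvH].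
  have In : igr (Hn n) (fun x => `|G x|).
    by apply: igrS IA; [exact: mHn|exact: mH|exact: HnH].
  by apply: le_Rint_set => //; exact: mHn.
move: nP; rewrite E ltr_norml => /andP[_ h1]; exact: ltr_sub_tail h1 le1.
Qed.

Lemma prim_ln : prim (@ln R) (fun x => x^-1).
Proof.
apply: prim_C1.
by move=> x x0; apply: inv_continuous; rewrite gt_eqF.
Qed.

(** If [|Phi|] stayed above [e] on []0, d]], the integral of [|Phi| / r] over [[a, d]] would be at
    least [e ln (d / a)], which is unbounded as [a] tends to 0. *)
Lemma igr_div_small0 (Phi : R -> R) (e d : R) : measurable_fun H Phi ->
  igr H (fun r => Phi r / r) -> 0 < e -> 0 < d ->
  exists2 a : R, 0 < a <= d & `|Phi a| < e.
Proof.
move=> mP IP e0 d0; apply: contrapT => hN.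
have big (a : R) : 0 < a -> a <= d -> e <= `|Phi a|.
  by move=> a0 ad; rewrite leNgt; apply/negP => h; apply: hN; exists a => //; rewrite a0.
have IA := igr_norm IP; set M := \int[mu]_(x in H) `|Phi x / x| in IA *.
have key (a : R) : 0 < a -> a <= d -> e * (ln d - ln a) <= M.
  move=> a0 ad; have [Il lE] := prim_ln; rewrite lE//.
  rewrite -(RintZ _ (mitv a d) (Il a d a0)).
  apply: le_trans (_ : _ <= \int[mu]_(x in `[a, d]) `|Phi x / x|) _.
    apply: le_Rint; [exact: mitv|exact: igrZ (mitv a d) (Il a d a0)| |].
      by apply: igrS IA; [exact: mitv|exact: mH|exact: itvH].
    move=> x; rewrite /= in_itv/= => /andP[ax xd].
    have x0 : 0 < x by exact: lt_le_trans ax.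
    rewrite normrM [`|x^-1|]gtr0_norm ?invr_gt0//.
    by apply: ler_wpM2r; [rewrite invr_ge0 ltW|exact: big].
  by apply: ge0_Rint_sub.
(* Chosen so that [e (ln d - ln a) = M + 1], which exceeds the bound [M]. *)
pose a := expR (ln d - (M + 1) / e).
have M0 : 0 <= M by apply: Rintegral_ge0.
have q0 : 0 < (M + 1) / e by rewrite divr_gt0//; lra.
have a0 : 0 < a by exact: expR_gt0.
have ad : a <= d by rewrite -[leRHS]lnK ?posrE// ler_expR; lra.
have := key a a0 ad; rewrite /a expRK.
have -> : e * (ln d - (ln d - (M + 1) / e)) = M + 1 by field; rewrite gt_eqF.
lra.
Qed.

Lemma igr_div_smally (Phi : R -> R) (e d : R) : measurable_fun H Phi ->
  igr H (fun r => Phi r / r) -> 0 < e -> 0 < d ->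
  exists2 b : R, d <= b & `|Phi b| < e.
Proof.
move=> mP IP e0 d0; apply: contrapT => hN.
have big (b : R) : d <= b -> e <= `|Phi b|.
  by move=> db; rewrite leNgt; apply/negP => h; apply: hN; exists b.
have IA := igr_norm IP; set M := \int[mu]_(x in H) `|Phi x / x| in IA *.
have key (b : R) : d <= b -> e * (ln b - ln d) <= M.
  move=> db; have [Il lE] := prim_ln; rewrite lE//.
  rewrite -(RintZ _ (mitv d b) (Il d b d0)).
  apply: le_trans (_ : _ <= \int[mu]_(x in `[d, b]) `|Phi x / x|) _.
    apply: le_Rint; [exact: mitv|exact: igrZ (mitv d b) (Il d b d0)| |].
      by apply: igrS IA; [exact: mitv|exact: mH|exact: itvH].
    move=> x; rewrite /= in_itv/= => /andP[dx xb].
    have x0 : 0 < x by exact: lt_le_trans dx.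
    rewrite normrM [`|x^-1|]gtr0_norm ?invr_gt0//.
    by apply: ler_wpM2r; [rewrite invr_ge0 ltW|exact: big].
  by apply: ge0_Rint_sub.
pose b := expR (ln d + (M + 1) / e).
have M0 : 0 <= M by apply: Rintegral_ge0.
have q0 : 0 < (M + 1) / e by rewrite divr_gt0//; lra.
have db : d <= b by rewrite -[leLHS]lnK ?posrE// ler_expR; lra.
have := key b db; rewrite /b expRK.
have -> : e * (ln d + (M + 1) / e - ln d) = M + 1 by field; rewrite gt_eqF.
lra.
Qed.

(* Both ends contribute nothing: since dr/r has infinite mass near 0 and near
   infinity, Phi takes arbitrarily small values there. *)
Lemma prim_int0 Phi G : prim Phi G -> igr H G -> igr H (fun r => Phi r / r) ->
  \int[mu]_(r in H) G r = 0.
Proof.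
move=> pP IG IP; have mP := prim_meas pP.
apply/eqP; rewrite -normr_le0; apply/ler_addgt0Pr => e e0; rewrite add0r.
have e4 : 0 < e / 4 by rewrite divr_gt0.
have [d /andP[d0 d1] dP] := Rint_tail IG e4.
have [a /andP[a0 ad] Pa] := igr_div_small0 mP IP e4 d0.
have di0 : 0 < d^-1 by rewrite invr_gt0.
have [b db Pb] := igr_div_smally mP IP e4 di0.
have d1' : 1 <= d^-1 by rewrite invf_ge1.
have ab : a <= b by lra.
have := dP a b a0 ad db; case: pP => _ <-//.
move: Pa Pb; rewrite !ltr_norml ler_norml => /andP[? ?] /andP[? ?] /andP[? ?].
by apply/andP; split; lra.
Qed.

End Halfline.

(** * Steklov means and difference quotients *)

Section Steklov.
Context {R : realType}.
Local Notation mu := (@lebesgue_measure R).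
Local Notation H := (`]0%R, +oo[%classic : set R).
Implicit Types (u v g k f : R -> R) (a b c h r : R).

Lemma prim_ex g : locigr g -> exists V, prim V g.
Proof.
move=> Ig; exists (fun x => if 1 <= x then \int[mu]_(y in `[1, x]) g y
  else - \int[mu]_(y in `[x, 1]) g y).
split=> // a b a0 ab.
have [b1|b1] := leP 1 b; have [a1|a1] := leP 1 a.
- by rewrite (Rint_chasles a1 ab (Ig 1 b ltr01)) addrC addKr.
- by rewrite opprK (Rint_chasles (ltW a1) b1 (Ig a b a0)) addrC.
- by have := le_lt_trans (le_trans a1 ab) b1; rewrite ltxx.
- by rewrite opprK (Rint_chasles ab (ltW b1) (Ig a 1 a0)) addrC addrK.
Qed.

Lemma sq_locigr v : sq v -> locigr v.
Proof.
move=> [mv Iv] a b a0.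
have I1 : igr `[a, b] (fun=> 1).
  apply: (@cont_locigr R (fun=> 1)) => // x x0; exact: cst_continuous.
have I2 : igr `[a, b] (fun r => r * v r ^+ 2).
  by apply: igrS Iv => //; exact: itvH.
apply: (igr_le (mitv a b) _ _ (igrD (mitv a b) I1 (igrZ a^-1 (mitv a b) I2))).
  by apply: measurable_funS mv; [exact: mH|exact: itvH].
move=> x; rewrite /= in_itv/= => /andP[ax _].
have h1 : v x ^+ 2 <= a^-1 * (x * v x ^+ 2).
  by rewrite mulrA ler_peMl ?sqr_ge0// mulrC ler_pdivlMr// mul1r.
have := sqr_ge0 (`|v x| - 1); rewrite -[v x ^+ 2]real_normK ?num_real// in h1 *.
nra.
Qed.

Lemma igr_sqr v a b : sq v -> 0 < a -> igr `[a, b] (fun r => v r ^+ 2).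
Proof.
move=> [mv Iv] a0.
have I2 : igr `[a, b] (fun r => r * v r ^+ 2).
  by apply: igrS Iv => //; exact: itvH.
apply: (igr_le (mitv a b) _ _ (igrZ a^-1 (mitv a b) I2)).
  by apply: measurable_funX; apply: measurable_funS mv; [exact: mH|exact: itvH].
move=> x; rewrite /= in_itv/= => /andP[ax _].
rewrite ger0_norm ?sqr_ge0//.
by rewrite mulrA ler_peMl ?sqr_ge0// mulrC ler_pdivlMr// mul1r.
Qed.

(* The Steklov mean and the difference quotient of v. *)
Definition stk h v r := h^-1 * \int[mu]_(x in `[r, r + h]) v x.

Definition dlt h v r := h^-1 * (v (r + h) - v r).

(** The mean of [v] is the difference quotient of a primitive. Through this identity the continuity,
    the derivative and the norm of a mean reduce to statements on difference quotients. *)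
Lemma stkE h V v r : 0 <= h -> prim V v -> 0 < r -> stk h v r = dlt h V r.
Proof. by move=> h0 [_ VE] r0; rewrite /stk /dlt VE// lerDl. Qed.

Lemma stk_lin h a v w r : locigr v -> locigr w -> 0 < r ->
  stk h (fun x => a * v x + w x) r = a * stk h v r + stk h w r.
Proof.
move=> Iv Iw r0; rewrite /stk (RintD (mitv _ _) (igrZ a (mitv _ _) (Iv _ _ r0)) (Iw _ _ r0)).
rewrite (RintZ _ (mitv _ _) (Iv _ _ r0)); ring.
Qed.

Lemma dlt_lin h a v w r :
  dlt h (fun x => a * v x + w x) r = a * dlt h v r + dlt h w r.
Proof. rewrite /dlt; ring. Qed.

Lemma prim_dlt h u g : 0 <= h -> prim u g -> prim (dlt h u) (dlt h g).
Proof.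
move=> h0 pu; apply: primZ.
have := primD (prim_shift h0 pu) (primZ (-1) pu).
by apply: prim_ext => x _; ring.
Qed.

Lemma stk_cont h v : 0 <= h -> locigr v -> forall x : R, 0 < x -> {for x, continuous (stk h v)}.
Proof.
move=> h0 Iv x x0; have [V pV] := prim_ex Iv.
have := prim_cont (prim_dlt h0 pV) x0.
rewrite /prop_for /continuous_at /= (stkE h0 pV x0); apply: cvg_trans.
apply: near_eq_cvg; near=> y; rewrite (stkE h0 pV)//.
by near: y; exists x => // z; rewrite /ball_/= ltr_norml => /andP[h1 h2]; lra.
Unshelve. all: by end_near. Qed.

Lemma prim_stk h v : 0 <= h -> (forall x : R, 0 < x -> {for x, continuous v}) ->
  prim (stk h v) (dlt h v).
Proof.
move=> h0 cv; have Iv := cont_locigr cv; have [V pV] := prim_ex Iv.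
by apply: prim_ext (prim_dlt h0 pV) => // x x0; rewrite -(stkE h0 pV x0).
Qed.

Lemma Rint_cst_itv a b c : a < b -> \int[mu]_(x in `[a, b]) c = c * (b - a).
Proof.
move=> ab; rewrite Rintegral_cst//; congr (_ * _).
have E : mu `[a, b] = (b - a)%:E by rewrite lebesgue_measure_itv/= lte_fin ab EFinB.
exact: (congr1 fine E).
Qed.

Lemma stk_bound h v r c (M : R) : 0 < h -> 0 < r -> locigr v ->
  (forall x, r <= x <= r + h -> `|v x - c| <= M) -> `|stk h v r - c| <= M.
Proof.
move=> h0 r0 Iv vM.
have Ic a : igr `[r, r + h] (fun=> a).
  by apply: (@cont_locigr R (fun=> a)) => // x x0; exact: cst_continuous.
have cE a : h^-1 * \int[mu]_(x in `[r, r + h]) a = a.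
  by rewrite Rint_cst_itv ?ltrDl// [r + h]addrC addrK mulrC mulfK// gt_eqF.
have Iv' := igrB (mitv r (r + h)) (Iv r (r + h) r0) (Ic c).
have -> : stk h v r - c = h^-1 * \int[mu]_(x in `[r, r + h]) (v x - c).
  by rewrite (RintB (mitv _ _) (Iv _ _ r0) (Ic c)) mulrBr cE.
rewrite normrM gtr0_norm ?invr_gt0// -[leRHS]cE ler_pM2l ?invr_gt0//.
apply: le_trans (norm_Rint_le (mitv _ _) Iv') _.
by apply: le_Rint => //; exact: igr_norm.
Qed.

(** Jensen's inequality, from [v^2 >= 2 m v - m^2] with [m] the mean. The window lies to the right
    of [r], so the weight inside the integral is at least [r]. *)
Lemma stk_sqr_le h v r : 0 < h -> 0 < r -> sq v ->
  r * stk h v r ^+ 2 <= stk h (fun x => x * v x ^+ 2) r.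
Proof.
move=> h0 r0 sv; have Iv := sq_locigr sv; set m := stk h v r.
have mE : \int[mu]_(x in `[r, r + h]) v x = h * m.
  by rewrite /m /stk mulrA divff ?mul1r// gt_eqF.
have I2 : igr `[r, r + h] (fun x => v x ^+ 2) by exact: igr_sqr.
have I1 := Iv r (r + h) r0.
have I3 : igr `[r, r + h] (fun x => x * v x ^+ 2).
  by case: sv => _ Iw; apply: igrS Iw => //; exact: itvH.
have Ic a : igr `[r, r + h] (fun=> a).
  by apply: (@cont_locigr R (fun=> a)) => // x x0; exact: cst_continuous.
have le1 : \int[mu]_(x in `[r, r + h]) (2 * m * v x - m ^+ 2) <=
    \int[mu]_(x in `[r, r + h]) (v x ^+ 2).
  apply: le_Rint => //; first exact: (igrB (mitv _ _) (igrZ _ (mitv _ _) I1) (Ic _)).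
  by move=> x _; have := sqr_ge0 (v x - m); nra.
have le2 : r * \int[mu]_(x in `[r, r + h]) (v x ^+ 2) <=
    \int[mu]_(x in `[r, r + h]) (x * v x ^+ 2).
  rewrite -(RintZ _ (mitv _ _) I2); apply: le_Rint => //; first exact: igrZ.
  by move=> x; rewrite /= in_itv/= => /andP[rx _]; rewrite ler_wpM2r ?sqr_ge0.
move: le1; rewrite (RintB (mitv _ _) (igrZ _ (mitv _ _) I1) (Ic _)).
rewrite (RintZ _ (mitv _ _) I1) mE Rint_cst_itv ?ltrDl//.
rewrite (_ : r + h - r = h) => [le1|]; last by ring.
rewrite /stk -(ler_pM2l h0) [leRHS]mulrA divff ?mul1r ?gt_eqF//.
apply: le_trans le2; rewrite mulrCA ler_pM2l//; lra.
Qed.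

(** With [V] a primitive of [r v^2], the previous lemma dominates the integrand by [dlt h V]. A
    primitive of the latter is [stk h V], whose oscillation is at most [2 N2 v]; no exchange of
    integrals is involved. *)
Lemma sq_stk h v : 0 < h -> sq v -> sq (stk h v) /\ N2 (stk h v) <= 2 * N2 v.
Proof.
move=> h0 sv; have Iv := sq_locigr sv.
have ms : measurable_fun H (stk h v) by apply: cont_meas; apply: stk_cont => //; exact: ltW.
case: (sv) => mv Iw; set w := (fun r => r * v r ^+ 2) in Iw.
have w0 : forall x : R, 0 < x -> 0 <= w x by move=> x x0; rewrite mulr_ge0 ?sqr_ge0 ?ltW.
have lw : locigr w by move=> a b a0; apply: igrS Iw => //; exact: itvH.
have [V pV] := prim_ex lw.
have Vb x y : 0 < x -> x <= y -> 0 <= V y - V x <= N2 v.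
  move=> x0 xy; case: pV => _ ->//; apply/andP; split; last exact: ge0_Rint_sub.
  apply: Rintegral_ge0 => z; rewrite /= in_itv/= => /andP[xz _].
  by apply: w0; exact: lt_le_trans xz.
have cV := prim_cont pV; have lV := cont_locigr cV.
have pX := prim_stk (ltW h0) cV.
have Vr x : 0 < x -> `|V x - V 1| <= N2 v.
  move=> x0; have [x1|x1] := leP 1 x; first by rewrite ger0_norm; have /andP[] := Vb 1 x ltr01 x1.
  by rewrite distrC ger0_norm; have /andP[] := Vb x 1 x0 (ltW x1).
have sb x : 0 < x -> V 1 - N2 v <= stk h V x <= V 1 + N2 v.
  move=> x0; have : `|stk h V x - V 1| <= N2 v.
    apply: stk_bound => // y /andP[xy _]; apply: Vr; exact: lt_le_trans xy.
  by rewrite ler_norml => /andP[? ?]; apply/andP; split; lra.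
have dV0 x : 0 < x -> 0 <= dlt h V x.
  move=> x0; rewrite /dlt; apply: mulr_ge0; first by rewrite invr_ge0 ltW.
  have xh : x <= x + h by rewrite lerDl ltW.
  by have /andP[] := Vb x (x + h) x0 xh.
have [IX XM] := prim_bdd pX dV0 sb.
have key r : 0 < r -> r * stk h v r ^+ 2 <= dlt h V r.
  by move=> r0; rewrite -(stkE (ltW h0) pV r0); exact: stk_sqr_le.
have Is : igr H (fun r => r * stk h v r ^+ 2).
  apply: (igr_le (mH (R := R)) _ _ IX); first exact: measurable_wsq.
  by move=> r; rewrite inH => r0; rewrite ger0_norm ?key// mulr_ge0 ?sqr_ge0 ?ltW.
split=> //; apply: le_trans (_ : _ <= \int[mu]_(r in H) dlt h V r) _.
  by apply: le_Rint => // r; rewrite inH; exact: key.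
by apply: le_trans XM _; lra.
Qed.

(** The bound blows up as [h] tends to 0. It serves to differentiate in time at a fixed [h]; bounds
    uniform in [h] come from the identity [dlt h u = stk h g] for a primitive [u] of [g]. *)
Lemma sq_dlt h v : 0 < h -> sq v -> sq (dlt h v) /\ N2 (dlt h v) <= h^-1 ^+ 2 * (4 * N2 v).
Proof.
move=> h0 sv; have [s1 n1] := sq_shift (ltW h0) sv.
have s2 := sqB s1 sv; split; first exact: sqZ.
rewrite N2Z// ler_wpM2l ?sqr_ge0//; apply: le_trans (N2_sub_le s1 sv) _; lra.
Qed.

Lemma L2d_stk h (v : R -> R -> R) v' t : 0 < h -> L2d v v' t ->
  L2d (fun s => stk h (v s)) (stk h v') t.
Proof.
move=> h0; apply: (@L2d_op R (stk h) 2) => [x|a x y r sx sy r0]; first exact: sq_stk.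
by apply: stk_lin => //; exact: sq_locigr.
Qed.

Lemma L2d_dlt h (v : R -> R -> R) v' t : 0 < h -> L2d v v' t ->
  L2d (fun s => dlt h (v s)) (dlt h v') t.
Proof.
move=> h0; apply: (@L2d_op R (dlt h) (h^-1 ^+ 2 * 4)) => [x sx|a x y r sx sy r0].
  by rewrite -mulrA; exact: sq_dlt.
exact: dlt_lin.
Qed.

Lemma stk_ae h v w r : measurable_fun H v -> measurable_fun H w -> 0 < r ->
  {ae mu, forall x : R, 0 < x -> v x = w x} -> stk h v r = stk h w r.
Proof.
move=> mv mw r0 vw; rewrite /stk; congr (_ * _).
apply: ae_eq_Rint => //.
- by apply: measurable_funS mv; [exact: mH|exact: itvH].
- by apply: measurable_funS mw; [exact: mH|exact: itvH].
- by apply: aeS vw => x vw /(itvH r0); rewrite inH.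
Qed.

Lemma dlt_ae h v w : 0 <= h -> {ae mu, forall x : R, 0 < x -> v x = w x} ->
  {ae mu, forall x : R, 0 < x -> dlt h v x = dlt h w x}.
Proof.
move=> h0 vw; apply: aeS2 vw (ae_shift h vw) => x E1 E2 x0.
by rewrite /dlt E1// E2//; lra.
Qed.

End Steklov.

(** * Weak derivatives *)

Section WeakDerivative.
Context {R : realType}.
Local Notation mu := (@lebesgue_measure R).
Local Notation H := (`]0%R, +oo[%classic : set R).
Implicit Types (u v g k f : R -> R) (a b c d h r : R).

Lemma cont_ae_le u (M : R) : (forall x : R, 0 < x -> {for x, continuous u}) ->
  {ae mu, forall x : R, 0 < x -> u x <= M} -> forall x : R, 0 < x -> u x <= M.
Proof.
move=> cu [N [mN N0 uN]] x x0; rewrite leNgt; apply/negP => Mu.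
have uM0 : 0 < u x - M by lra.
have := cu x x0; move/cvgrPdist_lt => /(_ _ uM0)[e /= e0 eP].
have sub : `]x, x + e[%classic `<=` N.
  move=> y; rewrite /= in_itv/= => /andP[xy ye]; apply: uN => /= h.
  have /h : 0 < y by lra.
  have : `|u x - u y| < u x - M by apply: eP; rewrite /= ltr_norml; apply/andP; split; lra.
  by rewrite ltr_norml => /andP[_ ?]; lra.
have : (mu (`]x, (x + e)%R[%classic : set R) <= mu N)%E by apply: le_measure => //; rewrite ?inE.
rewrite N0 lebesgue_measure_itv/= lte_fin ltrDl e0 -EFinB lee_fin; lra.
Qed.

Lemma near_lt x a : x < a -> \forall y \near x, y < a.
Proof.
move=> xa; have h : 0 < a - x by rewrite subr_gt0.
apply/nbhs_ballP; exists (a - x) => //= z.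
by rewrite /ball/= ltr_norml => /andP[? ?]; lra.
Qed.

Lemma near_gt x a : a < x -> \forall y \near x, a < y.
Proof.
move=> xa; have h : 0 < x - a by rewrite subr_gt0.
apply/nbhs_ballP; exists (x - a) => //= z.
by rewrite /ball/= ltr_norml => /andP[? ?]; lra.
Qed.

(** Lebesgue differentiation, applied to the restriction of [f] to each interval of the exhaustion:
    almost everywhere inside, [f] is the derivative of an indefinite integral that vanishes
    there. *)
Lemma Rint_itv0_ae f : locigr f ->
  (forall a b, 0 < a -> a <= b -> \int[mu]_(x in `[a, b]) f x = 0) ->
  {ae mu, forall x : R, 0 < x -> f x = 0}.
Proof.
move=> If f0.
have key (n : nat) : {ae mu, forall x : R, n.+1%:R^-1 < x < n.+1%:R -> f x = 0}.
  pose fn := f \_ (Hn n).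
  have i0 : 0 < n.+1%:R^-1 :> R by rewrite invr_gt0.
  have In : mu.-integrable setT (EFin \o fn).
    rewrite -restrict_EFin.
    exact: (proj1 (@integrable_mkcond _ _ _ mu (Hn n) (EFin \o f) (mHn n)) (If _ _ i0)).
  have hF : {ae mu, forall x : R,
      derivable (fun y : R => \int[mu]_(t in `]-oo, y]%classic) fn t : R) x 1 /\
      derive1 (fun y : R => \int[mu]_(t in `]-oo, y]) fn t) x = fn x}.
    apply: FTC1Ny; first by move=> y; apply: (igrS _ _ _ In).
    by apply: open_integrable_locally; [exact: openT|].
  apply: aeS hF => x [_ hfx] /andP[nx xn].
  have fE : fn x = f x.
    by rewrite /fn patchE ifT// inE /Hn/= in_itv/= !ltW.
  rewrite -fE -hfx derive1E.
  have -> : 'D_1 (fun y : R => \int[mu]_(t in `]-oo, y]) fn t) x = 'D_1 (cst 0 : R -> R) x.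
    apply: near_eq_derive; near=> y.
    have ny : n.+1%:R^-1 <= y by apply: ltW; near: y; exact: near_gt.
    have yn : y <= n.+1%:R by apply: ltW; near: y; exact: near_lt.
    rewrite -[RHS](f0 n.+1%:R^-1 y)// /fn -Rintegral_mkcondr; congr Rintegral.
    apply/seteqP; split=> z; rewrite /Hn /= !in_itv/=; first by move=> [-> /andP[-> _]].
    by move=> /andP[z1 z2]; rewrite z1 z2 (le_trans z2 yn).
  by rewrite derive_cst.
have : {ae mu, forall x : R, forall n : nat, n.+1%:R^-1 < x < n.+1%:R -> f x = 0}.
  exact/ae_foralln.
apply: aeS => x hx x0; apply: (hx (Num.truncn (x + x^-1))).
set N := Num.truncn _.
have N1 : x + x^-1 < N.+1%:R by exact: truncnS_gt.
have i0 : 0 < x^-1 by rewrite invr_gt0.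
apply/andP; split; last by lra.
by rewrite invf_plt ?posrE//; lra.
Unshelve. all: by end_near. Qed.

(** Test functions are only C^1, so primitives of piecewise affine functions are smooth enough and
    their integrals are explicit. The function [hramp] is the primitive of the positive part
    [ramp]. *)
Definition ramp (x : R) : R := Num.max 0 x.

Definition hramp (x : R) : R := ramp x ^+ 2 / 2.

Lemma ramp_cont : continuous ramp.
Proof. by move=> x; apply: continuous_max => //; exact: cst_continuous. Qed.

Lemma ramp_le0 x : x <= 0 -> ramp x = 0.
Proof. by move=> x0; rewrite /ramp max_l. Qed.

Lemma ramp_ge0 x : 0 <= x -> ramp x = x.
Proof. by move=> x0; rewrite /ramp max_r. Qed.

Lemma hramp_quad x h : `|hramp (x + h) - hramp x - h * ramp x| <= h ^+ 2.
Proof.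
rewrite /hramp; have [x0|x0] := leP x 0; have [y0|y0] := leP (x + h) 0;
  rewrite ?(ramp_le0 x0) ?(ramp_le0 y0) ?(ramp_ge0 (ltW x0)) ?(ramp_ge0 (ltW y0)) ler_norml;
  apply/andP; split; nra.
Qed.

Lemma is_derive_hramp x : is_derive x (1 : R) hramp (ramp x).
Proof.
apply: is_derive_cvg.
apply/cvgrPdist_le => e e0; near=> h.
have h0 : h != 0 by near: h; exact: nbhs_dnbhs_neq.
have he : `|h| <= e.
  near: h; apply: nbhs_dnbhs; exists e => //= z.
  by rewrite /ball_/= sub0r normrN => /ltW.
rewrite distrC.
have -> : h^-1 * (hramp (x + h) - hramp x) - ramp x
    = h^-1 * (hramp (x + h) - hramp x - h * ramp x) by field.
rewrite normrM normfV; apply: le_trans he.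
rewrite mulrC ler_pdivrMr ?normr_gt0// -expr2 real_normK ?num_real//.
exact: hramp_quad.
Unshelve. all: by end_near. Qed.

(* [trap c d e] is the trapezoid equal to 1 on [c, d], with ramps of length e,
   and [itrap c d e] its primitive vanishing on the left. *)
Definition trap c d e (s : R) : R :=
  e^-1 * (ramp (s - (c - e)) - ramp (s - c) - ramp (s - d) + ramp (s - (d + e))).

Definition itrap c d e (s : R) : R :=
  e^-1 * (hramp (s - (c - e)) - hramp (s - c) - hramp (s - d) + hramp (s - (d + e))).

Lemma is_derive_itrap c d e x : is_derive x (1 : R) (itrap c d e) (trap c d e x).
Proof.
have D a : is_derive x (1 : R) (fun s => hramp (s - a)) (ramp (x - a)).
  have d1 : is_derive x (1 : R) (fun s : R => s - a) 1.
    have := @is_deriveB R R R id (cst a) x 1 1 0 _ _.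
    by rewrite subr0; apply.
  have := @is_derive1_comp R hramp (fun s => s - a) x (ramp (x - a)) 1 (is_derive_hramp _) d1.
  by rewrite mulr1.
have := is_deriveZ e^-1 (is_deriveD (is_deriveB (is_deriveB (D (c - e)) (D c)) (D d)) (D (d + e))).
exact.
Qed.

Lemma trap_cont c d e : continuous (trap c d e).
Proof.
have C a : continuous (fun s => ramp (s - a)).
  move=> x; apply: (@continuous_comp _ _ _ (fun s => s - a) ramp); last exact: ramp_cont.
  by apply: cvgB => //; exact: cvg_cst.
move=> x; apply: cvgM; first exact: cvg_cst.
apply: cvgD; last exact: C.
by apply: cvgB; [apply: cvgB|]; exact: C.
Qed.

Lemma itrap_left c d e s : 0 < e -> c <= d -> s <= c - e -> itrap c d e s = 0.
Proof.
move=> e0 cd sc; rewrite /itrap /hramp !ramp_le0; lra.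
Qed.

(** The constant is the area of the trapezoid; [weak_cst] balances two trapezoids by their areas. *)
Lemma itrap_right c d e s : 0 < e -> c <= d -> d + e <= s -> itrap c d e s = d - c + e.
Proof.
move=> e0 cd sd; rewrite /itrap /hramp !ramp_ge0; try lra.
by field; rewrite gt_eqF.
Qed.

Lemma trap_left c d e s : 0 < e -> c <= d -> s <= c - e -> trap c d e s = 0.
Proof.
move=> e0 cd sc; rewrite /trap !ramp_le0; lra.
Qed.

Lemma trap_right c d e s : 0 < e -> c <= d -> d + e <= s -> trap c d e s = 0.
Proof.
move=> e0 cd sd; rewrite /trap !ramp_ge0; lra.
Qed.

Lemma Rint_ramp v V W a A B : prim V v -> prim W V -> 0 < A -> A <= a -> a <= B ->
  igr `[A, B] (fun s => v s * ramp (s - a)) /\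
  \int[mu]_(s in `[A, B]) (v s * ramp (s - a)) = V B * (B - a) - (W B - W a).
Proof.
move=> pV pW A0 Aa aB.
have pid : prim (fun s => s - a) (fun=> 1).
  apply: prim_C1; last by move=> x _; exact: cst_continuous.
  move=> x x0; have := @is_deriveB R R R id (cst a) x 1 1 0 _ _.
  by rewrite subr0; apply.
have [I1 E1] := primM pV pid.
have a0 : 0 < a by exact: lt_le_trans Aa.
have mv : measurable_fun H v by exact: prim_meas_dens pV.
have mr : measurable_fun H (fun s => ramp (s - a)).
  apply: cont_meas => x _.
  apply: (@continuous_comp _ _ _ (fun s => s - a) ramp); last exact: ramp_cont.
  by apply: cvgB => //; exact: cvg_cst.
have [Iv _] := pV.
have Ivr : igr `[A, B] (fun s => v s * ramp (s - a)).
  apply: (igr_le (mitv A B) _ _ (igrZ (B - a) (mitv A B) (igr_norm (Iv A B A0)))).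
    by apply: measurable_funM; [apply: measurable_funS mv|apply: measurable_funS mr];
      rewrite //; exact: itvH.
  move=> s; rewrite /= in_itv/= => /andP[As sB].
  rewrite normrM mulrC ler_wpM2r// /ramp ger0_norm ?le_max ?lexx//.
  by rewrite ge_max; apply/andP; split; lra.
split=> //; rewrite (Rint_chasles Aa aB Ivr).
have -> : \int[mu]_(x in `[A, a]) (v x * ramp (x - a)) = 0.
  transitivity (\int[mu]_(x in `[A, a]) (cst 0 x : R)); last by rewrite Rintegral_cst// mul0r.
  apply: eq_Rintegral => s; rewrite inE /= in_itv/= => /andP[_ sa].
  by rewrite ramp_le0 ?mulr0//; lra.
rewrite add0r; have [IV WE] := pW.
have E2 : \int[mu]_(x in `[a, B]) (v x * ramp (x - a)) = \int[mu]_(x in `[a, B]) (v x * (x - a)).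
  apply: eq_Rintegral => s; rewrite inE /= in_itv/= => /andP[sa _].
  by rewrite ramp_ge0//; lra.
have Iva : igr `[a, B] (fun x => v x * (x - a)).
  have := igrB (mitv a B) (I1 a B a0) (IV a B a0).
  by apply: igr_eq => // s _; ring.
have := E1 a B a0 aB.
have -> : (fun x => v x * (x - a) + V x * 1) = (fun x => v x * (x - a) + V x).
  by apply/funext => x; rewrite mulr1.
by rewrite (RintD (mitv a B) Iva (IV a B a0)) -WE// E2 subrr; lra.
Qed.

(** Integration by parts moves the derivative to the two ramps: what remains is the mean of [V] over
    [[d, d + e]] minus its mean over [[c - e, c]]. *)
Lemma Rint_trap v V W c d e A B : prim V v -> prim W V -> 0 < e ->
  0 < A -> A <= c - e -> c <= d -> d + e <= B ->
  igr `[A, B] (fun s => v s * trap c d e s) /\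
  \int[mu]_(s in `[A, B]) (v s * trap c d e s) = dlt e W d - dlt e W (c - e).
Proof.
move=> pV pW e0 A0 Ac cd dB.
have h1 : c - e <= B by lra.
have h2 : A <= c by lra.
have h3 : c <= B by lra.
have h4 : A <= d by lra.
have h5 : d <= B by lra.
have h6 : A <= d + e by lra.
have [I4 E4] := Rint_ramp pV pW A0 Ac h1.
have [I3 E3] := Rint_ramp pV pW A0 h2 h3.
have [I2 E2] := Rint_ramp pV pW A0 h4 h5.
have [I1 E1] := Rint_ramp pV pW A0 h6 dB.
have mAB := mitv A B.
have I43 := igrB mAB I4 I3; have I432 := igrB mAB I43 I2; have I := igrD mAB I432 I1.
have FE s : v s * trap c d e s = e^-1 * (v s * ramp (s - (c - e)) - v s * ramp (s - c)
    - v s * ramp (s - d) + v s * ramp (s - (d + e))) by rewrite /trap; ring.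
under eq_Rintegral do rewrite FE.
split; first by apply: igr_eq (igrZ e^-1 mAB I) => // s _; rewrite FE.
rewrite (RintZ _ mAB I) (RintD mAB I432 I1) (RintB mAB I43 I2) (RintB mAB I4 I3).
rewrite E1 E2 E3 E4 /dlt subrK; ring.
Qed.

Lemma dlt_cvg V W d : prim W V -> 0 < d -> {for d, continuous V} ->
  forall e : R, 0 < e -> exists2 t : R, 0 < t & forall h, 0 < h -> h < t ->
    `|dlt h W d - V d| <= e /\ (h < d -> `|dlt h W (d - h) - V d| <= e).
Proof.
move=> pW d0 cV e e0; have [IV WE] := pW.
move/cvgrPdist_lt: cV => /(_ e e0)[t /= t0 tP]; exists t => // h h0 ht.
have near y : d - h <= y <= d + h -> `|V y - V d| <= e.
  move=> /andP[? ?]; rewrite distrC ltW//; apply: tP => /=.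
  by rewrite ltr_norml; apply/andP; split; lra.
split=> [|hd]; rewrite -(stkE (ltW h0) pW)//; try lra; apply: stk_bound => //; try lra.
  by move=> x /andP[? ?]; apply: near; apply/andP; split; lra.
by move=> x /andP[? ?]; apply: near; apply/andP; split; lra.
Qed.

Lemma Rint_supp F A B : 0 < A -> (forall x : R, x \notin `[A, B] -> F x = 0) ->
  \int[mu]_(r in H) F r = \int[mu]_(r in `[A, B]) F r.
Proof.
move=> A0 F0; rewrite -(setIidr (itvH (b := B) A0)) Rintegral_mkcondr.
apply: eq_Rintegral => x _; rewrite patchE; case: ifPn => //.
by rewrite notin_setE /= => xAB; rewrite F0//; exact/negP.
Qed.

(** The lemma of du Bois-Reymond. Testing against the difference of a trapezoid primitive over
    [[c, d]] and one over [[1, 2]], and letting the ramps shrink, shows that a primitive [V] of [v]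
    is affine with slope [V 2 - V 1]; then [v] minus this slope has zero integral over every
    interval. *)
Lemma weak_cst v : locigr v ->
  (forall chi : R -> R, test_function chi -> \int[mu]_(r in H) (v r * derive1 chi r) = 0) ->
  exists C, {ae mu, forall x : R, 0 < x -> v x = C}.
Proof.
move=> Iv v0; have [V pV] := prim_ex Iv.
have cV := prim_cont pV; have [W pW] := prim_ex (cont_locigr cV).
have key c d e : 0 < e -> e < 1 -> e < c -> c <= d ->
    (1 + e) * (dlt e W d - dlt e W (c - e)) = (d - c + e) * (dlt e W 2 - dlt e W (1 - e)).
  move=> e0 e1 ec cd.
  (* Each trapezoid is weighted by the area of the other, so that [chi] vanishes to the right of
     both. *)
  pose l1 : R := 1 + e; pose l2 := d - c + e.
  pose chi s := l1 * itrap c d e s - l2 * itrap 1 2 e s.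
  pose eta s := l1 * trap c d e s - l2 * trap 1 2 e s.
  have dchi x : is_derive x (1 : R) chi (eta x).
    have := is_deriveB (is_deriveZ l1 (is_derive_itrap c d e x)) (is_deriveZ l2 (is_derive_itrap 1 2 e x)).
    exact.
  have chiE : derive1 chi = eta.
    by apply/funext => x; have dx := dchi x; rewrite derive1E derive_val.
  pose A := Num.min (c - e) (1 - e); pose B := Num.max (d + e) (2 + e).
  have A0 : 0 < A by rewrite lt_min; apply/andP; split; lra.
  have A1 : A <= c - e by rewrite ge_min lexx.
  have A2 : A <= 1 - e by rewrite ge_min lexx orbT.
  have B1 : d + e <= B by rewrite le_max lexx.
  have B2 : 2 + e <= B by rewrite le_max lexx orbT.
  have e12 : (1 : R) <= 2 by lra.
  have out x : x \notin `[A, B] -> chi x = 0 /\ eta x = 0.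
    rewrite in_itv/= negb_and -!ltNge => /orP[xA|Bx].
      rewrite /chi /eta !(itrap_left e0) ?(trap_left e0)//; try lra.
    rewrite /chi /eta !(itrap_right e0) ?(trap_right e0)//; try lra.
    rewrite /l1 /l2; split; ring.
  have test : test_function chi.
    split=> [x||]; first by case: (dchi x).
    - rewrite chiE => x; apply: cvgB; (apply: cvgM; [exact: cvg_cst|exact: trap_cont]).
    - by exists A, B; split=> // x /out[].
  have := v0 _ test; rewrite chiE.
  have [I1 E1] := Rint_trap pV pW e0 A0 A1 cd B1.
  have [I2 E2] := Rint_trap pV pW e0 A0 A2 e12 B2.
  rewrite (@Rint_supp _ A B)//; last by move=> x /out[_ ->]; rewrite mulr0.
  have FE s : v s * eta s = l1 * (v s * trap c d e s) - l2 * (v s * trap 1 2 e s).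
    by rewrite /eta; ring.
  under eq_Rintegral do rewrite FE.
  rewrite (RintB (mitv A B) (igrZ l1 (mitv A B) I1) (igrZ l2 (mitv A B) I2)).
  rewrite (RintZ _ (mitv A B) I1) (RintZ _ (mitv A B) I2) E1 E2 => E.
  by apply/eqP; rewrite -subr_eq0 E.
pose C := V 2 - V 1.
have aff c d : 0 < c -> c <= d -> V d - V c = C * (d - c).
  move=> c0 cd; have d0 : 0 < d by exact: lt_le_trans cd.
  apply/eqP; rewrite -subr_eq0 -normr_le0; apply/ler_addgt0Pr => eps eps0; rewrite add0r.
  (* A generous bound for the total coefficient of [e1] in the three error terms [Q1], [Q2], [Q3]
     below. *)
  pose K := 4 * (d - c) + `|C| + `|V d - V c| + 20.
  have K0 : 0 < K.
    have := normr_ge0 C; have := normr_ge0 (V d - V c); rewrite /K; lra.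
  pose e1 := eps / K.
  have e10 : 0 < e1 by rewrite divr_gt0.
  have [t1 t10 h1] := dlt_cvg pW c0 (cV c c0) e10.
  have [t2 t20 h2] := dlt_cvg pW d0 (cV d d0) e10.
  have [t3 t30 h3] := dlt_cvg pW ltr01 (cV 1 ltr01) e10.
  have [t4 t40 h4] := dlt_cvg pW (ltr0n _ 2) (cV 2 (ltr0n _ 2)) e10.
  pose e := Num.min (Num.min (Num.min t1 t2) (Num.min t3 t4))
     (Num.min (Num.min c 1) e1) / 2.
  have m0 : 0 < Num.min (Num.min (Num.min t1 t2) (Num.min t3 t4)) (Num.min (Num.min c 1) e1).
    by rewrite !lt_min t10 t20 t30 t40 c0 ltr01 e10.
  have e0 : 0 < e by rewrite divr_gt0.
  have eml x : Num.min (Num.min (Num.min t1 t2) (Num.min t3 t4)) (Num.min (Num.min c 1) e1) <= x -> e < x.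
    by rewrite /e; lra.
  have et1 : e < t1 by apply: eml; rewrite !ge_min lexx.
  have et2 : e < t2 by apply: eml; rewrite !ge_min lexx ?orbT.
  have et3 : e < t3 by apply: eml; rewrite !ge_min lexx ?orbT.
  have et4 : e < t4 by apply: eml; rewrite !ge_min lexx ?orbT.
  have ec : e < c by apply: eml; rewrite !ge_min lexx ?orbT.
  have e_1 : e < 1 by apply: eml; rewrite !ge_min lexx ?orbT.
  have ee1 : e < e1 by apply: eml; rewrite !ge_min lexx ?orbT.
  have := key c d e e0 e_1 ec cd.
  have [_ /(_ ec)] := h1 e e0 et1; have [+ _] := h2 e e0 et2.
  have [_ /(_ e_1)] := h3 e e0 et3; have [+ _] := h4 e e0 et4.
  set p4 := dlt e W 2; set p3 := dlt e W (1 - e); set p2 := dlt e W d; set p1 := dlt e W (c - e).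
  move=> b4 b3 b2 b1 E.
  (* The identity [key] is subtracted: there remain a term of order [e] and the differences between
     the means of [V] and its values. *)
  have -> : V d - V c - C * (d - c) =
     e * (C - (V d - V c)) + (1 + e) * ((p1 - V c) - (p2 - V d)) + (d - c + e) * ((p4 - V 2) - (p3 - V 1)).
    have : (1 + e) * (p2 - p1) - (d - c + e) * (p4 - p3) = 0 by rewrite E subrr.
    rewrite /C; lra.
  have EK : eps = e1 * K by rewrite /e1 divfK// gt_eqF.
  have T (x y : R) : `|x| <= e1 -> `|y| <= e1 -> `|x - y| <= 2 * e1.
    by move=> ? ?; apply: le_trans (ler_normB _ _) _; lra.
  have Q1 : `|e * (C - (V d - V c))| <= e1 * (`|C| + `|V d - V c|).
    by rewrite normrM gtr0_norm// ler_pM ?(ltW e0) ?(ltW ee1)// ler_normB.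
  have Q2 : `|(1 + e) * ((p1 - V c) - (p2 - V d))| <= 2 * (2 * e1).
    have e2 : 1 + e <= 2 by move: e_1; clear; lra.
    have e3 : 0 <= 1 + e by move: e0; clear; lra.
    by rewrite normrM (ger0_norm e3); apply: ler_pM => //; exact: T.
  have Q3 : `|(d - c + e) * ((p4 - V 2) - (p3 - V 1))| <= (d - c + 1) * (2 * e1).
    have e2 : d - c + e <= d - c + 1 by rewrite lerD2l ltW.
    have e3 : 0 <= d - c + e by rewrite addr_ge0 ?subr_ge0// ltW.
    by rewrite normrM (ger0_norm e3); apply: ler_pM => //; exact: T.
  apply: le_trans (ler_normD _ _) _; apply: le_trans (lerD (ler_normD _ _) (lexx _)) _.
  apply: le_trans (lerD (lerD Q1 Q2) Q3) _; rewrite EK /K.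
  have : 0 <= e1 * (d - c) by rewrite mulr_ge0 ?subr_ge0// ltW.
  by move: e10; clear; lra.
exists C.
have IC : locigr (fun=> C) by apply: cont_locigr => x _; exact: cst_continuous.
have IvC : locigr (fun x => v x - C).
  by move=> a b a0; apply: igrB; [exact: mitv|exact: Iv|exact: IC].
have := Rint_itv0_ae IvC _; move=> h; apply: aeS (h _) => [x hx x0|a b a0 ab].
  by apply/eqP; rewrite -subr_eq0 hx.
rewrite (RintB (mitv a b) (Iv a b a0) (IC a b a0)).
move: ab; rewrite le_eqVlt => /predU1P[->|ab]; first by rewrite set_itv1 !Rintegral_set1 subrr.
by rewrite Rint_cst_itv//; case: pV => _ <-//; rewrite ?aff ?subrr ?(ltW ab).
Qed.

Lemma locally_integrable_locigr f : locally_integrable H f -> locigr f.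
Proof.
move=> [mf _ If] a b a0; apply/integrableP; split.
  by apply/measurable_EFinP; apply: measurable_funS mf => //; exact: itvH.
by apply: If; [exact: itvH|exact: segment_compact].
Qed.

(** Subtracting a primitive [G] of [g] leaves a function with zero weak derivative, which [weak_cst]
    makes constant almost everywhere. The resulting [U] is the continuous representative of [u]. *)
Lemma weak_derivative_prim u g : is_weak_derivative u g ->
  exists2 U, prim U g & {ae mu, forall x : R, 0 < x -> u x = U x}.
Proof.
move=> [Iu Ig wd].
have lu := locally_integrable_locigr Iu; have lg := locally_integrable_locigr Ig.
have [G pG] := prim_ex lg.
have cG := prim_cont pG; have lG := cont_locigr cG.
have luG : locigr (fun x => u x - G x).
  by move=> a b a0; apply: igrB; [exact: mitv|exact: lu|exact: lG].
have [chi tchi|C hC] := weak_cst luG _; last first.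
  have pC : prim (fun=> C) (fun=> 0).
    by apply: prim_C1 => x _; exact: cst_continuous.
  exists (fun x => G x + C).
    by apply: prim_ext (primD pG pC) => // x _; rewrite addr0.
  by apply: aeS hC => x hC x0; rewrite -(hC x0) addrC subrK.
have [dchi cchi [a [b [a0 out]]]] := tchi.
have pchi : prim chi (derive1 chi).
  apply: prim_C1 => x _; last exact: cchi.
  by rewrite derive1E; apply: DeriveDef.
have out' x : x \notin `[a, b] -> derive1 chi x = 0.
  rewrite in_itv/= negb_and -!ltNge => xab; rewrite derive1E.
  have -> : 'D_1 chi x = 'D_1 (cst 0 : R -> R) x; last by rewrite derive_cst.
  case/orP: xab => h; apply: near_eq_derive; near=> y; apply: out;
    rewrite in_itv/= negb_and -!ltNge; apply/orP.
    by left; near: y; exact: near_lt.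
  by right; near: y; exact: near_gt.
(* Endpoints strictly outside [[a, b]], so that [chi] vanishes at both. The maximum covers an empty
   interval, where [b < a]. *)
pose B := Num.max a b + 1; pose A := a / 2.
have A0 : 0 < A by rewrite divr_gt0.
have aB : a <= B - 1 by rewrite /B addrK le_max lexx.
have bB : b <= B - 1 by rewrite /B addrK le_max lexx orbT.
have AB : A <= B by rewrite /A; lra.
have sAB x : x \notin `[A, B] -> x \notin `[a, b].
  rewrite !in_itv/= !negb_and -!ltNge /A => /orP[?|?]; apply/orP; [left|right]; lra.
have cA : chi A = 0 by apply: out; rewrite in_itv/= negb_and -!ltNge /A; apply/orP; left; lra.
have cB : chi B = 0 by apply: out; rewrite in_itv/= negb_and -!ltNge; apply/orP; right; lra.
have [_ /(_ A B A0 AB)] := primM pG pchi; rewrite cA cB !mulr0 subrr.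
have cdc (x : R) : 0 < x -> {for x, continuous (derive1 chi)} by move=> _; exact: cchi.
have I1 := locigrM cdc lu B A0; have I2 := locigrM cdc lG B A0.
have I3 := locigrM (prim_cont pchi) lg B A0.
rewrite (RintD (mitv A B) I3 I2) => E.
have := wd chi tchi; rewrite !(@Rint_supp _ A B)//.
- move=> E'; under eq_Rintegral do rewrite mulrBl.
  rewrite (RintB (mitv A B) I1 I2) E'; lra.
- by move=> x /sAB/out' ->; rewrite mulr0.
- by move=> x /sAB/out ->; rewrite mulr0.
- by move=> x /sAB/out' ->; rewrite mulr0.
Unshelve. all: by end_near. Qed.

End WeakDerivative.

(** * The virial identity for one component *)

Section Virial.
Context {R : realType}.
Local Notation mu := (@lebesgue_measure R).
Local Notation H := (`]0%R, +oo[%classic : set R).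
Implicit Types (u v g k f : R -> R) (a b c d h r : R).

Definition wt r : R := (1 + r)^-1.

Lemma wtE r : 0 < r -> (1 + r) * wt r = 1.
Proof. by move=> r0; rewrite divff// gt_eqF//; lra. Qed.

Lemma wt_gt0 r : 0 < r -> 0 < wt r.
Proof. by move=> r0; rewrite invr_gt0; lra. Qed.

Lemma wt_le1 r : 0 < r -> wt r <= 1.
Proof. by move=> r0; rewrite invf_le1; lra. Qed.

Lemma rwt r : 0 < r -> r * wt r = 1 - wt r.
Proof. by move=> /wtE; rewrite mulrDl mul1r => <-; ring. Qed.

Lemma rwt_le1 r : 0 < r -> r * wt r <= 1.
Proof. by move=> r0; rewrite rwt//; have := wt_gt0 r0; lra. Qed.

Lemma prim_id : prim (fun x : R => x) (fun=> 1).
Proof. by apply: prim_C1 => x _; exact: cst_continuous. Qed.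

Lemma prim_cst c : prim (fun=> c) (fun=> 0).
Proof. by apply: prim_C1 => x _; exact: cst_continuous. Qed.

Lemma prim_inv : prim (fun x : R => x^-1) (fun x => - (x ^- 2)).
Proof.
apply: prim_C1 => x x0; have xn0 : x != 0 by rewrite gt_eqF.
  have := @is_deriveV R id x 1 1 xn0 (is_derive_id _ _).
  by rewrite /GRing.scale/= mulr1.
apply: continuousN; apply: (@continuous_comp _ _ _ (fun x : R => x ^+ 2) (@GRing.inv R)).
  exact: exprn_continuous.
by apply: inv_continuous; rewrite expf_neq0.
Qed.

Lemma prim_wt : prim wt (fun x => - (wt x ^+ 2)).
Proof.
apply: prim_ext (prim_shift (@ler01 R) prim_inv) => x _; rewrite /wt addrC//.
by rewrite exprVn.
Qed.

Lemma sq_young (x y : R) : `|x * y| <= x ^+ 2 + y ^+ 2.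
Proof. by rewrite ler_norml; apply/andP; split; have := sqr_ge0 (x + y); have := sqr_ge0 (x - y); nra. Qed.

Lemma sqrD3_le (x y z : R) : (x + y + z) ^+ 2 <= 3 * (x ^+ 2 + y ^+ 2 + z ^+ 2).
Proof. by have := sqr_ge0 (x - y); have := sqr_ge0 (x - z); have := sqr_ge0 (y - z); nra. Qed.

Lemma sqrD4_le (x y z t : R) :
  (x + y + z + t) ^+ 2 <= 4 * (x ^+ 2 + y ^+ 2 + z ^+ 2 + t ^+ 2).
Proof.
have := sqr_ge0 (x - y); have := sqr_ge0 (x - z); have := sqr_ge0 (y - z).
have := sqr_ge0 (x - t); have := sqr_ge0 (y - t); have := sqr_ge0 (z - t); nra.
Qed.

(* The virial multiplier is psi d/dr + chi, where chi = (psi' + psi / r) / 2 makes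
   it antisymmetric for r dr. *)
Definition psi r : R := (r * wt r) ^+ 2.

Definition chi r : R := r * (3 + r) * wt r ^+ 3 / 2.

(* Coefficients of the exact derivatives: ca = r psi / 2, cb = ca' = r chi,
   ce = r chi', cq = psi / r. *)
Definition ca r : R := r ^+ 3 * wt r ^+ 2 / 2.

Definition cb r : R := r ^+ 2 * (3 + r) * wt r ^+ 3 / 2.

Definition ce r : R := r * (3 - 4 * r - r ^+ 2) * wt r ^+ 4 / 2.

Definition cq r : R := r * wt r ^+ 2.

Lemma prim_ca : prim ca cb.
Proof.
have := primZ 2^-1 (primM (primM prim_id (primM prim_id prim_id)) (primM prim_wt prim_wt)).
apply: prim_ext => x x0; rewrite /ca /cb /wt; field; lra.
Qed.

Lemma prim_cb : prim cb (fun r => 3 * r * wt r ^+ 4).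
Proof.
have := primZ 2^-1 (primM (primM (primM prim_id prim_id) (primD (prim_cst 3) prim_id))
  (primM prim_wt (primM prim_wt prim_wt))).
apply: prim_ext => x x0; rewrite /cb /wt; field; lra.
Qed.

Lemma prim_ce : prim ce (fun r => (3 - 17 * r + 5 * r ^+ 2 + r ^+ 3) * wt r ^+ 5 / 2).
Proof.
have := primZ 2^-1 (primM (primM prim_id (primD (prim_cst 3)
    (primD (primZ (-4) prim_id) (primZ (-1) (primM prim_id prim_id)))))
  (primM (primM prim_wt prim_wt) (primM prim_wt prim_wt))).
apply: prim_ext => x x0; rewrite /ce /wt; field; lra.
Qed.

Lemma prim_cq : prim cq (fun r => (1 - r) * wt r ^+ 3).
Proof.
have := primM prim_id (primM prim_wt prim_wt).
apply: prim_ext => x x0; rewrite /cq /wt; field; lra.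
Qed.

Lemma igr_wt2 : igr H (fun r => wt r ^+ 2).
Proof.
have [] := @prim_bdd R (fun x => - wt x) (fun x => wt x ^+ 2) (-1) 0 => //.
- have := primZ (-1) prim_wt; by apply: prim_ext => x _; ring.
- by move=> x _; exact: sqr_ge0.
- by move=> x x0; rewrite lerN2 oppr_le0 wt_le1// ltW// wt_gt0.
Qed.

Lemma meas_wt : measurable_fun H wt. Proof. exact: prim_meas prim_wt. Qed.

Lemma meas_psi : measurable_fun H psi.
Proof. by apply: measurable_funX; apply: measurable_funM => //; exact: meas_wt. Qed.

Lemma meas_chi : measurable_fun H chi.
Proof.
apply: measurable_funM => //; apply: measurable_funM.
  by apply: measurable_funM => //; exact: measurable_funD.
by apply: measurable_funX; exact: meas_wt.
Qed.

Lemma chi_bound r : 0 < r -> 0 <= chi r <= 3 / 2 * r * wt r ^+ 2.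
Proof.
move=> r0; have w0 := wt_gt0 r0; rewrite /chi; apply/andP; split.
  by rewrite !mulr_ge0 ?invr_ge0 ?exprn_ge0//; lra.
have -> : 3 / 2 * r * wt r ^+ 2 = r * (3 * ((1 + r) * wt r)) * wt r ^+ 2 / 2 by rewrite wtE//; field.
have -> : r * (3 + r) * wt r ^+ 3 / 2 = r * ((3 + r) * wt r) * wt r ^+ 2 / 2 by ring.
rewrite ler_wpM2r ?invr_ge0// ler_wpM2r ?sqr_ge0// ler_wpM2l ?(ltW r0)//.
by rewrite mulrA ler_wpM2r ?(ltW w0)//; lra.
Qed.

(** The comparisons that reduce the weights met below to [r] and [wt r ^+ 2], the two weights of the
    dominating function in [igr_dom]. *)
Lemma wt_cubes r : 0 < r -> [/\ r ^+ 2 * wt r <= r, r ^+ 4 * wt r ^+ 3 <= r,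
  r ^+ 2 * wt r ^+ 3 <= r, wt r ^+ 3 <= wt r ^+ 2 & wt r <= wt r ^+ 2 + r].
Proof.
move=> r0; have [w0 w1 rw] := And3 (wt_gt0 r0) (wt_le1 r0) (rwt_le1 r0).
have rw0 : 0 <= r * wt r by rewrite mulr_ge0// ltW.
split.
- by rewrite expr2 -mulrA -[leRHS]mulr1 ler_wpM2l// ltW.
- have -> : r ^+ 4 * wt r ^+ 3 = r * (r * wt r) ^+ 3 by ring.
  by rewrite -[leRHS]mulr1 ler_wpM2l ?(ltW r0)// exprn_ile1.
- have -> : r ^+ 2 * wt r ^+ 3 = r * ((r * wt r) * wt r ^+ 2) by ring.
  rewrite -[leRHS]mulr1 ler_wpM2l ?(ltW r0)// mulr_ile1 ?sqr_ge0//.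
  by rewrite exprn_ile1// ltW.
- by rewrite exprS ler_piMl ?sqr_ge0.
- have {1}-> : wt r = wt r ^+ 2 + r * (wt r) ^+ 2.
    by rewrite -[LHS]mul1r -(wtE r0); ring.
  by rewrite lerD2l ler_piMr ?(ltW r0)// exprn_ile1// ltW.
Qed.

Lemma igr_wt2M f : measurable_fun H f -> (forall x : R, 0 < x -> `|f x| <= 1) ->
  igr H (fun r => wt r ^+ 2 * f r ^+ 2).
Proof.
move=> mf f1; apply: (igr_le (mH (R := R)) _ _ igr_wt2).
  by apply: measurable_funM; apply: measurable_funX => //; exact: meas_wt.
move=> x; rewrite inH => x0; rewrite ger0_norm; last by pos.
rewrite ler_piMr ?sqr_ge0// -[f x ^+ 2]real_normK ?num_real//.
by rewrite exprn_ile1// f1.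
Qed.

(** Antisymmetry of the multiplier: the integrand is the derivative of [ca v^2], that is of
    [r psi v^2 / 2]. The domination by [G] replaces square integrability of [v], since the lemma is
    meant for components of [L f], whose term [f / r] may fail to be square integrable near 0. *)
Lemma int_dilation_eq0 v v1 G : prim v v1 -> igr H G ->
  (forall r, 0 < r -> r ^+ 2 * wt r * v r ^+ 2 + r ^+ 4 * wt r ^+ 3 * v1 r ^+ 2 <= G r) ->
  igr H (fun r => r * (v r * (psi r * v1 r + chi r * v r))) /\
  \int[mu]_(r in H) (r * (v r * (psi r * v1 r + chi r * v r))) = 0.
Proof.
move=> pv IG vG.
have mv := prim_meas pv; have mv1 := prim_meas_dens pv.
have pP := primM prim_ca (primM pv pv).
have E r : 0 < r -> cb r * (v r * v r) + ca r * (v1 r * v r + v r * v1 r)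
    = r * (v r * (psi r * v1 r + chi r * v r)).
  by move=> r0; rewrite /cb /ca /psi /chi; field.
have pP' := prim_ext (fun x _ => erefl) E pP.
have part r : 0 < r -> r ^+ 2 * wt r * v r ^+ 2 <= G r /\ r ^+ 4 * wt r ^+ 3 * v1 r ^+ 2 <= G r.
  move=> r0; have := vG r r0; have w0 := wt_gt0 r0.
  have : 0 <= r ^+ 2 * wt r * v r ^+ 2 by have r0' := ltW r0; have w0' := ltW w0; pos.
  have : 0 <= r ^+ 4 * wt r ^+ 3 * v1 r ^+ 2 by have r0' := ltW r0; have w0' := ltW w0; pos.
  by move=> ? ? ?; split; lra.
have I1 : igr H (fun r => r * (v r * (psi r * v1 r + chi r * v r))).
  apply: (igr_le (mH (R := R)) _ _ (igrZ 4 (mH (R := R)) IG)).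
    by apply: measurable_funM => //; apply: measurable_funM => //; apply: measurable_funD;
      apply: measurable_funM => //; [exact: meas_psi|exact: meas_chi].
  move=> r; rewrite inH => r0; have [g1 g2] := part r r0; have w0 := wt_gt0 r0.
  have -> : r * (v r * (psi r * v1 r + chi r * v r)) =
     r ^+ 3 * wt r ^+ 2 * (v r * v1 r) + r * chi r * v r ^+ 2 by rewrite /psi; ring.
  apply: le_trans (ler_normD _ _) _.
  have h1 : `|r ^+ 3 * wt r ^+ 2 * (v r * v1 r)| <= G r.
    have /andP[? ?] : - (r ^+ 2 * wt r * v r ^+ 2 + r ^+ 4 * wt r ^+ 3 * v1 r ^+ 2) <=
       2 * (r ^+ 3 * wt r ^+ 2 * (v r * v1 r)) <= r ^+ 2 * wt r * v r ^+ 2 + r ^+ 4 * wt r ^+ 3 * v1 r ^+ 2.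
      have q1 : 0 <= r ^+ 2 * wt r * (v r - r * wt r * v1 r) ^+ 2 by have r0' := ltW r0; have w0' := ltW w0; pos.
      have q2 : 0 <= r ^+ 2 * wt r * (v r + r * wt r * v1 r) ^+ 2 by have r0' := ltW r0; have w0' := ltW w0; pos.
      by apply/andP; split; nra.
    by rewrite ler_norml; have := vG r r0; move=> ?; apply/andP; split; lra.
  have h2 : `|r * chi r * v r ^+ 2| <= 3 / 2 * G r.
    have /andP[c0 c1] := chi_bound r0.
    rewrite ger0_norm; last by have r0' := ltW r0; pos.
    apply: le_trans (_ : _ <= 3 / 2 * (r ^+ 2 * wt r * v r ^+ 2)) _; last by rewrite ler_pM2l//; lra.
    rewrite [leRHS]mulrA ler_wpM2r ?sqr_ge0//.
    apply: le_trans (_ : r * (3 / 2 * r * wt r ^+ 2) <= _); first by rewrite ler_wpM2l// ltW.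
    have -> : r * (3 / 2 * r * wt r ^+ 2) = 3 / 2 * (r ^+ 2 * wt r) * wt r by ring.
    by rewrite ler_piMr ?wt_le1//; have r0' := ltW r0; have w0' := ltW w0; pos.
  have : 0 <= G r.
    by apply: le_trans g1; have r0' := ltW r0; have w0' := ltW w0; pos.
  lra.
split=> //; apply: (prim_int0 pP' I1).
apply: (igr_le (mH (R := R)) _ _ IG).
  apply: measurable_funM; first exact: prim_meas pP.
  exact: prim_meas prim_inv.
move=> r; rewrite inH => r0; have [g1 g2] := part r r0; have w0 := wt_gt0 r0.
have -> : ca r * (v r * v r) / r = (r ^+ 2 * wt r * v r ^+ 2) * (wt r / 2) by rewrite /ca; field; rewrite gt_eqF.
have p0 : 0 <= r ^+ 2 * wt r * v r ^+ 2 by have r0' := ltW r0; have w0' := ltW w0; pos.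
rewrite ger0_norm; last by have w0' := ltW w0; pos.
by apply: le_trans g1; rewrite ler_piMr//; have := wt_le1 r0; lra.
Qed.

(** Over the common factor [wt r ^+ 5] the difference is [(K - 1) (1 + r)^3] plus a polynomial with
    nonnegative coefficients and no constant term. For [K = 1] there is equality at [r = 0], where
    the right-hand side is [K - 3/4]; a vanishing angular momentum would make it negative. *)
Lemma coercive_coeff (K r : R) : 0 < r -> 1 <= K ->
  wt r ^+ 2 / 4 <= K * wt r ^+ 2 - (3 - 17 * r + 5 * r ^+ 2 + r ^+ 3) * wt r ^+ 5 / 4.
Proof.
move=> r0 K1; have w0 := wt_gt0 r0.
have -> : wt r ^+ 2 = ((1 + r) * wt r) ^+ 3 * wt r ^+ 2 by rewrite wtE// expr1n mul1r.
have -> : ((1 + r) * wt r) ^+ 3 * wt r ^+ 2 = (1 + r) ^+ 3 * wt r ^+ 5 by ring.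
rewrite -subr_ge0.
have -> : K * ((1 + r) ^+ 3 * wt r ^+ 5) - (3 - 17 * r + 5 * r ^+ 2 + r ^+ 3) * wt r ^+ 5 / 4
   - (1 + r) ^+ 3 * wt r ^+ 5 / 4 = ((K - 1) * (1 + r) ^+ 3
   + (2^-1 * r ^+ 3 + r ^+ 2 + 13 / 2 * r)) * wt r ^+ 5 by field.
rewrite mulr_ge0 ?exprn_ge0 ?(ltW w0)// addr_ge0//.
  by rewrite mulr_ge0 ?exprn_ge0//; lra.
have := exprn_ge0 3 (ltW r0); have := exprn_ge0 2 (ltW r0); lra.
Qed.

(** The term in [wt r ^+ 2] controls [f^2] near the origin, where [r f^2] is too weak; it is
    integrable because [f] is bounded. *)
Lemma igr_dom f f1 f2 : sq f -> sq f1 -> sq f2 -> (forall x : R, 0 < x -> `|f x| <= 1) ->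
  igr H (fun r => r * (f2 r ^+ 2 + f1 r ^+ 2 + f r ^+ 2) + wt r ^+ 2 * f r ^+ 2).
Proof.
move=> [mf If] [mf1 If1] [mf2 If2] fb.
have := igrD (mH (R := R)) (igrD (mH (R := R)) (igrD (mH (R := R)) If2 If1) If) (igr_wt2M mf fb).
by apply: igr_eq; [exact: mH|move=> r _; ring].
Qed.

Lemma wt3_le r : 0 < r -> (3 + r) * wt r <= 3.
Proof. by move=> r0; have := wtE r0; have := wt_le1 r0; lra. Qed.

(** * The scalar identity for a Bessel operator with mass *)

Section PotentialIdentity.
Variables (f f1 f2 : R -> R) (m K : R).
Hypotheses (K0 : 0 <= K) (pf : prim f f1) (pf1 : prim f1 f2).
Hypotheses (sf : sq f) (sf1 : sq f1) (sf2 : sq f2).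
Hypothesis fb : forall x : R, 0 < x -> `|f x| <= 1.

Let dom r := r * (f2 r ^+ 2 + f1 r ^+ 2 + f r ^+ 2) + wt r ^+ 2 * f r ^+ 2.

Let jj r := (r * f2 r + f1 r - K * (f r / r) - m ^+ 2 * (r * f r)) * (psi r * f1 r + chi r * f r).

Let co r := K * wt r ^+ 2 - (3 - 17 * r + 5 * r ^+ 2 + r ^+ 3) * wt r ^+ 5 / 4.

Let coer r := 2 * (r ^+ 2 * wt r ^+ 3) * f1 r ^+ 2 + co r * f r ^+ 2.

(** Each summand integrates one group of terms of [jj]: the first two come from [(r f1)'] against
    [psi f1] and [chi f], the third from the product [f f1] that the second leaves, the fourth from
    the centrifugal term. The last one is the whole mass term, an exact derivative by
    antisymmetry. *)
Let Phi r := ca r * (f1 r * f1 r) + cb r * (f r * f1 r) + (- 2^-1) * (ce r * (f r * f r))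
  + (- (K / 2)) * (cq r * (f r * f r)) + (- m ^+ 2) * (ca r * (f r * f r)).

Let prim_Phi : prim Phi (fun r => jj r + coer r).
Proof.
have ff := primM pf pf.
have := primD (primD (primD (primD (primM prim_ca (primM pf1 pf1)) (primM prim_cb (primM pf pf1)))
  (primZ (- 2^-1) (primM prim_ce ff))) (primZ (- (K / 2)) (primM prim_cq ff)))
  (primZ (- m ^+ 2) (primM prim_ca ff)).
apply: prim_ext => // x x0; rewrite /jj /coer /co /psi /chi /ca /cb /ce /cq /wt.
by field; lra.
Qed.

Let parts r : 0 < r -> [/\ 0 <= r * f2 r ^+ 2, 0 <= r * f1 r ^+ 2, 0 <= r * f r ^+ 2,
  0 <= wt r ^+ 2 * f r ^+ 2 & dom r = r * f2 r ^+ 2 + r * f1 r ^+ 2 + r * f r ^+ 2 + wt r ^+ 2 * f r ^+ 2].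
Proof. by move=> r0; have r0' := ltW r0; split; rewrite /dom; try pos; ring. Qed.

Let jj_le r : 0 < r -> `|jj r| <= (5 + 2 * (1 + K ^+ 2 + m ^+ 4)) * dom r.
Proof.
move=> r0; have [p1 p2 p3 p4 ->] := parts r0.
have [c1 c2 c3 c4 c5] := wt_cubes r0; have w0 := wt_gt0 r0; have w0' := ltW w0; have r0' := ltW r0.
(* The two factors of [jj] once [wt r ^+ 2] is taken out. Young's inequality splits this weight as
   [wt^3 U^2 + wt V^2], the split for which both squares are dominated. *)
pose U := r ^+ 2 * f2 r + r * f1 r + (- K) * f r + (- m ^+ 2) * (r ^+ 2 * f r).
pose V := r * f1 r + (3 + r) * wt r / 2 * f r.
have -> : jj r = wt r ^+ 2 * (U * V).
  by rewrite /jj /U /V /psi /chi; field; rewrite gt_eqF.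
have Y : `|wt r ^+ 2 * (U * V)| <= 2^-1 * (wt r ^+ 3 * U ^+ 2 + wt r * V ^+ 2).
  have q1 : 0 <= wt r * (wt r * U - V) ^+ 2 by pos.
  have q2 : 0 <= wt r * (wt r * U + V) ^+ 2 by pos.
  by rewrite ler_norml; apply/andP; split; nra.
have HU : wt r ^+ 3 * U ^+ 2 <= 4 * (1 + K ^+ 2 + m ^+ 4) *
    (r * f2 r ^+ 2 + r * f1 r ^+ 2 + r * f r ^+ 2 + wt r ^+ 2 * f r ^+ 2).
  apply: le_trans (_ : _ <= wt r ^+ 3 * (4 * ((r ^+ 2 * f2 r) ^+ 2 + (r * f1 r) ^+ 2
     + ((- K) * f r) ^+ 2 + ((- m ^+ 2) * (r ^+ 2 * f r)) ^+ 2))) _.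
    by rewrite ler_wpM2l ?sqrD4_le//; pos.
  have -> : wt r ^+ 3 * (4 * ((r ^+ 2 * f2 r) ^+ 2 + (r * f1 r) ^+ 2
     + ((- K) * f r) ^+ 2 + ((- m ^+ 2) * (r ^+ 2 * f r)) ^+ 2)) =
     4 * ((r ^+ 4 * wt r ^+ 3) * f2 r ^+ 2 + (r ^+ 2 * wt r ^+ 3) * f1 r ^+ 2
      + K ^+ 2 * (wt r ^+ 3 * f r ^+ 2) + m ^+ 4 * ((r ^+ 4 * wt r ^+ 3) * f r ^+ 2)) by ring.
  rewrite -[leRHS]mulrA ler_pM2l//.
  have h1 : r ^+ 4 * wt r ^+ 3 * f2 r ^+ 2 <= r * f2 r ^+ 2 by rewrite ler_wpM2r ?sqr_ge0.
  have h2 : r ^+ 2 * wt r ^+ 3 * f1 r ^+ 2 <= r * f1 r ^+ 2 by rewrite ler_wpM2r ?sqr_ge0.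
  have h3 : K ^+ 2 * (wt r ^+ 3 * f r ^+ 2) <= K ^+ 2 * (wt r ^+ 2 * f r ^+ 2).
    by rewrite ler_wpM2l ?sqr_ge0// ler_wpM2r ?sqr_ge0.
  have m4 : 0 <= m ^+ 4 by rewrite (_ : m ^+ 4 = (m ^+ 2) ^+ 2) ?sqr_ge0//; ring.
  have h4 : m ^+ 4 * ((r ^+ 4 * wt r ^+ 3) * f r ^+ 2) <= m ^+ 4 * (r * f r ^+ 2).
    by rewrite ler_wpM2l// ler_wpM2r ?sqr_ge0.
  have K2 := sqr_ge0 K.
  have e1 : 0 <= (K ^+ 2 + m ^+ 4) * (r * f2 r ^+ 2) by pos.
  have e2 : 0 <= (K ^+ 2 + m ^+ 4) * (r * f1 r ^+ 2) by pos.
  have e3 : 0 <= (1 + K ^+ 2) * (r * f r ^+ 2) by pos.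
  have e4 : 0 <= (1 + m ^+ 4) * (wt r ^+ 2 * f r ^+ 2) by pos.
  move: h1 h2 h3 h4 e1 e2 e3 e4; lra.
have HV : wt r * V ^+ 2 <= 10 * (r * f2 r ^+ 2 + r * f1 r ^+ 2 + r * f r ^+ 2 + wt r ^+ 2 * f r ^+ 2).
  have b1 : ((3 + r) * wt r / 2) ^+ 2 <= 9 / 4.
    have s0 : 0 <= (3 + r) * wt r by pos.
    have s3 := wt3_le r0.
    by move: s0 s3; nra.
  have h0 : V ^+ 2 <= 2 * ((r * f1 r) ^+ 2 + ((3 + r) * wt r / 2 * f r) ^+ 2).
    by rewrite /V; have := sqr_ge0 (r * f1 r - (3 + r) * wt r / 2 * f r); nra.
  apply: le_trans (ler_wpM2l w0' h0) _.
  have -> : wt r * (2 * ((r * f1 r) ^+ 2 + ((3 + r) * wt r / 2 * f r) ^+ 2)) =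
    2 * ((r ^+ 2 * wt r) * f1 r ^+ 2 + ((3 + r) * wt r / 2) ^+ 2 * (wt r * f r ^+ 2)) by ring.
  have h1 : r ^+ 2 * wt r * f1 r ^+ 2 <= r * f1 r ^+ 2 by rewrite ler_wpM2r ?sqr_ge0.
  have h2 : wt r * f r ^+ 2 <= wt r ^+ 2 * f r ^+ 2 + r * f r ^+ 2.
    by rewrite -mulrDl ler_wpM2r ?sqr_ge0.
  have h3 : ((3 + r) * wt r / 2) ^+ 2 * (wt r * f r ^+ 2) <= 9 / 4 * (wt r * f r ^+ 2).
    by rewrite ler_wpM2r//; pos.
  move: h1 h2 h3 p1 p2 p3 p4; lra.
move: Y HU HV; lra.
Qed.

Let co_le r : 0 < r -> `|co r| <= (K + 5) * wt r ^+ 2.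
Proof.
move=> r0; have w0 := wt_gt0 r0; rewrite /co.
have E : (1 + r) ^+ 3 * wt r ^+ 5 = wt r ^+ 2.
  have -> : (1 + r) ^+ 3 * wt r ^+ 5 = ((1 + r) * wt r) ^+ 3 * wt r ^+ 2 by ring.
  by rewrite wtE// expr1n mul1r.
have w5 : 0 <= wt r ^+ 5 by rewrite exprn_ge0// ltW.
have B : `|3 - 17 * r + 5 * r ^+ 2 + r ^+ 3| <= 17 * (1 + r) ^+ 3.
  have := exprn_ge0 3 (ltW r0); have := exprn_ge0 2 (ltW r0) => ? ?.
  by rewrite ler_norml; apply/andP; split; lra.
apply: le_trans (ler_normB _ _) _.
rewrite (ger0_norm (_ : 0 <= K * wt r ^+ 2)); last by pos.
rewrite -mulrA normrM (ger0_norm (_ : 0 <= wt r ^+ 5 / 4)); last by pos.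
have : `|3 - 17 * r + 5 * r ^+ 2 + r ^+ 3| * (wt r ^+ 5 / 4) <= 17 / 4 * wt r ^+ 2.
  by rewrite -E; have := ler_wpM2r w5 B; lra.
have := sqr_ge0 (wt r); lra.
Qed.

Let coer_le r : 0 < r -> `|coer r| <= (K + 7) * dom r.
Proof.
move=> r0; have [p1 p2 p3 p4 ->] := parts r0.
have [c1 c2 c3 c4 c5] := wt_cubes r0; have w0 := wt_gt0 r0; have w0' := ltW w0; have r0' := ltW r0.
apply: le_trans (ler_normD _ _) _.
rewrite (ger0_norm (_ : 0 <= 2 * (r ^+ 2 * wt r ^+ 3) * f1 r ^+ 2)); last by pos.
have h1 : 2 * (r ^+ 2 * wt r ^+ 3) * f1 r ^+ 2 <= 2 * (r * f1 r ^+ 2).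
  by rewrite -mulrA ler_pM2l// ler_wpM2r ?sqr_ge0.
have h2 : `|co r * f r ^+ 2| <= (K + 5) * (wt r ^+ 2 * f r ^+ 2).
  by rewrite normrM (ger0_norm (sqr_ge0 (f r))) mulrA ler_wpM2r ?sqr_ge0 ?co_le.
have e1 : 0 <= (K + 7) * (r * f2 r ^+ 2) by pos.
have e2 : 0 <= (K + 5) * (r * f1 r ^+ 2) by pos.
have e3 : 0 <= (K + 7) * (r * f r ^+ 2) by pos.
move: h1 h2 e1 e2 e3 p4; lra.
Qed.

Let Phi_le r : 0 < r -> `|Phi r / r| <= (10 + K + m ^+ 2) * dom r.
Proof.
move=> r0; have [p1 p2 p3 p4 ->] := parts r0.
have [c1 c2 c3 c4 c5] := wt_cubes r0; have w0 := wt_gt0 r0; have w0' := ltW w0; have r0' := ltW r0.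
have w1 := wt_le1 r0.
have w2 : wt r ^+ 2 <= 1 by rewrite exprn_ile1.
pose a' := r ^+ 2 * wt r ^+ 2 / 2; pose b' := r * (3 + r) * wt r ^+ 3 / 2.
pose e' := (3 - 4 * r - r ^+ 2) * wt r ^+ 4 / 2.
have -> : Phi r / r = a' * f1 r ^+ 2 + b' * (f r * f1 r) + (- 2^-1) * (e' * f r ^+ 2)
  + (- (K / 2)) * (wt r ^+ 2 * f r ^+ 2) + (- m ^+ 2) * (a' * f r ^+ 2).
  by rewrite /Phi /a' /b' /e' /ca /cb /ce /cq; field; rewrite gt_eqF.
have a0 : 0 <= a' by rewrite /a'; pos.
have a1 : a' <= r.
  have -> : a' = (r ^+ 2 * wt r) * (wt r / 2) by rewrite /a'; ring.
  apply: le_trans c1; rewrite ler_piMr//; first by pos.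
  by move: w1; lra.
have b0 : 0 <= b' by rewrite /b'; pos.
have b1 : b' <= 3 / 2 * r.
  have s3 := wt3_le r0.
  have -> : b' = (r / 2 * wt r ^+ 2) * ((3 + r) * wt r) by rewrite /b'; ring.
  apply: le_trans (_ : _ <= (r / 2 * 1) * 3) _; last by move: r0; lra.
  apply: ler_pM => //; try pos.
  by rewrite ler_wpM2l//; pos.
have e1 : `|e'| <= 2 * wt r ^+ 2.
  have E : (1 + r) ^+ 2 * wt r ^+ 4 = wt r ^+ 2.
    have -> : (1 + r) ^+ 2 * wt r ^+ 4 = ((1 + r) * wt r) ^+ 2 * wt r ^+ 2 by ring.
    by rewrite wtE// expr1n mul1r.
  have w4 : 0 <= wt r ^+ 4 by rewrite exprn_ge0.
  have B : `|3 - 4 * r - r ^+ 2| <= 4 * (1 + r) ^+ 2.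
    have := exprn_ge0 2 (ltW r0) => ?.
    by rewrite ler_norml; apply/andP; split; lra.
  rewrite /e' -mulrA normrM (ger0_norm (_ : 0 <= wt r ^+ 4 / 2)); last by pos.
  by rewrite -E; have := ler_wpM2r w4 B; lra.
have T1 : a' * f1 r ^+ 2 <= r * f1 r ^+ 2 by rewrite ler_wpM2r ?sqr_ge0.
have T2 : `|b' * (f r * f1 r)| <= 3 / 2 * (r * f r ^+ 2 + r * f1 r ^+ 2).
  rewrite normrM (ger0_norm b0) -mulrDr mulrA.
  by apply: ler_pM => //; exact: sq_young.
have T3 : `|(- 2^-1) * (e' * f r ^+ 2)| <= wt r ^+ 2 * f r ^+ 2.
  rewrite normrM normrN (ger0_norm (_ : 0 <= (2 : R)^-1)) ?invr_ge0// normrM (ger0_norm (sqr_ge0 (f r))).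
  by have := ler_wpM2r (sqr_ge0 (f r)) e1; lra.
have T4 : `|(- (K / 2)) * (wt r ^+ 2 * f r ^+ 2)| <= K * (wt r ^+ 2 * f r ^+ 2).
  have K2 : 0 <= K / 2 by pos.
  rewrite normrM normrN (ger0_norm K2) (ger0_norm p4) ler_wpM2r//.
  by move: K0; lra.
have T5 : `|(- m ^+ 2) * (a' * f r ^+ 2)| <= m ^+ 2 * (r * f r ^+ 2).
  have af : 0 <= a' * f r ^+ 2 by pos.
  rewrite normrM normrN (ger0_norm (sqr_ge0 m)) (ger0_norm af) ler_wpM2l ?sqr_ge0//.
  by rewrite ler_wpM2r ?sqr_ge0.
have T1' : `|a' * f1 r ^+ 2| <= r * f1 r ^+ 2 by rewrite ger0_norm//; pos.
have N := le_trans (ler_normD _ _) (lerD (le_trans (ler_normD _ _) (lerD (le_trans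
  (ler_normD _ _) (lerD (le_trans (ler_normD _ _) (lerD T1' T2)) T3)) T4)) T5).
apply: le_trans N _.
have e2 : 0 <= (K + m ^+ 2) * (r * f2 r ^+ 2) by pos.
have e3 : 0 <= (K + m ^+ 2) * (r * f1 r ^+ 2) by pos.
have e4 : 0 <= K * (r * f r ^+ 2) by pos.
have e5 : 0 <= m ^+ 2 * (wt r ^+ 2 * f r ^+ 2) by pos.
move: e2 e3 e4 e5 p1 p2 p3 p4; lra.
Qed.

(** The sum [jj + coer] has the primitive [Phi], and [Phi / r] is integrable, so that [prim_int0]
    discards both ends at once. *)
Lemma virial_identity : [/\ igr H jj, igr H coer & \int[mu]_(r in H) jj r = - \int[mu]_(r in H) coer r].
Proof.
have Id : igr H dom by exact: igr_dom.
have mf := prim_meas pf; have mf1 := prim_meas pf1; have mf2 := prim_meas_dens pf1.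
have minv := prim_meas (@prim_inv).
have mw := meas_wt.
have Ij : igr H jj.
  apply: (igr_le (mH (R := R)) _ _ (igrZ (5 + 2 * (1 + K ^+ 2 + m ^+ 4)) (mH (R := R)) Id)); last first.
    by move=> r; rewrite inH; exact: jj_le.
  apply: measurable_funM; last first.
    by apply: measurable_funD; apply: measurable_funM => //; [exact: meas_psi|exact: meas_chi].
  apply: measurable_funB; last by apply: measurable_funM => //; exact: measurable_funM.
  apply: measurable_funB; last by apply: measurable_funM => //; exact: measurable_funM.
  by apply: measurable_funD => //; exact: measurable_funM.
have Ic : igr H coer.
  apply: (igr_le (mH (R := R)) _ _ (igrZ (K + 7) (mH (R := R)) Id)); last first.
    by move=> r; rewrite inH; exact: coer_le.
  have mX n : measurable_fun H (fun r : R => wt r ^+ n) by exact: measurable_funX.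
  have mr n : measurable_fun H (fun r : R => r ^+ n) by exact: measurable_funX.
  apply: measurable_funD; apply: measurable_funM; try exact: measurable_funX.
    by apply: measurable_funM => //; exact: measurable_funM.
  apply: measurable_funB; first exact: measurable_funM.
  apply: measurable_funM => //; apply: measurable_funM => //.
  apply: measurable_funD => //; apply: measurable_funD; last exact: measurable_funM.
  by apply: measurable_funB => //; exact: measurable_funM.
split=> //; have IS := igrD (mH (R := R)) Ij Ic.
have : \int[mu]_(r in H) (jj r + coer r) = 0.
  apply: (prim_int0 prim_Phi IS).
  apply: (igr_le (mH (R := R)) _ _ (igrZ (10 + K + m ^+ 2) (mH (R := R)) Id)); last first.
    by move=> r; rewrite inH; exact: Phi_le.
  by apply: measurable_funM => //; exact: prim_meas prim_Phi.
by rewrite (RintD (mH (R := R)) Ij Ic) => /eqP; rewrite addr_eq0 => /eqP.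
Qed.

End PotentialIdentity.

End Virial.

(** * The radial Dirac operator *)

Section VirialEstimate.
Context {R : realType}.
Local Notation mu := (@lebesgue_measure R).
Local Notation H := (`]0%R, +oo[%classic : set R).
Implicit Types (a b c d h r : R).

(** The bracket on the right is the derivative of the bounded function [- (1 + sqrt r)^-1]; the
    comparison amounts to [(1 + s)^2 <= 2 (1 + s^2)] with [s = sqrt r]. *)
Lemma sqrt_wt_bound r : 0 < r ->
  wt r / Num.sqrt r <= 4 * (2^-1 * (Num.sqrt r)^-1 * (1 + Num.sqrt r)^-1 ^+ 2).
Proof.
move=> r0; set s := Num.sqrt r; have s0 : 0 < s by rewrite sqrtr_gt0.
have rE : r = s ^+ 2 by rewrite sqr_sqrtr// ltW.
rewrite /wt rE -subr_ge0.
have -> : 4 * (2^-1 * s^-1 * (1 + s)^-1 ^+ 2) - (1 + s ^+ 2)^-1 / s =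
   (1 - s) ^+ 2 * ((1 + s)^-1 ^+ 2 * (1 + s ^+ 2)^-1 * s^-1).
  field; apply/and3P; split; rewrite gt_eqF//; nra.
by have := ltW s0; move=> s0'; pos; rewrite addr_ge0 ?sqr_ge0.
Qed.

Lemma igr_sqrt_wt : igr H (fun r => wt r / Num.sqrt r).
Proof.
pose g x : R := 2^-1 * (Num.sqrt x)^-1 * (1 + Num.sqrt x)^-1 ^+ 2.
pose V x : R := - (1 + Num.sqrt x)^-1.
have pV : prim V g.
  apply: prim_C1 => x x0; have s0 : 0 < Num.sqrt x by rewrite sqrtr_gt0.
    have n0 : 1 + Num.sqrt x != 0 by rewrite gt_eqF// addr_gt0.
    have ds := is_derive1_sqrt x0.
    have d1 : is_derive x (1 : R) (fun y => 1 + Num.sqrt y) (2 * Num.sqrt x)^-1.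
      by have := is_deriveD (is_derive_cst (1 : R) x 1) ds; rewrite add0r.
    have := is_deriveN (@is_deriveV R _ x _ 1 n0 d1).
    rewrite /g /GRing.scale/= => dd; apply: is_derive_eq dd _.
    by field; rewrite n0 gt_eqF.
  have cs : {for x, continuous (@Num.sqrt R)} by exact: sqrt_continuous.
  apply: cvgM; last first.
    have ci : {for x, continuous (fun y : R => (1 + Num.sqrt y)^-1)}.
      apply: cvgV; first by rewrite gt_eqF// addr_gt0.
      by apply: cvgD => //; exact: cvg_cst.
    by apply: cvgM; exact: ci.
  by apply: cvgM; [exact: cvg_cst|apply: cvgV => //; rewrite gt_eqF].
have g0 x : 0 < x -> 0 <= g x.
  move=> x0; have s0 : 0 < Num.sqrt x by rewrite sqrtr_gt0.
  by have := ltW s0; rewrite /g => ?; pos.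
have Vb x : 0 < x -> -1 <= V x <= 0.
  move=> x0; have s0 := sqrtr_ge0 x.
  have p0 : 0 < 1 + Num.sqrt x by lra.
  have q1 : (1 + Num.sqrt x)^-1 <= 1 by rewrite invf_le1//; lra.
  have q0 : 0 < (1 + Num.sqrt x)^-1 by rewrite invr_gt0.
  by rewrite /V; apply/andP; split; lra.
have [Ig _] := prim_bdd pV g0 Vb.
apply: (igr_le (mH (R := R)) _ _ (igrZ 4 (mH (R := R)) Ig)).
  apply: measurable_funM; first exact: meas_wt.
  apply: cont_meas => x x0; apply: cvgV; first by rewrite gt_eqF// sqrtr_gt0.
  exact: sqrt_continuous.
move=> r; rewrite inH => r0; rewrite ger0_norm; first exact: sqrt_wt_bound.
by apply: mulr_ge0; [exact: ltW (wt_gt0 r0)|rewrite invr_ge0 sqrtr_ge0].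
Qed.

(* Cauchy-Schwarz on [x, y] with the weights s ds and ds / s. *)
Lemma prim_hoelder (u g : R -> R) h r x y : prim u g -> sq g -> N2 g <= 1 ->
  0 < h -> 0 < r -> r <= x <= r + h -> r <= y <= r + h ->
  `|u x - u y| <= Num.sqrt (h / r).
Proof.
move=> pu sg g1 h0 r0.
wlog xy : x y / y <= x => [hw xr yr|].
  by have [yx|xy] := leP y x; [exact: hw|rewrite distrC; apply: hw => //; exact: ltW].
move=> /andP[_ xr] /andP[ry _].
have y0 : 0 < y by exact: lt_le_trans ry.
have [Ig ug] := pu; rewrite ug//.
have q0 : 0 < h / r by rewrite divr_gt0.
(* The target bound is also the parameter in Young's inequality: each of the two resulting integrals
   contributes at most [q / 2]. *)
set q := Num.sqrt (h / r); have qp : 0 < q by rewrite sqrtr_gt0.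
have qE : q ^+ 2 = h / r by rewrite sqr_sqrtr// ltW.
apply: le_trans (norm_Rint_le (mitv y x) (Ig y x y0)) _.
have [_ I2] := sg.
have I2' : igr `[y, x] (fun s => s * g s ^+ 2).
  by apply: igrS I2 => //; exact: itvH.
have Ic : igr `[y, x] (fun=> q^-1 / r / 2).
  by apply: (@cont_locigr R (fun=> q^-1 / r / 2)) => // z z0; exact: cst_continuous.
have IS := igrD (mitv y x) (igrZ (q / 2) (mitv y x) I2') Ic.
apply: le_trans (_ : _ <= \int[mu]_(s in `[y, x]) (q / 2 * (s * g s ^+ 2) + q^-1 / r / 2)) _.
  apply: le_Rint => //; first exact: igr_norm (Ig y x y0).
  move=> s; rewrite /= in_itv/= => /andP[ys _].
  have rs : r <= s by exact: le_trans ys.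
  have s0 : 0 < s by exact: lt_le_trans rs.
  have h1 : q / 2 * (r * g s ^+ 2) <= q / 2 * (s * g s ^+ 2).
    by rewrite ler_pM2l ?divr_gt0// ler_wpM2r ?sqr_ge0.
  rewrite -[g s ^+ 2]real_normK ?num_real// in h1 *.
  have : 0 <= (q * r * `|g s| - 1) ^+ 2 / (2 * q * r).
    by rewrite divr_ge0 ?sqr_ge0// mulr_ge0 ?mulr_ge0// ltW.
  have -> : (q * r * `|g s| - 1) ^+ 2 / (2 * q * r) =
     q / 2 * (r * `|g s| ^+ 2) - `|g s| + q^-1 / r / 2.
    by field; rewrite !gt_eqF.
  lra.
rewrite (RintD (mitv y x) (igrZ (q / 2) (mitv y x) I2') Ic) (RintZ _ (mitv y x) I2').
have h1 : \int[mu]_(s in `[y, x]) (s * g s ^+ 2) <= 1.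
  apply: le_trans g1; apply: ge0_Rint_sub => // z z0; rewrite mulr_ge0 ?sqr_ge0 ?ltW//.
have h2 : \int[mu]_(s in `[y, x]) (q^-1 / r / 2) <= q / 2.
  move: xy; rewrite le_eqVlt => /predU1P[->|yx].
    by rewrite set_itv1 Rintegral_set1 divr_ge0 ?(ltW qp).
  rewrite Rint_cst_itv//.
  apply: le_trans (_ : _ <= q^-1 / r / 2 * h) _.
    rewrite ler_wpM2l//; first by rewrite !divr_ge0 ?invr_ge0 ?(ltW qp) ?(ltW r0).
    by lra.
  have -> : q^-1 / r / 2 * h = q^-1 * (h / r) / 2 by ring.
  by rewrite -qE expr2 mulrA mulVf ?mul1r// gt_eqF.
have : q / 2 * \int[mu]_(s in `[y, x]) (s * g s ^+ 2) <= q / 2 * 1.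
  by rewrite ler_wpM2l ?divr_ge0 ?(ltW qp).
lra.
Qed.

(* An index (a, b) stands for a real unknown: b selects the component of the
   spinor, and a its real or imaginary part, as spelled out in [to_spinor]. *)
Definition idx := (bool * bool)%type.
Definition swp (i : idx) : idx := (i.1, ~~ i.2).
Definition tau (i : idx) : idx := (~~ i.1, i.2).
Definition sgn (i : idx) : R := if i.1 == i.2 then -1 else 1.
Definition cc (k : R) (i : idx) : R := if i.2 then - k else k + 1.

Lemma sum_idx (F : idx -> R) : \sum_i F i =
  F (false, false) + F (false, true) + (F (true, false) + F (true, true)).
Proof.
rewrite (eq_bigr (fun p => F (p.1, p.2))) => [|[]//].
rewrite -(pair_bigA _ (fun x y => F (x, y))) /= !big_bool /=.
by rewrite addrC [F (false, true) + _]addrC [F (true, true) + _]addrC.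
Qed.

Lemma ae_idx (P : idx -> R -> Prop) : (forall i, {ae mu, forall r, P i r}) ->
  {ae mu, forall r, forall i, P i r}.
Proof.
move=> hP; have h2 (a b : idx) : {ae mu, forall r, P a r /\ P b r} by exact: aeS2 (hP a) (hP b).
by apply: aeS2 (h2 (false, false) (false, true)) (h2 (true, false) (true, true))
  => r [? ?] [? ?] [[] []].
Qed.

Lemma le_sum1 (F : idx -> R) i : (forall j, 0 <= F j) -> F i <= \sum_j F j.
Proof. by move=> F0; rewrite (bigD1 i)//= lerDl sumr_ge0. Qed.

Lemma sqr_sum_le (F : idx -> R) : (\sum_i F i) ^+ 2 <= 4 * \sum_i F i ^+ 2.
Proof.
rewrite !sum_idx.
have := sqrD4_le (F (false, false)) (F (false, true)) (F (true, false)) (F (true, true)).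
by rewrite !addrA.
Qed.

Variables (k m : R).

(* The linear part of the system in the unknowns f, with derivatives f1; LL1 is
   its r-derivative. *)
Definition LL (f f1 : idx -> R -> R) i r : R :=
  f1 (swp i) r + cc k i * (f (swp i) r / r) + m * sgn i * f (tau i) r.

Definition LL1 (f f1 f2 : idx -> R -> R) i r : R :=
  f2 (swp i) r + cc k i * (f1 (swp i) r / r - f (swp i) r / r ^+ 2)
  + m * sgn i * f1 (tau i) r.

Definition XX (f f1 : idx -> R -> R) i r : R := psi r * f1 i r + chi r * f i r.

Lemma prim_LL f f1 f2 i : (forall j, prim (f j) (f1 j)) -> (forall j, prim (f1 j) (f2 j)) ->
  prim (LL f f1 i) (LL1 f f1 f2 i).
Proof.
move=> pf pf1.
have := primD (primD (pf1 (swp i)) (primZ (cc k i) (primM (pf (swp i)) (@prim_inv R))))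
  (primZ (m * sgn i) (pf (tau i))).
by apply: prim_ext => x x0; rewrite /LL /LL1; [ring|field; rewrite gt_eqF].
Qed.

(** Since [cc k i + cc k (swp i) = 1], the terms in [f'] and [f] combine into a Bessel operator with
    squared momentum [cc k (swp i) ^+ 2]. The sign [sgn] changes under both [swp] and [tau]: the
    mixed mass terms cancel and the squared one is [- m^2]. *)
Lemma LL_LL f f1 f2 i r : 0 < r ->
  r * LL (LL f f1) (LL1 f f1 f2) i r =
  r * f2 i r + f1 i r - cc k (swp i) ^+ 2 * (f i r / r) - m ^+ 2 * (r * f i r).
Proof.
move=> r0; have rn0 : r != 0 by rewrite gt_eqF.
by case: i => [[] []]; rewrite /LL /LL1 /swp /tau /sgn /cc /=; field.
Qed.

Definition kap : R := 2 + `|k|.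

Lemma cc_le i : `|cc k i| <= kap.
Proof.
rewrite /cc /kap; case: ifP => _; first by rewrite normrN; lra.
by apply: le_trans (ler_normD _ _) _; rewrite normr1; lra.
Qed.

Lemma kap_ge1 : 1 <= kap.
Proof. by rewrite /kap; have := normr_ge0 k; lra. Qed.

Lemma sgn_norm i : `|sgn i| = 1.
Proof. by rewrite /sgn; case: ifP => _; rewrite ?normrN normr1. Qed.

(* The remainder terms of the virial identity, bounded pointwise.  A and B bound
   the first derivatives and the values, N is the size of the nonlinearity and e
   that of the regularization errors. *)
Lemma source_bound (A B F F1 N e r : R) : 0 < r -> 0 <= A -> 0 <= B -> 0 <= N -> 0 <= e ->
  0 <= F -> 0 <= F1 ->
  F <= N * B + e -> r * F1 <= N * (r * A) + e ->
  (kap + `|m| * r) * N <= wt r ^+ 2 / 1536 ->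
  r * (F1 + kap * (F / r) + `|m| * F) * (psi r * A + chi r * B)
  + r * (A + kap * (B / r) + `|m| * B) * (psi r * F1 + chi r * F) <=
  (r ^+ 2 * wt r ^+ 3 * A ^+ 2 + wt r ^+ 2 * B ^+ 2) / 256
  + 6 * (kap + `|m|) * (r * wt r) * e * (r * A + B).
Proof.
move=> r0 A0 B0 N0 e0 F0 F10 hF hF1 hN.
have r0' := ltW r0; have w0 := wt_gt0 r0; have w0' := ltW w0; have m0 := normr_ge0 m.
have k1 := kap_ge1; have k0 : 0 <= kap by apply: le_trans k1.
have /andP[chi0 chi1] := chi_bound r0.
have psiE : psi r = r ^+ 2 * wt r ^+ 2 by rewrite /psi exprMn.
(* Up to weights, the multiplier and [r L] are both controlled by the single combination [r x + y]
   of a derivative [x] and a value [y]. *)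
set Q := r * A + B; set T := r * F1 + F.
have Q0 : 0 <= Q by rewrite /Q; pos.
have T0 : 0 <= T by rewrite /T; pos.
have XB (x y : R) : 0 <= x -> 0 <= y ->
    0 <= psi r * x + chi r * y <= 3 / 2 * r * wt r ^+ 2 * (r * x + y).
  move=> x0 y0; have p0 : 0 <= psi r by exact: sqr_ge0.
  apply/andP; split; first by pos.
  have h1 : chi r * y <= 3 / 2 * r * wt r ^+ 2 * y by rewrite ler_wpM2r.
  have h2 : 0 <= r ^+ 2 * wt r ^+ 2 * x by pos.
  rewrite psiE; move: h1 h2; clear; lra.
have LB (x y : R) : 0 <= x -> 0 <= y ->
    0 <= r * (x + kap * (y / r) + `|m| * y) <= (kap + `|m| * r) * (r * x + y).
  move=> x0 y0; apply/andP; split; first by pos.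
  have -> : r * (x + kap * (y / r) + `|m| * y) = r * x + kap * y + `|m| * (r * y).
    by field; rewrite gt_eqF.
  have h1 : 0 <= (kap - 1) * (r * x) by rewrite mulr_ge0 ?subr_ge0//; pos.
  have h2 : 0 <= `|m| * r * (r * x) by pos.
  move: h1 h2; clear; lra.
have /andP[a0 a1] := XB A B A0 B0; have /andP[b0 b1] := XB F1 F F10 F0.
have /andP[c0 c1] := LB A B A0 B0; have /andP[d0 d1] := LB F1 F F10 F0.
rewrite -/Q -/T in a1 b1 c1 d1.
set kr := kap + `|m| * r in c1 d1 hN *.
have kr0 : 0 <= kr by rewrite /kr; pos.
have P1 := ler_pM d0 a0 d1 a1; have P2 := ler_pM c0 b0 c1 b1.
apply: le_trans (lerD P1 P2) _.
have -> : kr * T * (3 / 2 * r * wt r ^+ 2 * Q) + kr * Q * (3 / 2 * r * wt r ^+ 2 * T)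
  = 3 * r * wt r ^+ 2 * kr * Q * T by field.
have TQ : T <= N * Q + 2 * e by rewrite /T /Q; move: hF hF1; clear; lra.
have c30 : 0 <= 3 * r * wt r ^+ 2 * kr * Q by pos.
apply: le_trans (ler_wpM2l c30 TQ) _.
have -> : 3 * r * wt r ^+ 2 * kr * Q * (N * Q + 2 * e) =
  3 * r * wt r ^+ 2 * Q ^+ 2 * (kr * N) + 6 * (r * wt r) * e * Q * (kr * wt r) by ring.
apply: lerD.
  (* The factor 3 here and the factor 2 in the bound of [Q ^+ 2] turn 1/1536 into 1/256. *)
  have h1 : 3 * r * wt r ^+ 2 * Q ^+ 2 * (kr * N) <= 3 * r * wt r ^+ 2 * Q ^+ 2 * (wt r ^+ 2 / 1536).
    by rewrite ler_wpM2l//; pos.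
  apply: le_trans h1 _.
  have Q2 : Q ^+ 2 <= 2 * (r ^+ 2 * A ^+ 2 + B ^+ 2).
    by rewrite /Q; have := sqr_ge0 (r * A - B); clear; nra.
  have w4 : 0 <= r * wt r ^+ 4 by pos.
  have h2 := ler_wpM2l w4 Q2.
  have h3 : r * wt r ^+ 4 * (r ^+ 2 * A ^+ 2) <= r ^+ 2 * wt r ^+ 3 * A ^+ 2.
    have -> : r * wt r ^+ 4 * (r ^+ 2 * A ^+ 2) = (r ^+ 2 * wt r ^+ 3 * A ^+ 2) * (r * wt r) by ring.
    by rewrite ler_piMr ?rwt_le1//; pos.
  have h4 : r * wt r ^+ 4 * B ^+ 2 <= wt r ^+ 2 * B ^+ 2.
    have -> : r * wt r ^+ 4 * B ^+ 2 = (wt r ^+ 2 * B ^+ 2) * ((r * wt r) * wt r) by ring.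
    rewrite ler_piMr//; first by pos.
    by rewrite mulr_ile1 ?rwt_le1 ?wt_le1//; pos.
  move: h2 h3 h4; clear; lra.
have kw : kr * wt r <= kap + `|m|.
  have -> : kr * wt r = kap * wt r + `|m| * (r * wt r) by rewrite /kr; ring.
  by apply: lerD; rewrite ler_piMr ?wt_le1 ?rwt_le1.
have c60 : 0 <= 6 * (r * wt r) * e * Q by pos.
have := ler_wpM2l c60 kw; clear; lra.
Qed.

End VirialEstimate.

(** * The virial estimate *)

Section VirialRate.
Context {R : realType}.
Local Notation mu := (@lebesgue_measure R).
Local Notation H := (`]0%R, +oo[%classic : set R).
Implicit Types (a b c d h r : R).

Lemma N2_ext (v w : R -> R) : (forall r : R, 0 < r -> v r = w r) -> N2 v = N2 w.
Proof. by move=> vw; apply: eq_Rintegral => r; rewrite inE inH => r0; rewrite vw. Qed.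

Variables (k m : R).
Hypotheses (k1 : 1 <= k ^+ 2) (k2 : 1 <= (k + 1) ^+ 2).

Lemma cc_sqr_ge1 i : 1 <= cc k i ^+ 2.
Proof. by rewrite /cc; case: ifP => _ //; rewrite sqrrN. Qed.

(* LL and XX up to weights, so that both are bounded operators on L^2(r dr) and
   VV is differentiable in time together with its arguments. *)
Definition VV (f f1 : idx -> R -> R) i r : R :=
  (r * wt r) * f1 (swp i) r + (cc k i * wt r) * f (swp i) r
  + (m * sgn i * (r * wt r)) * f (tau i) r.

Definition ZZ (f f1 : idx -> R -> R) i r : R :=
  (r * wt r) * f1 i r + ((3 + r) * wt r ^+ 2 / 2) * f i r.

Lemma VV_ZZ (f f1 g g1 : idx -> R -> R) i r : 0 < r ->
  r * (VV f f1 i r * ZZ g g1 i r) = r * (LL k m f f1 i r * XX g g1 i r).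
Proof. by move=> r0; rewrite /VV /ZZ /LL /XX /psi /chi; field; rewrite gt_eqF. Qed.

Lemma rwt_meas : measurable_fun H (fun r : R => r * wt r).
Proof. by apply: measurable_funM => //; exact: meas_wt. Qed.

Lemma rwt_bound r : 0 < r -> `|r * wt r| <= 1.
Proof. by move=> r0; rewrite ger0_norm ?rwt_le1// mulr_ge0 ?ltW ?wt_gt0. Qed.

Lemma cwt_meas c : measurable_fun H (fun r : R => c * wt r).
Proof. by apply: measurable_funM => //; exact: meas_wt. Qed.

Lemma cwt_bound c r : 0 < r -> `|c * wt r| <= `|c|.
Proof.
move=> r0; rewrite normrM [`|wt r|]gtr0_norm ?wt_gt0//.
by rewrite ler_piMr ?wt_le1.
Qed.

Lemma crwt_meas c : measurable_fun H (fun r : R => c * (r * wt r)).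
Proof. by apply: measurable_funM => //; exact: rwt_meas. Qed.

Lemma crwt_bound c r : 0 < r -> `|c * (r * wt r)| <= `|c|.
Proof. by move=> r0; rewrite normrM ler_piMr ?rwt_bound. Qed.

Lemma zwt_meas : measurable_fun H (fun r : R => (3 + r) * wt r ^+ 2 / 2).
Proof.
apply: measurable_funM => //; apply: measurable_funM; first exact: measurable_funD.
by apply: measurable_funX; exact: meas_wt.
Qed.

Lemma zwt_bound r : 0 < r -> `|(3 + r) * wt r ^+ 2 / 2| <= 2.
Proof.
move=> r0; have w0 := wt_gt0 r0; have w1 := wt_le1 r0; have h3 := wt3_le r0.
have w0' := ltW w0; have r0' := ltW r0.
rewrite ger0_norm; last by pos.
have -> : (3 + r) * wt r ^+ 2 / 2 = ((3 + r) * wt r) * wt r / 2 by ring.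
have : (3 + r) * wt r * wt r <= 3 * 1 by apply: ler_pM => //; pos.
lra.
Qed.

Lemma sq_VV (f f1 : idx -> R -> R) i : (forall j, sq (f j)) -> (forall j, sq (f1 j)) ->
  sq (VV f f1 i).
Proof.
move=> sf sf1; apply: sqD; first apply: sqD.
- exact: (proj1 (sqM rwt_meas rwt_bound (sf1 _))).
- exact: (proj1 (sqM (cwt_meas _) (@cwt_bound _) (sf _))).
- exact: (proj1 (sqM (crwt_meas _) (@crwt_bound _) (sf _))).
Qed.

Lemma sq_ZZ (f f1 : idx -> R -> R) i : (forall j, sq (f j)) -> (forall j, sq (f1 j)) ->
  sq (ZZ f f1 i).
Proof.
move=> sf sf1; apply: sqD.
- exact: (proj1 (sqM rwt_meas rwt_bound (sf1 _))).
- exact: (proj1 (sqM zwt_meas zwt_bound (sf _))).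
Qed.

Lemma N2_VV_le (f f1 : idx -> R -> R) i (M : R) : (forall j, sq (f j)) -> (forall j, sq (f1 j)) ->
  (forall j, N2 (f j) <= M) -> (forall j, N2 (f1 j) <= M) ->
  N2 (VV f f1 i) <= (4 + 4 * cc k i ^+ 2 + 2 * m ^+ 2) * M.
Proof.
move=> sf sf1 nf nf1.
have [s1 n1] := sqM rwt_meas rwt_bound (sf1 (swp i)).
have [s2 n2] := sqM (cwt_meas (cc k i)) (@cwt_bound _) (sf (swp i)).
have [s3 n3] := sqM (crwt_meas (m * sgn i)) (@crwt_bound _) (sf (tau i)).
have [s12 n12] := sqD_le s1 s2; have [_ n123] := sqD_le s12 s3.
apply: le_trans n123 _.
rewrite expr1n mul1r in n1.
have n2' : N2 (fun r => (cc k i * wt r) * f (swp i) r) <= cc k i ^+ 2 * M.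
  apply: le_trans n2 _; rewrite -[X in X * _]ger0_norm ?sqr_ge0// normrX normr_id -normrX.
  by rewrite (ger0_norm (sqr_ge0 _)) ler_wpM2l ?sqr_ge0.
have n3' : N2 (fun r => (m * sgn i * (r * wt r)) * f (tau i) r) <= m ^+ 2 * M.
  apply: le_trans n3 _; rewrite normrM sgn_norm mulr1 -normrX (ger0_norm (sqr_ge0 m)).
  by rewrite ler_wpM2l ?sqr_ge0.
have := nf1 (swp i); move: n1 n2' n3' n12; lra.
Qed.

Lemma N2_ZZ_le (f f1 : idx -> R -> R) i (M : R) : (forall j, sq (f j)) -> (forall j, sq (f1 j)) ->
  (forall j, N2 (f j) <= M) -> (forall j, N2 (f1 j) <= M) -> N2 (ZZ f f1 i) <= 10 * M.
Proof.
move=> sf sf1 nf nf1.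
have [s1 n1] := sqM rwt_meas rwt_bound (sf1 i).
have [s2 n2] := sqM zwt_meas zwt_bound (sf i).
have [_ n12] := sqD_le s1 s2; apply: le_trans n12 _.
rewrite expr1n mul1r in n1; have := nf i; have := nf1 i; move: n1 n2; lra.
Qed.

(** Bounds the integral of [err], the density of the regularization errors divided by [h^(1/2)]. The
    number 32 is 4 times 8, the bound for the sum of the four norms [N2 (f1 j) <= 2]. *)
Definition rate_cst : R := 24 * (kap k + `|m|) * (2 * kap k + 4) *
  (\int[mu]_(r in H) (wt r ^+ 2) + 32 + 4 * \int[mu]_(r in H) (wt r / Num.sqrt r))
  + \int[mu]_(r in H) (wt r / Num.sqrt r).

(** The state at one instant: unknowns, their r-derivatives, their time derivatives and the
    nonlinearity. The Lipschitz constant [N r] of the nonlinearity along the solution is valid on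
    all of [[r, +oo[], hence on the window of the mean at [r]. *)
Variables (h : R) (u g d w : idx -> R -> R) (N : R -> R).
Hypotheses (h0 : 0 < h) (pu : forall i, prim (u i) (g i)).
Hypotheses (su : forall i, sq (u i)) (sg : forall i, sq (g i)) (sd : forall i, sq (d i)).
Hypotheses (ng1 : forall i, N2 (g i) <= 1).
Hypothesis (ub : forall i (r : R), 0 < r -> `|u i r| <= 1).
Hypothesis (cw : forall i (r : R), 0 < r -> {for r, continuous (w i)}).
Hypothesis (N0 : forall r : R, 0 < r -> 0 <= N r).
Hypothesis (Nw : forall r : R, 0 < r -> (kap k + `|m| * r) * N r <= wt r ^+ 2 / 1536).
Hypothesis (wlip : forall i (r x y : R), 0 < r -> r <= x -> r <= y ->
  `|w i x - w i y| <= N r * \sum_j `|u j x - u j y|).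
Hypothesis (wb : forall i (r x : R), 0 < r -> r <= x -> `|w i x| <= N r * \sum_j `|u j x|).
Hypothesis (eqn : forall i, {ae mu, forall r : R, 0 < r ->
  d i r = LL k m u g i r + w i r}).

Let f i := stk h (u i).
Let f1 i := dlt h (u i).
Let f2 i := dlt h (g i).
Let fd i := stk h (d i).
Let fd1 i := dlt h (d i).
Local Notation s := (Num.sqrt h).
Let cu i (r : R) : 0 < r -> {for r, continuous (u i)}. Proof. exact: prim_cont (pu i) r. Qed.
Let lu i : locigr (u i). Proof. exact: cont_locigr (@cu i). Qed.

Let pf i : prim (f i) (f1 i). Proof. exact: prim_stk (ltW h0) (@cu i). Qed.
Let pf1 i : prim (f1 i) (f2 i). Proof. exact: prim_dlt (ltW h0) (pu i). Qed.
Let sf i : sq (f i). Proof. by have [] := sq_stk h0 (su i). Qed.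
Let sf1 i : sq (f1 i). Proof. by have [] := sq_dlt h0 (su i). Qed.
Let sf2 i : sq (f2 i). Proof. by have [] := sq_dlt h0 (sg i). Qed.
Let sfd i : sq (fd i). Proof. by have [] := sq_stk h0 (sd i). Qed.
Let sfd1 i : sq (fd1 i). Proof. by have [] := sq_dlt h0 (sd i). Qed.

Let nf1 i : N2 (f1 i) <= 2.
Proof.
have [_ n] := sq_stk h0 (sg i).
have -> : N2 (f1 i) = N2 (stk h (g i)).
  by apply: N2_ext => r r0; rewrite (stkE (ltW h0) (pu i)).
by have := ng1 i; lra.
Qed.

Let fb i r : 0 < r -> `|f i r| <= 1.
Proof.
move=> r0; rewrite -[f i r]subr0; apply: stk_bound => // x /andP[rx _]; by rewrite subr0 ub//; exact: lt_le_trans rx.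
Qed.

Let hoel i r x y : 0 < r -> r <= x <= r + h -> r <= y <= r + h ->
  `|u i x - u i y| <= s / Num.sqrt r.
Proof.
move=> r0 xr yr; have := prim_hoelder (pu i) (sg i) (ng1 i) h0 r0 xr yr.
by rewrite sqrtrM ?(ltW h0)// sqrtrV ?(ltW r0).
Qed.

Let fu i r x : 0 < r -> r <= x <= r + h -> `|f i r - u i x| <= s / Num.sqrt r.
Proof. by move=> r0 xr; apply: stk_bound => // y yr; exact: hoel. Qed.

(** Size of the regularization errors: the part in [kap k] comes from the commutators with [1/r],
    and 4 from the nonlinearity, one unit for each unknown. *)
Let e r : R := (2 * kap k + 4) * s / Num.sqrt r ^+ 3.

(** Gives the error due to [1/r] the same form as the oscillation of [u] in [hoel]. With
    [a = sqrt h] and [b = sqrt r] the inequality is [a^2 / (a^2 + b^2) <= a / b]. *)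
Let h_le r : 0 < r -> h / (r + h) <= s / Num.sqrt r.
Proof.
have key (a b : R) : 0 < a -> 0 < b -> a ^+ 2 / (b ^+ 2 + a ^+ 2) <= a / b.
  move=> a0 b0; rewrite ler_pdivrMr; last by rewrite addr_gt0 ?exprn_gt0.
  rewrite -subr_ge0.
  have -> : a / b * (b ^+ 2 + a ^+ 2) - a ^+ 2 =
     a / b * ((b - a / 2) ^+ 2 + 3 / 4 * a ^+ 2) by field; rewrite gt_eqF.
  have := ltW b0; have := ltW a0 => ? ?; pos.
move=> r0; have q0 : 0 < Num.sqrt r by rewrite sqrtr_gt0.
have s0 : 0 < s by rewrite sqrtr_gt0.
have r0' := ltW r0; have h0' := ltW h0.
by have := key _ _ s0 q0; rewrite !sqr_sqrtr.
Qed.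

(** The defect of the linear equation for the Steklov means; [F1] is the corresponding defect for
    their r-derivatives. *)
Let F i r := fd i r - LL k m f f1 i r.
Let F1 i r := fd1 i r - LL1 k m f f1 f2 i r.
Let A r : R := \sum_j `|f1 j r|.
Let B r : R := \sum_j `|f j r|.

Let A0 r : 0 <= A r. Proof. exact: sumr_ge0. Qed.
Let B0 r : 0 <= B r. Proof. exact: sumr_ge0. Qed.

Let q3 r : 0 < r -> Num.sqrt r ^+ 3 = r * Num.sqrt r.
Proof. by move=> r0; rewrite exprSr sqr_sqrtr// ltW. Qed.

Let stk_w i r : 0 < r -> `|stk h (w i) r| <= N r * B r + 4 * s / Num.sqrt r ^+ 3.
Proof.
move=> r0; have q0 : 0 < Num.sqrt r by rewrite sqrtr_gt0.
have s0 : 0 <= s by rewrite sqrtr_ge0.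
have h1 : `|stk h (w i) r| <= N r * (B r + 4 * (s / Num.sqrt r)).
  rewrite -[stk _ _ _]subr0; apply: stk_bound => //; first exact: cont_locigr (@cw i).
  move=> x xr; rewrite subr0; have /andP[rx _] := xr.
  apply: le_trans (wb i r0 rx) _; rewrite ler_wpM2l ?N0//.
  have : \sum_j `|u j x| <= \sum_j (`|f j r| + s / Num.sqrt r).
    apply: ler_sum => j _; have := fu j r0 xr; rewrite distrC => hf.
    by rewrite -[u j x](subrK (f j r)) addrC; apply: le_trans (ler_normD _ _) _; rewrite lerD2l.
  rewrite big_split /= -/(B r).
  by have -> : \sum_(j : idx) (s / Num.sqrt r) = 4 * (s / Num.sqrt r) by rewrite sum_idx; ring.
apply: le_trans h1 _; rewrite mulrDr lerD2l.
(* The decay of [N] trades the error [r^(-1/2)] for the common form [r^(-3/2)]. *)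
have Nr : N r * r <= 1.
  have := Nw r0; have w0 := wt_gt0 r0; have w1 := wt_le1 r0.
  have c1 := kap_ge1 k; have m0 := normr_ge0 m => hN.
  have r0' := ltW r0; have mr : 0 <= `|m| * r * N r by rewrite !mulr_ge0 ?N0.
  have kN : 0 <= (kap k - 1) * N r by rewrite mulr_ge0 ?N0 ?subr_ge0.
  have hN1 : N r <= wt r ^+ 2 by move: hN mr kN (sqr_ge0 (wt r)); lra.
  apply: le_trans (ler_wpM2r (ltW r0) hN1) _.
  have -> : wt r ^+ 2 * r = (r * wt r) * wt r by ring.
  have rw1 := rwt_le1 r0; have rw0 : 0 <= r * wt r by rewrite mulr_ge0// ltW.
  by rewrite mulr_ile1// ltW.
rewrite q3//.
have -> : N r * (4 * (s / Num.sqrt r)) = (N r * r) * (4 * s / (r * Num.sqrt r)).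
  by field; rewrite !gt_eqF.
by rewrite ler_piMl//; have := ltW q0; have := ltW r0 => ? ?; pos.
Qed.

Let dlt_w i r : 0 < r -> `|dlt h (w i) r| <= N r * A r.
Proof.
move=> r0; rewrite /dlt normrM gtr0_norm ?invr_gt0//.
have rh : r <= r + h by rewrite lerDl ltW.
have := wlip i r0 rh (lexx r) => hw.
rewrite mulrC ler_pdivrMr//; apply: le_trans hw _.
rewrite -mulrA ler_wpM2l ?N0// /A mulr_suml; apply: ler_sum => j _.
rewrite /f1 /dlt normrM gtr0_norm ?invr_gt0// mulrC mulrA divff ?mul1r//.
by rewrite gt_eqF.
Qed.

(** On the window, [1/r - 1/x = (x - r) / (x r)] is at most [h / ((r + h) r)], and [u] is bounded by
    1. *)
Let comm0 j r : 0 < r -> `|stk h (fun x => u j x / x) r - f j r / r| <= s / Num.sqrt r ^+ 3.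
Proof.
move=> r0; have q0 : 0 < Num.sqrt r by rewrite sqrtr_gt0.
have ci : forall x : R, 0 < x -> {for x, continuous (fun x : R => x^-1)}.
  exact: prim_cont (@prim_inv R).
have l1 : locigr (fun x => u j x / x) by exact: locigrM ci (lu j).
have -> : stk h (fun x => u j x / x) r - f j r / r = stk h (fun x => (- r^-1) * u j x + u j x / x) r.
  by rewrite (stk_lin _ (- r^-1) (lu j) l1 r0) /f; ring.
have lS : locigr (fun x => (- r^-1) * u j x + u j x / x).
  by move=> a b a0; apply: igrD; [exact: mitv|apply: igrZ; [exact: mitv|exact: lu]|exact: l1].
rewrite -[stk _ _ _]subr0; apply: stk_bound => // x /andP[rx xr].
have x0 : 0 < x by exact: lt_le_trans rx.
rewrite subr0.
have -> : - r^-1 * u j x + u j x / x = u j x * (- ((x - r) / x / r)).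
  by field; rewrite !gt_eqF.
rewrite normrM normrN; apply: le_trans (_ : 1 * `|(x - r) / x / r| <= _).
  by rewrite ler_wpM2r ?ub.
rewrite mul1r ger0_norm; last by rewrite !divr_ge0 ?subr_ge0 ?(ltW r0) ?(ltW x0).
have E : (x - r) / x <= h / (r + h).
  rewrite ler_pdivrMr// mulrAC ler_pdivlMr; last by rewrite addr_gt0.
  rewrite -subr_ge0; have -> : h * x - (x - r) * (r + h) = r * (r + h - x) by ring.
  by rewrite mulr_ge0 ?subr_ge0// ltW.
apply: le_trans (ler_wpM2r _ (le_trans E (h_le r0))) _; first by rewrite invr_ge0 ltW.
rewrite q3// le_eqVlt; apply/orP; left; apply/eqP; field.
by rewrite !gt_eqF.
Qed.

(** The difference quotient of [u / x] and the derivative of [f / r] differ exactly by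
    [(f - u (r + h)) + u (r + h) h / (r + h)], divided by [r^2]; each of the two terms is at most
    [(h / r)^(1/2)]. *)
Let comm1 j r : 0 < r ->
  r * `|dlt h (fun x => u j x / x) r - (f1 j r / r - f j r / r ^+ 2)| <= 2 * s / Num.sqrt r ^+ 3.
Proof.
move=> r0; have q0 : 0 < Num.sqrt r by rewrite sqrtr_gt0.
have rh : 0 < r + h by rewrite addr_gt0.
have -> : dlt h (fun x => u j x / x) r - (f1 j r / r - f j r / r ^+ 2) =
  ((f j r - u j (r + h)) + u j (r + h) * (h / (r + h))) / r ^+ 2.
  by rewrite /dlt /f1 /dlt; field; rewrite !gt_eqF.
rewrite normrM normfV [`|r ^+ 2|]ger0_norm ?sqr_ge0//.
have B1 : `|f j r - u j (r + h) + u j (r + h) * (h / (r + h))| <= 2 * (s / Num.sqrt r).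
  apply: le_trans (ler_normD _ _) _.
  have b1 : `|f j r - u j (r + h)| <= s / Num.sqrt r.
    by apply: fu => //; rewrite lexx andbT lerDl ltW.
  have b2 : `|u j (r + h) * (h / (r + h))| <= s / Num.sqrt r.
    rewrite normrM; apply: le_trans (h_le r0).
    have hr0 : 0 <= h / (r + h) by rewrite divr_ge0// ltW.
    by rewrite [`|h / _|]ger0_norm// ler_piMl ?ub.
  lra.
have := ler_wpM2r (_ : 0 <= r^-1) B1; rewrite invr_ge0 (ltW r0) => /(_ isT) B2.
have -> : r * (`|f j r - u j (r + h) + u j (r + h) * (h / (r + h))| / r ^+ 2)
   = `|f j r - u j (r + h) + u j (r + h) * (h / (r + h))| / r by field; rewrite gt_eqF.
apply: le_trans B2 _; rewrite q3// le_eqVlt; apply/orP; left; apply/eqP; field.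
by rewrite !gt_eqF.
Qed.

Let ls i : locigr (fun x => u i x / x).
Proof. exact: locigrM (prim_cont (@prim_inv R)) (@lu i). Qed.

Let F_bound i r : 0 < r -> `|F i r| <= N r * B r + e r.
Proof.
move=> r0.
have mLw : measurable_fun H (fun x => LL k m u g i x + w i x).
  apply: measurable_funD; last exact: cont_meas (@cw i).
  apply: measurable_funD; last by apply: measurable_funM => //; case: (su (tau i)).
  apply: measurable_funD; first by case: (sg (swp i)).
  apply: measurable_funM => //; apply: measurable_funM; first by case: (su (swp i)).
  exact: prim_meas (@prim_inv R).
have FE : F i r = cc k i * (stk h (fun x => u (swp i) x / x) r - f (swp i) r / r) + stk h (w i) r.
  have [md _] := sd i.
  rewrite /F /fd (stk_ae h md mLw r0 (eqn i)).
  have E : (fun x => LL k m u g i x + w i x) = (fun x => 1 * g (swp i) x +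
     (cc k i * (u (swp i) x / x) + ((m * sgn i) * u (tau i) x + w i x))).
    by apply/funext => x; rewrite /LL; ring.
  have lg := sq_locigr (sg (swp i)).
  have lw := cont_locigr (@cw i).
  have l1 : locigr (fun x => (m * sgn i) * u (tau i) x + w i x).
    by move=> a b a0; apply: igrD; [exact: mitv|apply: igrZ; [exact: mitv|exact: lu]|exact: lw].
  have l2 : locigr (fun x => cc k i * (u (swp i) x / x) + ((m * sgn i) * u (tau i) x + w i x)).
    by move=> a b a0; apply: igrD; [exact: mitv|apply: igrZ; [exact: mitv|exact: ls]|exact: l1].
  rewrite E (stk_lin h 1 lg l2 r0) (stk_lin h (cc k i) (ls (swp i)) l1 r0).
  rewrite (stk_lin h (m * sgn i) (lu (tau i)) lw r0) (stkE (ltW h0) (pu (swp i)) r0).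
  by rewrite /LL /f /f1; ring.
rewrite FE; apply: le_trans (ler_normD _ _) _; rewrite normrM.
have c1 := comm0 (swp i) r0; have c2 := stk_w i r0; have c3 := cc_le k i.
have p0 : 0 <= s / Num.sqrt r ^+ 3 by rewrite divr_ge0 ?exprn_ge0 ?sqrtr_ge0.
have h1 : `|cc k i| * `|stk h (fun x => u (swp i) x / x) r - f (swp i) r / r| <=
   kap k * (s / Num.sqrt r ^+ 3) by apply: ler_pM.
have k0 : 0 <= kap k * (s / Num.sqrt r ^+ 3).
  by rewrite mulr_ge0//; have := kap_ge1 k; lra.
by rewrite /e; move: h1 c2 k0; lra.
Qed.

Let F1_bound i : {ae mu, forall r : R, 0 < r -> r * `|F1 i r| <= N r * (r * A r) + e r}.
Proof.
apply: aeS (dlt_ae (ltW h0) (eqn i)) => r hE r0.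
have FE : F1 i r = cc k i * (dlt h (fun x => u (swp i) x / x) r
    - (f1 (swp i) r / r - f (swp i) r / r ^+ 2)) + dlt h (w i) r.
  rewrite /F1 /fd1 hE//.
  by rewrite /LL1 /LL /f1 /f2 /dlt; ring.
rewrite FE; apply: le_trans (ler_wpM2l (ltW r0) (ler_normD _ _)) _; rewrite normrM mulrDr.
have c1 := comm1 (swp i) r0; have c2 := dlt_w i r0; have c3 := cc_le k i.
have p0 : 0 <= s / Num.sqrt r ^+ 3 by rewrite divr_ge0 ?exprn_ge0 ?sqrtr_ge0.
set C := dlt h _ r - _ in c1 *.
have h1 : `|cc k i| * (r * `|C|) <= kap k * (2 * s / Num.sqrt r ^+ 3).
  by apply: ler_pM => //; apply: mulr_ge0 => //; exact: ltW.
have h2 : r * `|dlt h (w i) r| <= r * (N r * A r) by rewrite ler_wpM2l// ltW.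
by rewrite /e; move: h1 h2 p0; rewrite mulrCA; lra.
Qed.

Let jj i r := (r * f2 i r + f1 i r - cc k (swp i) ^+ 2 * (f i r / r) - m ^+ 2 * (r * f i r))
  * (psi r * f1 i r + chi r * f i r).

Let coer i r := 2 * (r ^+ 2 * wt r ^+ 3) * f1 i r ^+ 2
  + (cc k (swp i) ^+ 2 * wt r ^+ 2 - (3 - 17 * r + 5 * r ^+ 2 + r ^+ 3) * wt r ^+ 5 / 4) * f i r ^+ 2.

Let tt i r := r * (LL k m f f1 i r * (psi r * LL1 k m f f1 f2 i r + chi r * LL k m f f1 i r)).

Let TT i r := r * (VV fd fd1 i r * ZZ f f1 i r) + r * (VV f f1 i r * ZZ fd fd1 i r).

Let src i r := r * LL k m F F1 i r * XX f f1 i r + r * LL k m f f1 i r * XX F F1 i r.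

(** The time derivative of the means is written [L f + F]. Then [L L f] against [X f] gives [jj],
    [L f] against [X L f] gives [tt], and everything that contains [F] is collected in [src]. *)
Let TT_split i r : 0 < r -> TT i r = jj i r + tt i r + src i r.
Proof.
move=> r0; rewrite /TT !VV_ZZ//.
have h1 := LL_LL k m f f1 f2 i r0.
have h2 : LL k m fd fd1 i r = LL k m F F1 i r + LL k m (LL k m f f1) (LL1 k m f f1 f2) i r.
  by rewrite /LL /F /F1 /LL /LL1; ring.
have h3 : XX fd fd1 i r = XX F F1 i r + XX (LL k m f f1) (LL1 k m f f1 f2) i r.
  by rewrite /XX /F /F1; ring.
by rewrite h2 h3 /jj -h1 /tt /src /XX; ring.
Qed.

Let igrTT i : igr H (TT i) /\
  \int[mu]_(r in H) TT i r = ip (VV fd fd1 i) (ZZ f f1 i) + ip (VV f f1 i) (ZZ fd fd1 i).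
Proof.
have I1 := sq_prod (sq_VV i sfd sfd1) (sq_ZZ i sf sf1).
have I2 := sq_prod (sq_VV i sf sf1) (sq_ZZ i sfd sfd1).
by split; [exact: (igrD (mH (R := R)) I1 I2)|exact: (RintD (mH (R := R)) I1 I2)].
Qed.

(** Antisymmetry of the multiplier applied to [L f]. The work lies in the domination: the square of
    [L f] is expanded and each term is reduced by [wt_cubes]. *)
Let igr_tt i : igr H (tt i) /\ \int[mu]_(r in H) tt i r = 0.
Proof.
have Id j : igr H (fun r => r * (f2 j r ^+ 2 + f1 j r ^+ 2 + f j r ^+ 2) + wt r ^+ 2 * f j r ^+ 2).
  exact: igr_dom (sf j) (sf1 j) (sf2 j) (@fb j).
have IG := igrZ (20 * (1 + kap k ^+ 2 + m ^+ 2)) (mH (R := R))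
  (igrD (mH (R := R)) (Id (swp i)) (Id (tau i))).
apply: (int_dilation_eq0 (prim_LL k m i pf pf1) IG) => r r0.
have [c1 c2 c3 c4 c5] := wt_cubes r0; have w0 := wt_gt0 r0; have w0' := ltW w0; have r0' := ltW r0.
set K := kap k; have K0 : 0 <= K by have := kap_ge1 k; rewrite /K; lra.
have cK : cc k i ^+ 2 <= K ^+ 2.
  by rewrite -[leLHS]real_normK ?num_real// ler_pXn2r ?nnegrE ?cc_le.
have sg1 : sgn i ^+ 2 = 1 :> R by rewrite -[LHS]real_normK ?num_real// sgn_norm expr1n.
have e1 : r ^+ 2 * wt r * LL k m f f1 i r ^+ 2 <= 3 * (r * f1 (swp i) r ^+ 2
    + K ^+ 2 * (wt r ^+ 2 * f (swp i) r ^+ 2 + r * f (swp i) r ^+ 2) + m ^+ 2 * (r * f (tau i) r ^+ 2)).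
  have hL := sqrD3_le (f1 (swp i) r) (cc k i * (f (swp i) r / r)) (m * sgn i * f (tau i) r).
  have p0 : 0 <= r ^+ 2 * wt r by pos.
  apply: le_trans (ler_wpM2l p0 hL) _.
  have -> : r ^+ 2 * wt r * (3 * (f1 (swp i) r ^+ 2 + (cc k i * (f (swp i) r / r)) ^+ 2
     + (m * sgn i * f (tau i) r) ^+ 2)) = 3 * (r ^+ 2 * wt r * f1 (swp i) r ^+ 2
     + cc k i ^+ 2 * (wt r * f (swp i) r ^+ 2) + m ^+ 2 * sgn i ^+ 2 * (r ^+ 2 * wt r * f (tau i) r ^+ 2)).
    by field; rewrite gt_eqF.
  rewrite sg1 mulr1 ler_pM2l//; apply: lerD; first apply: lerD.
  - by rewrite ler_wpM2r ?sqr_ge0.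
  - by apply: ler_pM => //; rewrite -?mulrDl ?ler_wpM2r ?sqr_ge0// mulr_ge0 ?sqr_ge0.
  - by rewrite ler_wpM2l ?sqr_ge0// ler_wpM2r ?sqr_ge0.
have e2 : r ^+ 4 * wt r ^+ 3 * LL1 k m f f1 f2 i r ^+ 2 <= 4 * (r * f2 (swp i) r ^+ 2
    + K ^+ 2 * (r * f1 (swp i) r ^+ 2 + wt r ^+ 2 * f (swp i) r ^+ 2) + m ^+ 2 * (r * f1 (tau i) r ^+ 2)).
  have hL := sqrD4_le (f2 (swp i) r) (cc k i * (f1 (swp i) r / r)) (- (cc k i * (f (swp i) r / r ^+ 2)))
     (m * sgn i * f1 (tau i) r).
  have p0 : 0 <= r ^+ 4 * wt r ^+ 3 by pos.
  have E : LL1 k m f f1 f2 i r = f2 (swp i) r + cc k i * (f1 (swp i) r / r) + - (cc k i * (f (swp i) r / r ^+ 2))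
     + m * sgn i * f1 (tau i) r by rewrite /LL1; ring.
  rewrite E; apply: le_trans (ler_wpM2l p0 hL) _.
  have -> : r ^+ 4 * wt r ^+ 3 * (4 * (f2 (swp i) r ^+ 2 + (cc k i * (f1 (swp i) r / r)) ^+ 2
     + (- (cc k i * (f (swp i) r / r ^+ 2))) ^+ 2 + (m * sgn i * f1 (tau i) r) ^+ 2))
     = 4 * (r ^+ 4 * wt r ^+ 3 * f2 (swp i) r ^+ 2
     + cc k i ^+ 2 * (r ^+ 2 * wt r ^+ 3 * f1 (swp i) r ^+ 2 + wt r ^+ 3 * f (swp i) r ^+ 2)
     + m ^+ 2 * sgn i ^+ 2 * (r ^+ 4 * wt r ^+ 3 * f1 (tau i) r ^+ 2)).
    by field; rewrite gt_eqF.
  rewrite sg1 mulr1 ler_pM2l//; apply: lerD; first apply: lerD.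
  - by rewrite ler_wpM2r ?sqr_ge0.
  - apply: ler_pM => //; [pos|pos|].
    by apply: lerD; rewrite ler_wpM2r ?sqr_ge0.
  - by rewrite ler_wpM2l ?sqr_ge0// ler_wpM2r ?sqr_ge0.
apply: le_trans (lerD e1 e2) _.
have q1 : 0 <= r * f2 (swp i) r ^+ 2 by pos.
have q2 : 0 <= r * f1 (swp i) r ^+ 2 by pos.
have q3' : 0 <= r * f (swp i) r ^+ 2 by pos.
have q4 : 0 <= wt r ^+ 2 * f (swp i) r ^+ 2 by pos.
have q5 : 0 <= r * f2 (tau i) r ^+ 2 by pos.
have q6 : 0 <= r * f1 (tau i) r ^+ 2 by pos.
have q7 : 0 <= r * f (tau i) r ^+ 2 by pos.
have q8 : 0 <= wt r ^+ 2 * f (tau i) r ^+ 2 by pos.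
have K2 := sqr_ge0 K; have m2 := sqr_ge0 m.
rewrite !(mulrDr r).
move: (r * f2 (swp i) r ^+ 2) (r * f1 (swp i) r ^+ 2) (r * f (swp i) r ^+ 2) (wt r ^+ 2 * f (swp i) r ^+ 2)
  (r * f2 (tau i) r ^+ 2) (r * f1 (tau i) r ^+ 2) (r * f (tau i) r ^+ 2) (wt r ^+ 2 * f (tau i) r ^+ 2)
  (K ^+ 2) (m ^+ 2) q1 q2 q3' q4 q5 q6 q7 q8 K2 m2 => x1 x2 x3 x4 y1 y2 y3 y4 X Y.
move=> x10 x20 x30 x40 y10 y20 y30 y40 X0 Y0.
have := (mulr_ge0 X0 x10, mulr_ge0 X0 x20, mulr_ge0 X0 x30, mulr_ge0 X0 x40).
have := (mulr_ge0 X0 y10, mulr_ge0 X0 y20, mulr_ge0 X0 y30, mulr_ge0 X0 y40).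
have := (mulr_ge0 Y0 x10, mulr_ge0 Y0 x20, mulr_ge0 Y0 x30, mulr_ge0 Y0 x40).
have := (mulr_ge0 Y0 y10, mulr_ge0 Y0 y20, mulr_ge0 Y0 y30, mulr_ge0 Y0 y40).
move=> [[[? ?] ?] ?] [[[? ?] ?] ?] [[[? ?] ?] ?] [[[? ?] ?] ?].
lra.
Qed.

Let igr_jj i : [/\ igr H (jj i), igr H (coer i) & \int[mu]_(r in H) jj i r = - \int[mu]_(r in H) coer i r].
Proof. exact: virial_identity (sqr_ge0 _) (pf i) (pf1 i) (sf i) (sf1 i) (sf2 i) (@fb i). Qed.

Let coer_ge i r : 0 < r -> 2 * (r ^+ 2 * wt r ^+ 3 * f1 i r ^+ 2) + wt r ^+ 2 * f i r ^+ 2 / 4 <= coer i r.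
Proof.
move=> r0; have := coercive_coeff r0 (cc_sqr_ge1 (swp i)) => hc.
have := ler_wpM2r (sqr_ge0 (f i r)) hc; rewrite /coer mulrA; lra.
Qed.

Let src_le i r : 0 < r -> (forall j, r * `|F1 j r| <= N r * (r * A r) + e r) ->
  src i r <= (r ^+ 2 * wt r ^+ 3 * A r ^+ 2 + wt r ^+ 2 * B r ^+ 2) / 256
    + 6 * (kap k + `|m|) * (r * wt r) * e r * (r * A r + B r).
Proof.
move=> r0 hF1; have r0' := ltW r0.
have e0 : 0 <= e r.
  have := sqrtr_ge0 h; have := sqrtr_ge0 r; have := kap_ge1 k => ? ? ?.
  have k0 : 0 <= kap k by lra.
  by rewrite /e; pos.
pose Fb := N r * B r + e r; pose F1b := (N r * (r * A r) + e r) / r.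
have Fb0 : 0 <= Fb by rewrite addr_ge0// mulr_ge0 ?N0.
have F1b0 : 0 <= F1b by rewrite divr_ge0// addr_ge0// mulr_ge0 ?N0 ?mulr_ge0.
have E1 : r * F1b <= N r * (r * A r) + e r by rewrite /F1b mulrC divfK// gt_eqF.
apply: le_trans (source_bound r0 (A0 r) (B0 r) (N0 r0) e0 Fb0 F1b0 (lexx _) E1 (Nw r0)).
have hF j : `|F j r| <= Fb by exact: F_bound.
have hF1' j : `|F1 j r| <= F1b by rewrite ler_pdivlMr// mulrC.
have hA j : `|f1 j r| <= A r by apply: (le_sum1 (F := fun j => `|f1 j r|)).
have hB j : `|f j r| <= B r by apply: (le_sum1 (F := fun j => `|f j r|)).
have /andP[chi0 _] := chi_bound r0.
have L_le (v v1 : idx -> R -> R) (b b1 : R) : (forall j, `|v j r| <= b) -> (forall j, `|v1 j r| <= b1) ->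
    `|LL k m v v1 i r| <= b1 + kap k * (b / r) + `|m| * b.
  move=> hv hv1; rewrite /LL; apply: le_trans (ler_normD _ _) _; apply: lerD.
    apply: le_trans (ler_normD _ _) _; apply: lerD => //.
    rewrite normrM; apply: ler_pM => //; first exact: cc_le.
    by rewrite normrM normfV (gtr0_norm r0) ler_wpM2r ?invr_ge0.
  by rewrite !normrM sgn_norm mulr1 ler_wpM2l.
have X_le (v v1 : idx -> R -> R) (b b1 : R) : (forall j, `|v j r| <= b) -> (forall j, `|v1 j r| <= b1) ->
    `|XX v v1 i r| <= psi r * b1 + chi r * b.
  move=> hv hv1; rewrite /XX; apply: le_trans (ler_normD _ _) _; apply: lerD.
    by rewrite normrM ger0_norm ?sqr_ge0// ler_wpM2l ?sqr_ge0.
  by rewrite normrM ger0_norm// ler_wpM2l.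
apply: lerD; apply: le_trans (ler_norm _) _; rewrite !normrM (gtr0_norm r0).
- by apply: ler_pM; rewrite ?mulr_ge0//; [rewrite ler_wpM2l// L_le|exact: X_le].
- by apply: ler_pM; rewrite ?mulr_ge0//; [rewrite ler_wpM2l// L_le|exact: X_le].
Qed.

Let C0 : R := 24 * (kap k + `|m|) * (2 * kap k + 4).

Let err r := C0 * (wt r ^+ 2 + 4 * \sum_j r * f1 j r ^+ 2 + 4 * (wt r / Num.sqrt r)) + wt r / Num.sqrt r.

Let igr_err : igr H err /\ \int[mu]_(r in H) err r <= rate_cst.
Proof.
have Is := igr_sum (index_enum idx) (mH (R := R)) (fun j => (sf1 j).2).
have I2 := igrD (mH (R := R)) (igr_wt2 (R := R)) (igrZ 4 (mH (R := R)) Is).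
have I4 := igrZ 4 (mH (R := R)) (igr_sqrt_wt (R := R)).
have I5 := igrZ C0 (mH (R := R)) (igrD (mH (R := R)) I2 I4).
split; first exact: igrD (mH (R := R)) I5 (igr_sqrt_wt (R := R)).
rewrite /err (RintD (mH (R := R)) I5 (igr_sqrt_wt (R := R))) /rate_cst lerD2r.
rewrite (RintZ _ (mH (R := R)) (igrD (mH (R := R)) I2 I4)) (RintD (mH (R := R)) I2 I4).
rewrite (RintZ _ (mH (R := R)) (igr_sqrt_wt (R := R))) (RintD (mH (R := R)) (igr_wt2 (R := R)) (igrZ 4 (mH (R := R)) Is)).
rewrite (RintZ _ (mH (R := R)) Is) (Rint_sum (index_enum idx) (mH (R := R)) (fun j => (sf1 j).2)).
have C0ge : 0 <= C0.
  have := kap_ge1 k; have := normr_ge0 m => h1 h2.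
  have k0 : 0 <= kap k by lra.
  by rewrite /C0; pos.
apply: ler_wpM2l => //; rewrite lerD2r lerD2l.
have h8 : \sum_j N2 (f1 j) <= \sum_(j : idx) 2 by apply: ler_sum => j _; exact: nf1.
have : \sum_(j : idx) 2 = 8 :> R by rewrite sum_idx; ring.
by move: h8; rewrite /N2; lra.
Qed.

(** Balance of the constants: the four equations and [A^2 <= 4 SA], [B^2 <= 4 SB] make the nonlinear
    part cost 16/256 of each square. Of the coefficient 1/4 of [wt^2 SB] at least 1/8 is left, and
    passing from the means back to [u] costs the last term of [err]. *)
Let rate_pt : {ae mu, forall r : R, 0 < r ->
  \sum_i (src i r - coer i r) <= s * err r - 8^-1 * \sum_i wt r ^+ 2 * u i r ^+ 2}.
Proof.
apply: aeS (ae_idx (@F1_bound)) => r hF1 r0; have r0' := ltW r0.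
have w0 := wt_gt0 r0; have w0' := ltW w0; have w1 := wt_le1 r0.
have q0 : 0 < Num.sqrt r by rewrite sqrtr_gt0.
have s0 : 0 <= s by rewrite sqrtr_ge0.
set Y := (r ^+ 2 * wt r ^+ 3 * A r ^+ 2 + wt r ^+ 2 * B r ^+ 2) / 256
    + 6 * (kap k + `|m|) * (r * wt r) * e r * (r * A r + B r).
set SA := \sum_i f1 i r ^+ 2; set SB := \sum_i f i r ^+ 2.
have h1 : \sum_i (src i r - coer i r) <= 4 * Y - (2 * (r ^+ 2 * wt r ^+ 3 * SA) + wt r ^+ 2 * SB / 4).
  have hb i : src i r - coer i r <= Y - (2 * (r ^+ 2 * wt r ^+ 3 * f1 i r ^+ 2) + wt r ^+ 2 * f i r ^+ 2 / 4).
    by apply: lerB; [apply: src_le => // j; exact: hF1|exact: coer_ge].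
  apply: le_trans (ler_sum _ (fun i _ => hb i)) _.
  by rewrite /SA /SB !sum_idx le_eqVlt; apply/orP; left; apply/eqP; field.
have A2 : A r ^+ 2 <= 4 * SA.
  apply: le_trans (sqr_sum_le _) _; rewrite ler_pM2l//.
  by rewrite /SA !sum_idx !real_normK ?num_real.
have B2 : B r ^+ 2 <= 4 * SB.
  apply: le_trans (sqr_sum_le _) _; rewrite ler_pM2l//.
  by rewrite /SB !sum_idx !real_normK ?num_real.
have B4 : B r <= 4.
  have : B r <= \sum_(j : idx) 1 by apply: ler_sum => j _; exact: fb.
  by rewrite [X in _ <= X]sum_idx; lra.
have C0ge : 0 <= 24 * (kap k + `|m|) * (2 * kap k + 4).
  have := kap_ge1 k; have := normr_ge0 m => ? ?.
  have k0 : 0 <= kap k by lra.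
  by pos.
have h2 : 24 * (kap k + `|m|) * (r * wt r) * e r * (r * A r + B r) <=
    s * (C0 * (wt r ^+ 2 + 4 * \sum_j r * f1 j r ^+ 2 + 4 * (wt r / Num.sqrt r))).
  (* The factor [r] of the multiplier reduces the singularity of [e r] to [r^(-1/2)]. Young's
     inequality then gives the terms [wt^2] and [r f1^2] of [err]. *)
  have -> : 24 * (kap k + `|m|) * (r * wt r) * e r * (r * A r + B r) =
    C0 * s * (wt r * (Num.sqrt r * A r) + wt r / Num.sqrt r * B r).
    rewrite /e q3// /C0; set q := Num.sqrt r in q0 *.
    have -> : r = q ^+ 2 by rewrite sqr_sqrtr.
    by field; rewrite gt_eqF.
  rewrite [leRHS]mulrCA -mulrA ler_wpM2l// ler_wpM2l//; apply: lerD.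
    apply: le_trans (ler_norm _) _; apply: le_trans (sq_young _ _) _; rewrite lerD2l exprMn sqr_sqrtr//.
    by rewrite -mulr_sumr [leRHS]mulrCA ler_wpM2l.
  by rewrite mulrC ler_wpM2r// divr_ge0 ?(ltW q0).
have h3 : wt r ^+ 2 * \sum_i u i r ^+ 2 - wt r ^+ 2 * SB <= 8 * (s * (wt r / Num.sqrt r)).
  have hi i : u i r ^+ 2 - f i r ^+ 2 <= 2 * (s / Num.sqrt r).
    have hf := fu i r0 (_ : r <= r <= r + h); rewrite lexx lerDl (ltW h0) in hf.
    have -> : u i r ^+ 2 - f i r ^+ 2 = (u i r + f i r) * - (f i r - u i r) by ring.
    apply: le_trans (ler_norm _) _; rewrite normrM normrN; apply: ler_pM => //; last exact: hf.
    by apply: le_trans (ler_normD _ _) _; apply: lerD; [exact: ub|exact: fb].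
  have hs : \sum_i u i r ^+ 2 - SB <= 8 * (s / Num.sqrt r).
    rewrite -sumrB; apply: le_trans (ler_sum _ (fun i _ => hi i)) _.
    by rewrite sum_idx le_eqVlt; apply/orP; left; apply/eqP; ring.
  rewrite -mulrBr; apply: le_trans (ler_wpM2l (sqr_ge0 _) hs) _.
  have -> : wt r ^+ 2 * (8 * (s / Num.sqrt r)) = wt r * (8 * (s * (wt r / Num.sqrt r))) by ring.
  by rewrite ler_piMl// ?mulr_ge0// divr_ge0// ltW.
have p1 : 0 <= r ^+ 2 * wt r ^+ 3 by pos.
have p2 := sqr_ge0 (wt r).
have p3 := ler_wpM2l p1 A2; have p4 := ler_wpM2l p2 B2.
have SA0 : 0 <= SA by apply: sumr_ge0 => i _; exact: sqr_ge0.
have SB0 : 0 <= SB by apply: sumr_ge0 => i _; exact: sqr_ge0.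
have p5 := mulr_ge0 p1 SA0; have p6 := mulr_ge0 p2 SB0.
have E : \sum_i wt r ^+ 2 * u i r ^+ 2 = wt r ^+ 2 * \sum_i u i r ^+ 2 by rewrite mulr_sumr.
rewrite /err E mulrDr.
move: h1 h2 h3 p3 p4 p5 p6; rewrite /Y; lra.
Qed.

Lemma virial_rate :
  \sum_i (ip (VV fd fd1 i) (ZZ f f1 i) + ip (VV f f1 i) (ZZ fd fd1 i)) <=
  rate_cst * s - 8^-1 * \sum_i \int[mu]_(r in H) (wt r ^+ 2 * u i r ^+ 2).
Proof.
have mHR := mH (R := R).
(* Integrability of [src] is read off [TT_split], whose other terms are integrable. *)
have Isrc i : igr H (src i).
  have [IT _] := igrTT i; have [It _] := igr_tt i; have [Ij _ _] := igr_jj i.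
  apply: igr_eq mHR _ (igrB mHR IT (igrD mHR Ij It)) => r; rewrite inE inH => r0.
  by rewrite TT_split//; ring.
have E i : ip (VV fd fd1 i) (ZZ f f1 i) + ip (VV f f1 i) (ZZ fd fd1 i) =
    \int[mu]_(r in H) (src i r - coer i r).
  have [IT <-] := igrTT i; have [It t0] := igr_tt i; have [Ij Ic jc] := igr_jj i.
  rewrite (RintB mHR (Isrc i) Ic).
  have -> : \int[mu]_(r in H) TT i r = \int[mu]_(r in H) ((jj i r + tt i r) + src i r).
    by apply: eq_Rintegral => r; rewrite inE inH => r0; rewrite TT_split.
  rewrite (RintD mHR (igrD mHR Ij It) (Isrc i)) (RintD mHR Ij It) t0 jc; ring.
rewrite (eq_bigr _ (fun i _ => E i)).
have Id i : igr H (fun r => src i r - coer i r).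
  by have [_ Ic _] := igr_jj i; exact: igrB mHR (Isrc i) Ic.
have Iu i : igr H (fun r => wt r ^+ 2 * u i r ^+ 2) by apply: igr_wt2M (@ub i); case: (su i).
have [Ie le] := igr_err.
have IuS := igr_sum (index_enum idx) mHR Iu.
rewrite -(Rint_sum (index_enum idx) mHR Id) -(Rint_sum (index_enum idx) mHR Iu).
apply: le_trans (_ : _ <= \int[mu]_(r in H) (s * err r - 8^-1 * \sum_i wt r ^+ 2 * u i r ^+ 2)) _.
  apply: (ae_le_Rint mHR (igr_sum _ mHR Id) (igrB mHR (igrZ _ mHR Ie) (igrZ _ mHR IuS))).
  by apply: aeS rate_pt => r hr; rewrite inH.
rewrite (RintB mHR (igrZ _ mHR Ie) (igrZ _ mHR IuS)) (RintZ _ mHR Ie) (RintZ _ mHR IuS).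
by rewrite lerD2r mulrC ler_wpM2r// sqrtr_ge0.
Qed.

End VirialRate.

(** * Decay in time *)

Section Decay.
Context {R : realType}.
Local Notation mu := (@lebesgue_measure R).
Local Notation H := (`]0%R, +oo[%classic : set R).
Implicit Types (a b c h r t : R).

Lemma derive_le (K K' : R -> R) a b c : a <= b ->
  (forall t, a <= t <= b -> is_derive t (1 : R) K (K' t)) ->
  (forall t, a <= t <= b -> K' t <= c) -> K b - K a <= c * (b - a).
Proof.
move=> ab dK Kc.
have dK' x : x \in `]a, b[ -> is_derive x (1 : R) K (K' x).
  by rewrite in_itv/= => /andP[h1 h2]; apply: dK; rewrite !ltW.
have cK : {within `[a, b], continuous K}.
  apply: derivable_within_continuous => x; rewrite in_itv/= => xab.
  by have [] := dK _ xab.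
have [x xab ->] := MVT_segment ab dK' cK.
by rewrite ler_wpM2r ?subr_ge0//; apply: Kc; rewrite in_itv/= in xab.
Qed.

(* For a fixed horizon the error [e] can be sent to 0, so that [be] is integrable
   in time; being Lipschitz, it tends to 0. *)
Lemma lyapunov_decay (be be' : R -> R) (M L c : R) : 0 < c -> 0 < L ->
  (forall t, 0 <= t -> is_derive t (1 : R) be (be' t)) ->
  (forall t, 0 <= t -> - L <= be' t) -> (forall t, 0 <= t -> 0 <= be t) ->
  (forall e : R, 0 < e -> exists K K' : R -> R, forall t, 0 <= t ->
    [/\ is_derive t (1 : R) K (K' t), `|K t| <= M & K' t <= e - c * be t]) ->
  be t @[t --> +oo] --> 0.
Proof.
move=> c0 L0 dbe Lbe be0 hK; apply/cvgrPdist_lt => eta eta0.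
have [[T HT]|hn] := pselect (exists T : R, forall t, T < t -> be t < eta).
  exists (Num.max T 0); split; first exact: num_real.
  move=> t; rewrite gt_max => /andP[Tt t0].
  by rewrite sub0r normrN ger0_norm ?be0 ?ltW//; exact: HT.
have often T : exists2 t, T < t & eta <= be t.
  apply: contrapT => h; apply: hn; exists T => t Tt.
  by rewrite ltNge; apply/negP => h'; apply: h; exists t.
pose de := eta / (2 * L); have de0 : 0 < de by rewrite divr_gt0// mulr_gt0.
pose good e (K K' : R -> R) := forall t, 0 <= t ->
    [/\ is_derive t (1 : R) K (K' t), `|K t| <= M & K' t <= e - c * be t].
(* After each time at which [be] is at least [eta], the Lipschitz bound keeps it above [eta / 2] for
   the duration [de], which lowers every [K] by [c (eta / 2) de] up to drift. The time [T] is built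
   from [be] alone, before [e] and [K], so that [e] can still be chosen in terms of [T]. *)
have steps (n : nat) : exists2 T : R, 0 <= T & forall (e : R) K K', 0 < e -> good e K K' ->
    K T - K 0 <= e * T - n%:R * (c * (eta / 2) * de).
  elim: n => [|n [T T0 IH]].
    by exists 0 => // e K K' _ _; rewrite mul0r mulr0 !subrr.
  have [t Tt bt] := often T; have t0 : 0 <= t by apply: le_trans (ltW Tt).
  exists (t + de); first by rewrite addr_ge0// ltW.
  move=> e K K' e0 gK; have h1 := IH e K K' e0 gK.
  have h2 : K t - K T <= e * (t - T).
    apply: (derive_le (K' := K')); first exact: ltW.
      by move=> x /andP[Tx _]; have [] := gK x (le_trans T0 Tx).
    move=> x /andP[Tx _]; have x0 := le_trans T0 Tx.
    have [_ _ hx] := gK x x0; apply: le_trans hx _.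
    by rewrite gerBl mulr_ge0 ?be0// ltW.
  have h3 : K (t + de) - K t <= (e - c * (eta / 2)) * (t + de - t).
    apply: (derive_le (K' := K')); first by rewrite lerDl ltW.
      by move=> x /andP[tx _]; have [] := gK x (le_trans t0 tx).
    move=> x /andP[tx xt]; have x0 := le_trans t0 tx.
    have [_ _ hx] := gK x x0; apply: le_trans hx _.
    rewrite lerD2l lerN2 ler_pM2l//.
    have : (- be x) - (- be t) <= L * (x - t).
      apply: (derive_le (K := fun y => - be y) (K' := fun y => - be' y)) => //.
        by move=> y /andP[ty _]; apply: is_deriveN; exact: dbe (le_trans t0 ty).
      by move=> y /andP[ty _]; rewrite lerNl; exact: Lbe (le_trans t0 ty).
    have : L * (x - t) <= L * de by rewrite ler_pM2l//; lra.
    have -> : L * de = eta / 2 by rewrite /de; field; rewrite gt_eqF.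
    lra.
  rewrite [t + de - t]addrC addKr in h3.
  rewrite -natr1 mulrDl mul1r; move: h1 h2 h3; lra.
set gam := c * (eta / 2) * de in steps.
have gam0 : 0 < gam by apply: mulr_gt0 => //; apply: mulr_gt0 => //; exact: divr_gt0.
have [n hn'] : exists n : nat, (2 * M + 2) / gam < n%:R.
  exists (Num.truncn `|(2 * M + 2) / gam|).+1.
  by apply: le_lt_trans (ler_norm _) _; exact: truncnS_gt.
have [T T0 HT] := steps n.
have T1 : 0 < T + 1 by rewrite ltr_wpDl.
(* With this [e] the drift up to [T] is at most 1, whereas [n] steps lower [K] by more than
   [2 M + 2], too much for a function bounded by [M]. *)
have [K [K' gK]] := hK (T + 1)^-1 ltac:(by rewrite invr_gt0).
have := HT _ _ _ (_ : 0 < (T + 1)^-1) gK; rewrite invr_gt0 => /(_ T1) h1.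
have [_ /ler_normlP[b1 b2] _] := gK T T0; have [_ /ler_normlP[b3 b4] _] := gK 0 (lexx 0).
have h2 : (T + 1)^-1 * T <= 1 by rewrite mulrC ler_pdivrMr// mul1r lerDl.
move: hn'; rewrite ltr_pdivrMr// => hn'; exfalso; move: h1 h2 hn' b1 b2 b3 b4; lra.
Qed.

Lemma is_derive_isum (F : idx -> R -> R) (F' : idx -> R) t :
  (forall i, is_derive t (1 : R) (F i) (F' i)) ->
  is_derive t (1 : R) (fun s => \sum_i F i s) (\sum_i F' i).
Proof.
move=> dF; rewrite sum_idx; under eq_fun do rewrite sum_idx.
exact: is_deriveD (is_deriveD (dF _) (dF _)) (is_deriveD (dF _) (dF _)).
Qed.

(** * The virial functional as a Lyapunov function of the reduced system *)

Section Evolution.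
Variables (k m : R).
Hypotheses (k1 : 1 <= k ^+ 2) (k2 : 1 <= (k + 1) ^+ 2).
Variables (u g d w : R -> idx -> R -> R) (N : R -> R).
Hypotheses (pu : forall t i, prim (u t i) (g t i)) (sg : forall t i, sq (g t i)).
Hypothesis (Ld : forall t i, L2d (fun s => u s i) (d t i) t).
Hypotheses (nu1 : forall t i, 0 <= t -> N2 (u t i) <= 1).
Hypotheses (ng1 : forall t i, 0 <= t -> N2 (g t i) <= 1).
Hypothesis (ub : forall t i (r : R), 0 <= t -> 0 < r -> `|u t i r| <= 1).
Hypothesis (cw : forall t i (r : R), 0 <= t -> 0 < r -> {for r, continuous (w t i)}).
Hypothesis (N0 : forall r : R, 0 < r -> 0 <= N r).
Hypothesis (Nw : forall r : R, 0 < r -> (kap k + `|m| * r) * N r <= wt r ^+ 2 / 1536).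
Hypothesis (wlip : forall t i (r x y : R), 0 <= t -> 0 < r -> r <= x -> r <= y ->
  `|w t i x - w t i y| <= N r * \sum_j `|u t j x - u t j y|).
Hypothesis (wb : forall t i (r x : R), 0 <= t -> 0 < r -> r <= x ->
  `|w t i x| <= N r * \sum_j `|u t j x|).
Hypothesis (eqn : forall t i, 0 <= t -> {ae mu, forall r : R, 0 < r ->
  d t i r = LL k m (u t) (g t) i r + w t i r}).

Let su t i : sq (u t i). Proof. by have [] := Ld t i. Qed.
Let sd t i : sq (d t i). Proof. by have [] := Ld t i. Qed.

Lemma L2d_VV (f f1 : R -> idx -> R -> R) (f' f1' : idx -> R -> R) t i :
  (forall j, L2d (fun s => f s j) (f' j) t) -> (forall j, L2d (fun s => f1 s j) (f1' j) t) ->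
  L2d (fun s => VV k m (f s) (f1 s) i) (VV k m f' f1' i) t.
Proof.
move=> Lf Lf1; apply: (L2dD (v := fun s r => _) (w := fun s r => _)).
  apply: (L2dD (v := fun s r => _) (w := fun s r => _)).
    exact: L2dM (@rwt_meas R) (@rwt_bound R) (Lf1 _).
  exact: L2dM (@cwt_meas R _) (@cwt_bound R _) (Lf _).
exact: L2dM (@crwt_meas R _) (@crwt_bound R _) (Lf _).
Qed.

Lemma L2d_ZZ (f f1 : R -> idx -> R -> R) (f' f1' : idx -> R -> R) t i :
  (forall j, L2d (fun s => f s j) (f' j) t) -> (forall j, L2d (fun s => f1 s j) (f1' j) t) ->
  L2d (fun s => ZZ (f s) (f1 s) i) (ZZ f' f1' i) t.
Proof.
move=> Lf Lf1; apply: (L2dD (v := fun s r => _) (w := fun s r => _)).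
  exact: L2dM (@rwt_meas R) (@rwt_bound R) (Lf1 _).
exact: L2dM (@zwt_meas R) (@zwt_bound R) (Lf _).
Qed.

(** The weight [r wt^4] is a compromise: bounded operators of L^2(r dr) produce it, so [be] is
    differentiable in time, and it is at most [wt^2], the weight of the dissipated quantity in
    [virial_rate]. *)
Let be t : R := \sum_i ip (fun r => wt r ^+ 2 * u t i r) (fun r => wt r ^+ 2 * u t i r).

Let be' t : R := 2 * \sum_i ip (fun r => wt r ^+ 2 * d t i r) (fun r => wt r ^+ 2 * u t i r).

Let wt2_meas : measurable_fun H (fun r : R => wt r ^+ 2).
Proof. by apply: measurable_funX; exact: meas_wt. Qed.

Let wt2_bound (r : R) : 0 < r -> `|wt r ^+ 2| <= 1.
Proof.
move=> r0; rewrite ger0_norm ?sqr_ge0// exprn_ile1 ?wt_le1//.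
exact: ltW (wt_gt0 r0).
Qed.

Let dbe t : is_derive t (1 : R) be (be' t).
Proof.
have Lq i : L2d (fun s r => wt r ^+ 2 * u s i r) (fun r => wt r ^+ 2 * d t i r) t.
  exact: L2dM wt2_meas wt2_bound (Ld t i).
have := is_derive_isum (fun i => is_derive_ip (Lq i) (Lq i)) => dd.
apply: is_derive_eq dd _; rewrite /be' mulr_sumr; apply: eq_bigr => i _.
by rewrite [X in _ + X]ipC mulr2n mulrDl mul1r.
Qed.

Let be_ge0 t : 0 <= be t.
Proof.
apply: sumr_ge0 => i _; apply: Rintegral_ge0 => r; rewrite inH => r0.
by rewrite -expr2 mulr_ge0 ?sqr_ge0// ltW.
Qed.

Let be_le t : 0 <= t -> be t <= \sum_i \int[mu]_(r in H) (wt r ^+ 2 * u t i r ^+ 2).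
Proof.
move=> t0; apply: ler_sum => i _.
have sq1 := (sqM wt2_meas wt2_bound (su t i)).1.
apply: le_Rint; [exact: mH|exact: sq_prod| |].
  by apply: igr_wt2M => [|r r0]; [case: (su t i)|exact: ub].
move=> r; rewrite inH => r0; have w0 := ltW (wt_gt0 r0); have w1 := wt_le1 r0; have rw := rwt_le1 r0.
have r0' := ltW r0.
have -> : r * (wt r ^+ 2 * u t i r * (wt r ^+ 2 * u t i r)) =
   (r * wt r * wt r) * (wt r ^+ 2 * u t i r ^+ 2) by ring.
by apply: ler_piMl; [pos|rewrite mulr_ile1// mulr_ge0].
Qed.

Let N_le1 (r : R) : 0 < r -> N r <= 1.
Proof.
move=> r0; have hN := Nw r0; have N00 := N0 r0; have c1 := kap_ge1 k.
have mr : 0 <= `|m| * r * N r by rewrite !mulr_ge0// ltW.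
have kN : 0 <= (kap k - 1) * N r by rewrite mulr_ge0// subr_ge0.
have := wt2_bound r0; rewrite ger0_norm ?sqr_ge0// => w2.
by move: hN mr kN w2 (sqr_ge0 (wt r)); lra.
Qed.

Let L0 : R := 10 + kap k * \int[mu]_(r in H) (wt r ^+ 2) + 2 * `|m|.

(** The time derivative is replaced by the equation. Against the weight [r] the singular term in
    [1/r] becomes a bounded function times [wt^2]. In [L0], the constant 10 is 2 for the derivative
    term plus 8 for the nonlinearity. *)
Let dbe_bound t i : 0 <= t ->
  `|ip (fun r => wt r ^+ 2 * d t i r) (fun r => wt r ^+ 2 * u t i r)| <= L0.
Proof.
move=> t0; have mHR := mH (R := R).
have sq1 := (sqM wt2_meas wt2_bound (su t i)).1.
have sq2 := (sqM wt2_meas wt2_bound (sd t i)).1.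
have Ip := sq_prod sq2 sq1.
apply: le_trans (norm_Rint_le mHR Ip) _.
pose Sq (v : R -> R) r := r * v r ^+ 2.
have Iu j : igr H (Sq (u t j)) by case: (su t j).
have Ig j : igr H (Sq (g t j)) by case: (sg t j).
have Ij j := igrD mHR (Iu j) (Iu i).
have Is := igr_sum (index_enum idx) mHR Ij.
have I1 := igrD mHR (Ig (swp i)) (Iu i).
have I2 := igrZ (kap k) mHR (igr_wt2 (R := R)).
have I3 := igrZ `|m| mHR (Ij (tau i)).
have I12 := igrD mHR I1 I2; have I123 := igrD mHR I12 I3; have I4 := igrD mHR I123 Is.
apply: le_trans (_ : _ <= \int[mu]_(r in H) (Sq (g t (swp i)) r + Sq (u t i) r + kap k * wt r ^+ 2
   + `|m| * (Sq (u t (tau i)) r + Sq (u t i) r) + \sum_j (Sq (u t j) r + Sq (u t i) r))) _.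
  apply: (ae_le_Rint mHR (igr_norm Ip) I4).
  apply: aeS (eqn i t0) => r hr; rewrite inH => r0; have r0' := ltW r0.
  have w0 := ltW (wt_gt0 r0); have w1 := wt_le1 r0; have rw := rwt_le1 r0.
  have -> : r * (wt r ^+ 2 * d t i r * (wt r ^+ 2 * u t i r)) = (wt r ^+ 2 * wt r ^+ 2) * (r * (d t i r * u t i r)).
    by ring.
  have w2 : `|wt r ^+ 2| <= 1 by exact: wt2_bound.
  have W : r * (d t i r * u t i r) = r * (g t (swp i) r * u t i r)
     + cc k i * (u t (swp i) r * u t i r) + m * sgn i * (r * (u t (tau i) r * u t i r))
     + r * (w t i r * u t i r).
    by rewrite hr// /LL; field; rewrite gt_eqF.
  rewrite W 3!(mulrDr (wt r ^+ 2 * wt r ^+ 2)).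
  have qle x : `|wt r ^+ 2 * wt r ^+ 2 * x| <= `|x|.
    by rewrite normrM ler_piMl// normrM mulr_ile1.
  have yg x y : `|r * (x * y)| <= r * x ^+ 2 + r * y ^+ 2.
    by rewrite normrM ger0_norm// -mulrDr ler_wpM2l// sq_young.
  apply: le_trans (ler_normD _ _) _; apply: lerD; first apply: le_trans (ler_normD _ _) _; first apply: lerD;
    first apply: le_trans (ler_normD _ _) _; first apply: lerD.
  - by apply: le_trans (qle _) _; exact: yg.
  - rewrite !normrM; have := ub (swp i) t0 r0; have := ub i t0 r0 => u1 u2.
    rewrite ger0_norm ?sqr_ge0// mulrCA.
    apply: ler_pM => //; [by rewrite !mulr_ge0|exact: cc_le|].
    rewrite ger0_norm ?sqr_ge0// in w2.
    have h1 : wt r ^+ 2 * wt r ^+ 2 <= wt r ^+ 2 by rewrite ler_piMl ?sqr_ge0.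
    by apply: le_trans h1; rewrite ler_piMr ?mulr_ge0 ?sqr_ge0// mulr_ile1.
  - apply: le_trans (qle _) _; rewrite normrM normrM sgn_norm mulr1 ler_wpM2l//; exact: yg.
  - apply: le_trans (qle _) _; rewrite normrM ger0_norm// normrM.
    have hw : `|w t i r| <= \sum_j `|u t j r|.
      apply: le_trans (wb i t0 r0 (lexx r)) _; rewrite ler_piMl ?N_le1//.
      by apply: sumr_ge0.
    apply: le_trans (ler_wpM2l r0' (ler_wpM2r (normr_ge0 _) hw)) _.
    rewrite mulr_suml mulr_sumr; apply: ler_sum => j _.
    by have := yg (u t j r) (u t i r); rewrite !normrM (ger0_norm r0').
rewrite (RintD mHR I123 Is) (RintD mHR I12 I3) (RintD mHR I1 I2) (RintD mHR (Ig _) (Iu _)).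
rewrite (RintZ _ mHR (igr_wt2 (R := R))) (RintZ _ mHR (Ij _)) (Rint_sum _ mHR Ij) (RintD mHR (Iu _) (Iu _)).
have nu j : \int[mu]_(r in H) Sq (u t j) r <= 1 by exact: nu1.
have ng j : \int[mu]_(r in H) Sq (g t j) r <= 1 by exact: ng1.
have hs : \sum_j \int[mu]_(r in H) (Sq (u t j) r + Sq (u t i) r) <= \sum_(j : idx) 2.
  apply: ler_sum => j _; rewrite (RintD mHR (Iu _) (Iu _)); have := nu i; have := nu j; lra.
have hm : `|m| * (\int[mu]_(x in H) Sq (u t (tau i)) x + \int[mu]_(x in H) Sq (u t i) x) <= `|m| * 2.
  by rewrite ler_wpM2l//; have := nu i; have := nu (tau i); lra.
have e8 : \sum_(j : idx) 2 = 8 :> R by rewrite sum_idx; ring.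
rewrite e8 in hs; rewrite /L0; move: hs hm (nu i) (ng (swp i)); lra.
Qed.

Let Lyap h t : R := \sum_i ip (VV k m (fun j => stk h (u t j)) (fun j => dlt h (u t j)) i)
  (ZZ (fun j => stk h (u t j)) (fun j => dlt h (u t j)) i).

(** The bound has to be uniform in [h], hence the norm of the difference quotient is computed as
    that of the mean of [g]. Young's inequality gives [14 = (8 + 20) / 2] for each of the four
    indices. *)
Let Lyap_bound h t : 0 < h -> 0 <= t -> `|Lyap h t| <= 4 * (14 + 4 * kap k ^+ 2 + 2 * m ^+ 2).
Proof.
move=> h0 t0.
have sf j : sq (stk h (u t j)) by have [] := sq_stk h0 (su t j).
have sf1 j : sq (dlt h (u t j)) by have [] := sq_dlt h0 (su t j).
have nf j : N2 (stk h (u t j)) <= 2.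
  by have [_ n] := sq_stk h0 (su t j); have := nu1 j t0; lra.
have nf1 j : N2 (dlt h (u t j)) <= 2.
  have [_ n] := sq_stk h0 (sg t j).
  have -> : N2 (dlt h (u t j)) = N2 (stk h (g t j)).
    by apply: N2_ext => r r0; rewrite (stkE (ltW h0) (pu t j)).
  by have := ng1 j t0; lra.
have -> : 4 * (14 + 4 * kap k ^+ 2 + 2 * m ^+ 2) = \sum_(i : idx) (14 + 4 * kap k ^+ 2 + 2 * m ^+ 2).
  by rewrite sum_idx; ring.
apply: le_trans (ler_norm_sum _ _ _) _; apply: ler_sum => i _.
have key (a b c K n e : R) : a <= (4 + 4 * c + 2 * n) * 2 -> b <= 10 * 2 -> c <= K ->
  2 * e <= 1 * a + 1^-1 * b -> e <= 14 + 4 * K + 2 * n by lra.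
have key' := key _ _ _ (kap k ^+ 2) _ _ (N2_VV_le k m i sf sf1 nf nf1) (N2_ZZ_le i sf sf1 nf nf1) _
  (ip_young ltr01 (sq_VV k m i sf sf1) (sq_ZZ i sf sf1)).
apply: key'.
have := cc_le k i; have := kap_ge1 k => ? ?.
by rewrite -[leLHS]real_normK ?num_real// ler_pXn2r ?nnegrE//; lra.
Qed.

Lemma local_energy_decay : be t @[t --> +oo] --> 0.
Proof.
have kp := kap_ge1 k.
have wt0 : 0 <= \int[mu]_(r in H) (wt r ^+ 2) by apply: Rintegral_ge0 => r _; exact: sqr_ge0.
have L00 : 0 < L0.
  have k0 : 0 <= kap k by exact: le_trans ler01 kp.
  by rewrite /L0 -addrA ltr_wpDr// addr_ge0// mulr_ge0.
apply: (@lyapunov_decay be be' (4 * (14 + 4 * kap k ^+ 2 + 2 * m ^+ 2)) (8 * L0) 8^-1).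
- by rewrite invr_gt0.
- by rewrite mulr_gt0.
- by move=> t _; exact: dbe.
- move=> t t0.
  have : `|\sum_i ip (fun r => wt r ^+ 2 * d t i r) (fun r => wt r ^+ 2 * u t i r)| <= \sum_(i : idx) L0.
    by apply: le_trans (ler_norm_sum _ _ _) _; apply: ler_sum => i _; exact: dbe_bound.
  rewrite (_ : \sum_(i : idx) L0 = 4 * L0); last by rewrite sum_idx; ring.
  by rewrite /be' => /ler_normlP[]; lra.
- by move=> t _; exact: be_ge0.
(* The width [h = q^2] is chosen so that [rate_cst] times [h^(1/2)] is at most [e]. *)
move=> e e0; pose q := e / (`|rate_cst k m| + 1); have q0 : 0 < q by rewrite divr_gt0// ltr_wpDl.
pose h := q ^+ 2; have h0 : 0 < h by rewrite exprn_gt0.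
have sh : Num.sqrt h = q by rewrite sqrtr_sqr gtr0_norm.
exists (Lyap h); exists (fun t => \sum_i (ip (VV k m (fun j => stk h (d t j)) (fun j => dlt h (d t j)) i)
  (ZZ (fun j => stk h (u t j)) (fun j => dlt h (u t j)) i) +
  ip (VV k m (fun j => stk h (u t j)) (fun j => dlt h (u t j)) i)
  (ZZ (fun j => stk h (d t j)) (fun j => dlt h (d t j)) i))) => t t0; split.
- apply: is_derive_isum => i; apply: is_derive_ip.
    apply: (L2d_VV (f := fun s j => stk h (u s j)) (f1 := fun s j => dlt h (u s j))) => j.
      exact: L2d_stk (Ld t j).
    exact: L2d_dlt (Ld t j).
  apply: (L2d_ZZ (f := fun s j => stk h (u s j)) (f1 := fun s j => dlt h (u s j))) => j.
    exact: L2d_stk (Ld t j).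
  exact: L2d_dlt (Ld t j).
- exact: Lyap_bound.
have V := virial_rate k1 k2 h0 (pu t) (su t) (sg t) (sd t) (fun i => ng1 i t0)
  (fun i r => @ub t i r t0) (fun i r => @cw t i r t0) N0 Nw (fun i r x y => @wlip t i r x y t0)
  (fun i r x => @wb t i r x t0) (fun i => @eqn t i t0).
apply: le_trans V _; rewrite sh; apply: lerB.
  apply: le_trans (ler_wpM2r (ltW q0) (ler_norm _)) _.
  rewrite /q mulrCA ler_piMr ?(ltW e0)// ler_pdivrMr ?ltr_wpDl// mul1r.
  by rewrite lerDl.
by rewrite ler_pM2l ?invr_gt0// be_le.
Qed.

End Evolution.

End Decay.

(** * The nonlinearity *)

Section Nonlinearity.
Context {R : realType}.
Implicit Types (b s t : R).
Local Open Scope complex_scope.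

(** Real and imaginary parts are differentiable. Polynomials in a function and its conjugate
    preserve this, which lets the mean value theorem be applied to the nonlinearity along a
    segment. *)
Definition cderivable (F : R -> R[i]) s := exists a b : R -> R,
  [/\ forall x, F x = a x +i* b x, derivable a s 1 & derivable b s 1].

Lemma cderivable_ext F G s : (forall x, F x = G x) -> cderivable F s -> cderivable G s.
Proof. by move=> FG [a [b [E da db]]]; exists a, b; split=> // x; rewrite -FG. Qed.

Lemma cderivable_Re F s : cderivable F s -> derivable (fun x => complex.Re (F x)) s 1.
Proof.
move=> [a [b [E da _]]]; rewrite (_ : (fun x => _) = a); first exact: da.
by apply/funext => x; rewrite E.
Qed.

Lemma cderivable_Im F s : cderivable F s -> derivable (fun x => complex.Im (F x)) s 1.
Proof.
move=> [a [b [E _ db]]]; rewrite (_ : (fun x => _) = b); first exact: db.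
by apply/funext => x; rewrite E.
Qed.

Lemma cderivable_cst c s : cderivable (fun=> c) s.
Proof.
exists (fun=> complex.Re c), (fun=> complex.Im c).
by split=> [x||]; [case: c|exact: derivable_cst|exact: derivable_cst].
Qed.

Lemma cderivableD F G s : cderivable F s -> cderivable G s -> cderivable (fun x => F x + G x) s.
Proof.
move=> [a [b [E da db]]] [a' [b' [E' da' db']]].
exists (a + a'), (b + b'); split=> [x||]; first by rewrite E E'.
  exact: (derivableD da da').
exact: (derivableD db db').
Qed.

Lemma cderivableM F G s : cderivable F s -> cderivable G s -> cderivable (fun x => F x * G x) s.
Proof.
move=> [a [b [E da db]]] [a' [b' [E' da' db']]].
exists (a * a' - b * b'), (a * b' + b * a'); split=> [x||]; first by rewrite E E'.
  exact: (derivableB (derivableM da da') (derivableM db db')).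
exact: (derivableD (derivableM da db') (derivableM db da')).
Qed.

Lemma cderivable_conj F s : cderivable F s -> cderivable (fun x => (F x)^*) s.
Proof.
move=> [a [b [E da db]]]; exists a, (- b); split=> [x||]; first by rewrite E.
  exact: da.
exact: (derivableN db).
Qed.

Lemma cderivableX F n s : cderivable F s -> cderivable (fun x => F x ^+ n) s.
Proof.
move=> dF; elim: n => [|n IHn]; first exact: cderivable_cst.
apply: (cderivable_ext (F := fun x => F x * F x ^+ n)) => [x|]; first by rewrite exprS.
exact: (cderivableM dF IHn).
Qed.

Lemma cderivable_meval (W : mpoly.mpoly 4 R[i]) (v : R -> 'I_4 -> R[i]) s :
  (forall i, cderivable (fun x => v x i) s) -> cderivable (fun x => mpoly.meval (v x) W) s.
Proof.
move=> dv.
have dm (m : mpoly.multinom 4) (r : seq 'I_4) :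
    cderivable (fun x => \prod_(i <- r) v x i ^+ mpoly.fun_of_multinom m i) s.
  elim: r => [|i r IHr].
    by apply: cderivable_ext (cderivable_cst 1 s) => x; rewrite big_nil.
  apply: cderivable_ext (cderivableM (cderivableX (mpoly.fun_of_multinom m i) (dv i)) IHr) => x.
  by rewrite big_cons.
have ds (l : seq (mpoly.multinom 4)) : cderivable (fun x => \sum_(a <- l)
    mpoly.mcoeff a W * \prod_i v x i ^+ mpoly.fun_of_multinom a i) s.
  elim: l => [|a l IHl].
    by apply: cderivable_ext (cderivable_cst 0 s) => x; rewrite big_nil.
  apply: cderivable_ext (cderivableD (cderivableM (cderivable_cst (mpoly.mcoeff a W) s)
    (dm a (index_enum _))) IHl) => x.
  by rewrite big_cons.
by apply: cderivable_ext (ds (mpoly.msupp W)) => x; rewrite mpoly.mevalE.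
Qed.

Lemma cderivable_nonlin (W : mpoly.mpoly 4 R[i]) (f : R -> spinor R) s :
  cderivable (fun x => (f x).1) s -> cderivable (fun x => (f x).2) s ->
  cderivable (nonlin W \o f) s.
Proof.
move=> f1 f2.
have f3 := cderivable_conj f1; have f4 := cderivable_conj f2.
apply: (@cderivable_meval W (fun x => tnth [tuple (f x).1; (f x).1^*; (f x).2; (f x).2^*]) s) => i.
have E x : nth 0 [:: (f x).1; (f x).1^*; (f x).2; (f x).2^*] i =
  tnth [tuple (f x).1; (f x).1^*; (f x).2; (f x).2^*] i by rewrite (tnth_nth 0).
apply: cderivable_ext E _.
by case: i => [[|[|[|[|//]]]] ilt].
Qed.

(* The real unknowns in which the linear part is the operator LL. *)
Definition to_spinor (x : idx -> R) : spinor R :=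
  (x (false, false) +i* x (true, false), - x (true, true) +i* x (false, true)).

Definition real_coord (z : spinor R) (i : idx) : R := match i with
  | (false, false) => complex.Re z.1 | (true, false) => complex.Im z.1
  | (false, true) => complex.Im z.2 | (true, true) => - complex.Re z.2 end.

Lemma real_coordK z : to_spinor (real_coord z) = z.
Proof. by case: z => -[a1 a2] [b1 b2]; rewrite /to_spinor /= opprK. Qed.

(** The coordinates of [- 'i] times the nonlinearity, in the arrangement of [to_spinor]. *)
Definition source (W1 W2 : mpoly.mpoly 4 R[i]) (x : idx -> R) (i : idx) : R :=
  let z := to_spinor x in match i with
  | (false, false) => complex.Im (nonlin W1 z) | (true, false) => - complex.Re (nonlin W1 z)
  | (false, true) => - complex.Re (nonlin W2 z) | (true, true) => - complex.Im (nonlin W2 z) end.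

Lemma spnormE (x : idx -> R) : spnorm (to_spinor x) = Num.sqrt (\sum_i x i ^+ 2).
Proof. by rewrite /spnorm /= sum_idx sqrrN; congr Num.sqrt; ring. Qed.

Lemma spnorm_le_sum (x : idx -> R) : spnorm (to_spinor x) <= \sum_i `|x i|.
Proof.
have S0 : 0 <= \sum_i `|x i| by exact: sumr_ge0.
rewrite spnormE -[leRHS]ger0_norm// -sqrtr_sqr ler_wsqrtr// !sum_idx.
do 4 (rewrite -[in leLHS](real_normK (num_real (x _)))).
have := normr_ge0 (x (false, false)); have := normr_ge0 (x (false, true)).
have := normr_ge0 (x (true, false)); have := normr_ge0 (x (true, true)).
move: (`|x _|) (`|x _|) (`|x _|) (`|x _|) => p1 p2 p3 p4 h1 h2 h3 h4.
have := (mulr_ge0 h1 h2, mulr_ge0 h1 h3, mulr_ge0 h1 h4, mulr_ge0 h2 h3, mulr_ge0 h2 h4, mulr_ge0 h3 h4).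
by case=> [[[[[? ?] ?] ?] ?] ?]; lra.
Qed.

Lemma spnorm_le (x : idx -> R) b : (forall i, `|x i| <= b) -> spnorm (to_spinor x) <= 2 * b.
Proof.
move=> xb; have b0 : 0 <= b by exact: le_trans (xb (false, false)).
rewrite spnormE; have -> : 2 * b = Num.sqrt ((2 * b) ^+ 2) by rewrite sqrtr_sqr ger0_norm ?mulr_ge0.
rewrite ler_wsqrtr//.
have xb2 i : x i ^+ 2 <= b ^+ 2.
  by rewrite -[leLHS]real_normK ?num_real// ler_pXn2r ?nnegrE.
apply: le_trans (ler_sum _ (fun i _ => xb2 i)) _.
by rewrite sum_idx le_eqVlt; apply/orP; left; apply/eqP; ring.
Qed.

Lemma powR_le_expr (x y p : R) (n : nat) : 0 <= x <= y -> y <= 1 -> n%:R <= p ->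
  x `^ p <= y ^+ n.
Proof.
move=> /andP[x0 xy] y1 np; have y0 := le_trans x0 xy.
have p0 : 0 <= p by apply: le_trans np.
apply: le_trans (_ : y `^ p <= _); first by apply: ge0_ler_powR.
rewrite -powR_mulrn//; move: y0; rewrite le_eqVlt => /predU1P[<-|y0].
  have [->|n0] := eqVneq (n%:R : R) 0.
    by rewrite powRr0; have [->|pn0] := eqVneq p 0; rewrite ?powRr0// powR0.
  rewrite (powR0 n0) powR0//; apply: contraNneq n0 => pE.
  by rewrite eq_le ler0n andbT -pE.
by apply: ger_powR => //; rewrite y0.
Qed.

Lemma cmod_ge z : `|complex.Re z| <= cmod z /\ `|complex.Im z| <= cmod z :> R.
Proof.
by split; rewrite -sqrtr_sqr /cmod ler_wsqrtr// ?lerDl ?lerDr sqr_ge0.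
Qed.

Variables (C p : R) (n : nat) (W1 W2 : mpoly.mpoly 4 R[i]).
Hypotheses (C0 : 0 < C) (np : n.+1%:R <= p).
Hypotheses (pb : power_bound C p W1 W2) (db : derivative_bound C p W1 W2).

Lemma source0 i : source W1 W2 (fun=> 0) i = 0.
Proof.
have z0 : spnorm (to_spinor (fun=> 0)) = 0 :> R.
  by rewrite spnormE big1 ?sqrtr0// => j _; rewrite expr0n.
have := pb (z := to_spinor (fun=> 0)); rewrite z0 ltr01 => /(_ isT).
rewrite powR0 ?mulr0; last by rewrite gt_eqF//; apply: lt_le_trans np.
have c0 (c : R[i]) : 0 <= cmod c by exact: sqrtr_ge0.
move=> h; have [h1 h2] := cmod_ge (nonlin W1 (to_spinor (fun=> 0))).
have [h3 h4] := cmod_ge (nonlin W2 (to_spinor (fun=> 0))).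
have e1 : cmod (nonlin W1 (to_spinor (fun=> 0))) = 0.
  by apply/eqP; rewrite eq_le c0 andbT; apply: le_trans h; rewrite lerDl.
have e2 : cmod (nonlin W2 (to_spinor (fun=> 0))) = 0.
  by apply/eqP; rewrite eq_le c0 andbT; apply: le_trans h; rewrite lerDr.
rewrite e1 e2 in h1 h2 h3 h4.
by case: i => [[] []] /=; apply/eqP; rewrite ?oppr_eq0 -normr_le0.
Qed.

(* Mean value theorem along the segment from x to y, parametrized by [1, 2]. *)
Lemma source_lip (x y : idx -> R) b i : (forall j, `|x j| <= b) -> (forall j, `|y j| <= b) ->
  2 * b < 1 ->
  `|source W1 W2 x i - source W1 W2 y i| <= C * (2 * b) ^+ n * \sum_j `|x j - y j|.
Proof.
move=> xb yb b1; have b0 : 0 <= b by exact: le_trans (xb (false, false)).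
(* The parameter starts at 1 because [derivative_bound] is stated at positive radii. It holds for
   any differentiable path of spinors, here the segment itself. *)
pose X s : idx -> R := fun j => y j + (s - 1) * (x j - y j).
pose f s : spinor R := to_spinor (X s).
have dX j s : is_derive s (1 : R) (fun s => X s j) (x j - y j).
  have d1 : is_derive s (1 : R) (fun s : R => s - 1) 1.
    have dd := is_deriveB (is_derive_id s (1 : R)) (is_derive_cst (1 : R) s 1).
    by apply: is_derive_eq dd _; rewrite subr0.
  have := is_deriveD (is_derive_cst (y j) s 1) (is_deriveM d1 (is_derive_cst (x j - y j) s 1)).
  by move=> dd; apply: is_derive_eq dd _; rewrite /GRing.scale/= mulr0 add0r add0r mulr1.
have dXN j s : is_derive s (1 : R) (fun s => - X s j) (- (x j - y j)).
  exact: is_deriveN (dX j s).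
have df s : forall_comp (fun u => derivable u s 1) f.
  by split; rewrite /comp11 /comp12 /comp21 /comp22 /f /to_spinor/=;
    [have [] := dX (false, false) s|have [] := dX (true, false) s
    |have [] := dXN (true, true) s|have [] := dX (false, true) s].
have cdf W s : cderivable (nonlin W \o f) s.
  apply: cderivable_nonlin.
    by exists (fun s => X s (false, false)), (fun s => X s (true, false)).
  by exists (fun s => - X s (true, true)), (fun s => X s (false, true)).
have Xb s j : 1 <= s <= 2 -> `|X s j| <= b.
  move=> /andP[s1 s2]; have -> : X s j = (2 - s) * y j + (s - 1) * x j by rewrite /X; ring.
  apply: le_trans (ler_normD _ _) _; rewrite !normrM.
  rewrite (ger0_norm (_ : 0 <= 2 - s)) ?subr_ge0// (ger0_norm (_ : 0 <= s - 1)) ?subr_ge0//.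
  have h1 : (2 - s) * `|y j| <= (2 - s) * b by rewrite ler_wpM2l ?subr_ge0.
  have h2 : (s - 1) * `|x j| <= (s - 1) * b by rewrite ler_wpM2l ?subr_ge0.
  lra.
set D := C * (2 * b) ^+ n * \sum_j `|x j - y j|.
have bound s : 1 <= s <= 2 -> cmod (cderive1 (nonlin W1 \o f) s) + cmod (cderive1 (nonlin W2 \o f) s) <= D.
  move=> s12; have fs : spnorm (f s) <= 2 * b by apply: spnorm_le => j; exact: Xb.
  have s0 : 0 < s by have /andP[] := s12; lra.
  have f0 : 0 <= spnorm (f s) by exact: sqrtr_ge0.
  apply: le_trans (db s0 (df s) (le_lt_trans fs b1)) _; rewrite /D.
  apply: ler_pM; rewrite ?mulr_ge0 ?powR_ge0 ?sqrtr_ge0 ?(ltW C0)//.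
    rewrite ler_pM2l//; apply: powR_le_expr; rewrite ?f0 ?(ltW b1)//.
    by move: np; rewrite -natr1; lra.
  have -> : comp_map (@derive1 R _) f s = to_spinor (fun j => x j - y j).
    rewrite /comp_map /to_spinor /comp11 /comp12 /comp21 /comp22 /f /to_spinor /= !derive1E.
    have dE j : 'D_1 (fun s => X s j) s = x j - y j by have [_ ->] := dX j s.
    have dEN j : 'D_1 (fun s => - X s j) s = - (x j - y j) by have [_ ->] := dXN j s.
    by rewrite !dE dEN.
  exact: spnorm_le_sum.
have key (G : R -> R) : (forall s, derivable G s 1) ->
    (forall s, 1 <= s <= 2 -> `|derive1 G s| <= D) -> `|G 2 - G 1| <= D.
  move=> dG hG.
  have dG' s : is_derive s (1 : R) G (derive1 G s) by rewrite derive1E; exact: derivableP.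
  have l12 : (1 : R) <= 2 by lra.
  have u1 := derive_le (c := D) l12 (fun s _ => dG' s)
    (fun s h => le_trans (ler_norm _) (hG s h)).
  have u2 := derive_le (c := D) l12 (fun s _ => is_deriveN (dG' s))
    (fun s h => le_trans (ler_norm _) (eq_ind_r (fun t => t <= D) (hG s h) (normrN _))).
  by rewrite ler_norml; move: u1 u2 => /=; rewrite -[(- G) 2]/(- G 2) -[(- G) 1]/(- G 1) => u1 u2; apply/andP; split; lra.
have f2 : f 2 = to_spinor x.
  by rewrite /f; congr to_spinor; apply/funext => j; rewrite /X; ring.
have f1 : f 1 = to_spinor y.
  by rewrite /f; congr to_spinor; apply/funext => j; rewrite /X; ring.
have c0 (c : R[i]) : 0 <= cmod c by exact: sqrtr_ge0.
have [k1r k1i] : `|complex.Re (nonlin W1 (to_spinor x)) - complex.Re (nonlin W1 (to_spinor y))| <= D /\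
    `|complex.Im (nonlin W1 (to_spinor x)) - complex.Im (nonlin W1 (to_spinor y))| <= D.
  rewrite -f1 -f2; split.
    apply: (key (fun s => complex.Re (nonlin W1 (f s)))) => [s|s s12]; first exact: cderivable_Re (cdf W1 s).
    apply: le_trans (bound s s12); have [h _] := cmod_ge (cderive1 (nonlin W1 \o f) s).
    by apply: le_trans h _; rewrite lerDl.
  apply: (key (fun s => complex.Im (nonlin W1 (f s)))) => [s|s s12]; first exact: cderivable_Im (cdf W1 s).
  apply: le_trans (bound s s12); have [_ h] := cmod_ge (cderive1 (nonlin W1 \o f) s).
  by apply: le_trans h _; rewrite lerDl.
have [k2r k2i] : `|complex.Re (nonlin W2 (to_spinor x)) - complex.Re (nonlin W2 (to_spinor y))| <= D /\
    `|complex.Im (nonlin W2 (to_spinor x)) - complex.Im (nonlin W2 (to_spinor y))| <= D.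
  rewrite -f1 -f2; split.
    apply: (key (fun s => complex.Re (nonlin W2 (f s)))) => [s|s s12]; first exact: cderivable_Re (cdf W2 s).
    apply: le_trans (bound s s12); have [h _] := cmod_ge (cderive1 (nonlin W2 \o f) s).
    by apply: le_trans h _; rewrite lerDr.
  apply: (key (fun s => complex.Im (nonlin W2 (f s)))) => [s|s s12]; first exact: cderivable_Im (cdf W2 s).
  apply: le_trans (bound s s12); have [_ h] := cmod_ge (cderive1 (nonlin W2 \o f) s).
  by apply: le_trans h _; rewrite lerDr.
have opp (a c : R) : `|a - c| <= D -> `|- a - - c| <= D by rewrite -opprD normrN.
by case: i => [[] []]; [exact: opp k2i|exact: opp k1r|exact: opp k2r|exact: k1i].
Qed.

Lemma source_le (x : idx -> R) b i : (forall j, `|x j| <= b) -> 2 * b < 1 ->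
  `|source W1 W2 x i| <= C * (2 * b) ^+ n * \sum_j `|x j|.
Proof.
move=> xb b1; have b0 : 0 <= b by exact: le_trans (xb (false, false)).
have y0 (j : idx) : `|0 : R| <= b by rewrite normr0.
have := source_lip i xb y0 b1; rewrite source0 subr0.
by under eq_bigr do rewrite subr0.
Qed.

End Nonlinearity.

(** * Pointwise decay in r and the reduced system *)

Section ReducedSystem.
Context {R : realType}.
Local Notation mu := (@lebesgue_measure R).
Local Notation H := (`]0%R, +oo[%classic : set R).
Implicit Types (a b e r t : R).

(* Average of u(r)^2 <= u(s)^2 + int |(u^2)'| over s in [r, r + 1]. *)
Lemma radial_sqr_le (u g : R -> R) r : prim u g -> sq u -> sq g -> 0 < r ->
  r * u r ^+ 2 <= 2 * N2 u + N2 g.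
Proof.
move=> pu su sg r0; have r1 : r < r + 1 by rewrite ltrDl.
set J := `[r, r + 1]%classic; have mJ : measurable J by exact: mitv.
have Iu : igr J (fun s => u s ^+ 2) by exact: igr_sqr.
have Ig : igr J (fun s => g s ^+ 2) by exact: igr_sqr.
have [IV VE] := primM pu pu.
have Ic a : igr J (fun=> a).
  by apply: (@cont_locigr R (fun=> a)) => // z z0; exact: cst_continuous.
have IVJ := igr_norm (IV r (r + 1) r0).
set c := \int[mu]_(s in J) `|g s * u s + u s * g s|.
have h1 : u r ^+ 2 <= \int[mu]_(s in J) (u s ^+ 2 + c).
  have -> : u r ^+ 2 = \int[mu]_(s in J) (u r ^+ 2).
    by rewrite /J Rint_cst_itv// [r + 1]addrC addrK mulr1.
  apply: (le_Rint mJ (Ic _) (igrD mJ Iu (Ic c))) => s; rewrite /J /= in_itv/= => /andP[rs s1].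
  have := VE r s r0 rs; rewrite -!expr2 => e1.
  have Is := IV r s r0.
  have h2 : - (\int[mu]_(x in `[r, s]) (g x * u x + u x * g x)) <= c.
    apply: le_trans (ler_norm _) _; rewrite normrN; apply: le_trans (norm_Rint_le (mitv r s) Is) _.
    apply: (le_Rint_set (mitv r s) mJ _ IVJ) => //.
    by apply: subset_itvl; rewrite bnd_simp.
  by move: h2; rewrite -e1; lra.
have h2 : c <= \int[mu]_(s in J) (u s ^+ 2 + g s ^+ 2).
  apply: (le_Rint mJ IVJ (igrD mJ Iu Ig)) => s _.
  rewrite [u s * g s]mulrC -mulr2n -mulr_natl ler_norml.
  by have := sqr_ge0 (u s - g s); have := sqr_ge0 (u s + g s) => ? ?; apply/andP; split; lra.
have h3 : \int[mu]_(s in J) (u s ^+ 2 + c) = \int[mu]_(s in J) (u s ^+ 2) + c.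
  by rewrite (RintD mJ Iu (Ic c)) /J Rint_cst_itv// [r + 1]addrC addrK mulr1.
rewrite (RintD mJ Iu Ig) in h2.
have wle (v : R -> R) : sq v -> igr J (fun s => v s ^+ 2) -> r * \int[mu]_(s in J) (v s ^+ 2) <= N2 v.
  move=> [mv Iv] IJ; rewrite -(RintZ _ mJ IJ).
  have IvJ : igr J (fun s => s * v s ^+ 2).
    by apply: igrS Iv; [exact: mJ|exact: mH|exact: itvH].
  apply: le_trans (_ : _ <= \int[mu]_(s in J) (s * v s ^+ 2)) _.
    apply: (le_Rint mJ (igrZ r mJ IJ) IvJ) => s; rewrite /J /= in_itv/= => /andP[rs _].
    by rewrite ler_wpM2r ?sqr_ge0.
  by apply: ge0_Rint_sub => // x x0; rewrite mulr_ge0 ?sqr_ge0// ltW.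
have k1 := wle u su Iu; have k2 := wle g sg Ig.
have : r * u r ^+ 2 <= r * (2 * \int[mu]_(s in J) (u s ^+ 2) + \int[mu]_(s in J) (g s ^+ 2)).
  by rewrite ler_pM2l//; move: h1 h2; rewrite h3; lra.
move: k1 k2; lra.
Qed.

(** The bound [r u^2 <= 3 e^2] of [radial_sqr_le] is added to [u^2 <= e^2], which takes over near
    the origin; the sum is [(1 + r) u^2 <= 4 e^2]. *)
Lemma radial_decay (u g : R -> R) e r : prim u g -> sq u -> sq g -> 0 <= e ->
  N2 u <= e ^+ 2 -> N2 g <= e ^+ 2 -> (forall x, 0 < x -> `|u x| <= e) -> 0 < r ->
  `|u r| <= 2 * e * Num.sqrt (wt r).
Proof.
move=> pu su sg e0 nu ng ue r0; have w0 := wt_gt0 r0.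
have b0 : 0 <= 2 * e * Num.sqrt (wt r) by rewrite mulr_ge0 ?sqrtr_ge0// mulr_ge0.
rewrite -[leRHS]ger0_norm// -[leLHS]sqrtr_sqr -[leRHS]sqrtr_sqr ler_wsqrtr//.
rewrite !exprMn sqr_sqrtr ?(ltW w0)//.
have h1 := radial_sqr_le pu su sg r0.
have h2 : u r ^+ 2 <= e ^+ 2.
  by rewrite -[u r ^+ 2]real_normK ?num_real// ler_pXn2r ?nnegrE// ue.
have h3 : (1 + r) * u r ^+ 2 <= 4 * e ^+ 2 by move: h1 h2 nu ng; lra.
have := ler_wpM2l (ltW w0) h3; rewrite mulrA [wt r * _]mulrC wtE// mul1r; lra.
Qed.

Lemma sqrtwt_le r x : 0 < r -> r <= x -> Num.sqrt (wt x) <= Num.sqrt (wt r).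
Proof.
move=> r0 rx; have x0 := lt_le_trans r0 rx.
by rewrite ler_wsqrtr// /wt lef_pV2 ?posrE ?addr_gt0// lerD2l.
Qed.

Lemma sqrtwt_le1 r : 0 < r -> Num.sqrt (wt r) <= 1.
Proof. by move=> r0; rewrite -[leRHS]sqrtr1 ler_wsqrtr// wt_le1. Qed.

Variables (k m C p e : R) (n : nat) (W1 W2 : mpoly.mpoly 4 R[i]).
Hypotheses (k1 : 1 <= k ^+ 2) (k2 : 1 <= (k + 1) ^+ 2).
Hypotheses (C0 : 0 < C) (np : n.*2.+1%:R <= p) (nm : n = if m == 0 then 2 else 3).
Hypotheses (pb : power_bound C p W1 W2) (db : derivative_bound C p W1 W2).
Hypotheses (e0 : 0 < e) (e1 : 8 * e <= 1) (ke : (kap k + `|m|) * (C * (4 * e)) * 1536 <= 1).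
Variables (u g d : R -> idx -> R -> R).
Hypotheses (pu : forall t i, prim (u t i) (g t i)) (sg : forall t i, sq (g t i)).
Hypothesis (Ld : forall t i, L2d (fun s => u s i) (d t i) t).
Hypotheses (nu : forall t i, 0 <= t -> N2 (u t i) <= e ^+ 2).
Hypotheses (ng : forall t i, 0 <= t -> N2 (g t i) <= e ^+ 2).
Hypothesis (ub : forall t i (r : R), 0 <= t -> 0 < r -> `|u t i r| <= e).
Hypothesis (eqn : forall t i, 0 <= t -> {ae mu, forall r : R, 0 < r ->
  d t i r = LL k m (u t) (g t) i r + source W1 W2 (fun j => u t j r) i}).

Let su t i : sq (u t i). Proof. by have [] := Ld t i. Qed.

(** Each unknown is at most [2 e wt^(1/2)] and the spinor norm at most twice that. The power [n.*2]
    is 4 or 6, one less than the critical exponent, and yields [wt^n]. *)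
Let N r : R := C * (2 * (2 * e * Num.sqrt (wt r))) ^+ n.*2.

Let N_le r : 0 < r -> N r <= C * (4 * e) * wt r ^+ n.
Proof.
move=> r0; have w0 := ltW (wt_gt0 r0).
rewrite /N (_ : 2 * (2 * e * Num.sqrt (wt r)) = (4 * e) * Num.sqrt (wt r)); last by ring.
have E : Num.sqrt (wt r) ^+ n.*2 = wt r ^+ n by rewrite -mul2n exprM sqr_sqrtr.
rewrite exprMn E -mulrA ler_pM2l//.
have e40 : 0 <= 4 * e by rewrite mulr_ge0// ltW.
rewrite ler_wpM2r ?exprn_ge0//.
have n0 : (0 < n.*2)%N by rewrite nm; case: ifP.
case: n.*2 n0 => // q _; rewrite exprS ler_piMr// exprn_ile1//.
by move: e1; lra.
Qed.

Let Nw r : 0 < r -> (kap k + `|m| * r) * N r <= wt r ^+ 2 / 1536.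
Proof.
move=> r0; have w0 := ltW (wt_gt0 r0); have w1 := wt_le1 r0; have rw := rwt_le1 r0.
have k0 : 0 <= kap k by exact: le_trans ler01 (kap_ge1 k).
have kr0 : 0 <= kap k + `|m| * r by rewrite addr_ge0// mulr_ge0// ltW.
have D0 : 0 <= C * (4 * e) by rewrite mulr_ge0 ?(ltW C0)// mulr_ge0 ?(ltW e0).
apply: le_trans (ler_wpM2l kr0 (N_le r0)) _.
have hw : (kap k + `|m| * r) * wt r ^+ n <= (kap k + `|m|) * wt r ^+ 2.
  rewrite nm; have [->|m0] := eqVneq m 0; first by rewrite normr0 mul0r.
  have -> : (kap k + `|m| * r) * wt r ^+ 3 = (kap k * wt r + `|m| * (r * wt r)) * wt r ^+ 2 by ring.
  by rewrite ler_wpM2r ?sqr_ge0//; apply: lerD; rewrite ler_piMr.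
have -> : (kap k + `|m| * r) * (C * (4 * e) * wt r ^+ n) = C * (4 * e) * ((kap k + `|m| * r) * wt r ^+ n).
  by ring.
apply: le_trans (ler_wpM2l D0 hw) _.
have := ler_wpM2r (sqr_ge0 (wt r)) ke; lra.
Qed.

Let N0 r : 0 < r -> 0 <= N r.
Proof.
move=> r0; have e0' := ltW e0; have q := sqrtr_ge0 (wt r).
by rewrite /N mulr_ge0 ?(ltW C0)// exprn_ge0//; pos.
Qed.

Let ur t i r x : 0 <= t -> 0 < r -> r <= x -> `|u t i x| <= 2 * e * Num.sqrt (wt r).
Proof.
move=> t0 r0 rx; have x0 := lt_le_trans r0 rx.
apply: le_trans (radial_decay (pu t i) (su t i) (sg t i) (ltW e0) (nu i t0) (ng i t0) _ x0) _.
  by move=> y; exact: ub.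
by rewrite ler_pM2l ?mulr_gt0// sqrtwt_le.
Qed.

Let b1 r : 0 < r -> 2 * (2 * e * Num.sqrt (wt r)) < 1.
Proof.
move=> r0; have h := sqrtwt_le1 r0; have h0 := sqrtr_ge0 (wt r).
have : e * Num.sqrt (wt r) <= e * 1 by rewrite ler_pM2l.
by move: e1 e0; lra.
Qed.

Let w t i r : R := source W1 W2 (fun j => u t j r) i.

Let cw t i r : 0 <= t -> 0 < r -> {for r, continuous (w t i)}.
Proof.
move=> t0 r0; apply/subr_cvg0; apply/norm_cvg0P.
have e2 : 2 * e < 1 by move: e1 e0; lra.
pose S y : R := C * (2 * e) ^+ n.*2 * \sum_j `|u t j y - u t j r|.
have cS : S y @[y --> r] --> 0.
  have cj j : `|u t j y - u t j r| @[y --> r] --> 0.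
    by apply/norm_cvg0P/subr_cvg0; exact: prim_cont (pu t j) r r0.
  pose a j y : R := `|u t j y - u t j r|.
  have SE : S = (fun y => C * (2 * e) ^+ n.*2 * (a (false, false) y + a (false, true) y
      + (a (true, false) y + a (true, true) y))) by apply/funext => y; rewrite /S sum_idx.
  have cs : (fun y => C * (2 * e) ^+ n.*2 * (a (false, false) y + a (false, true) y
      + (a (true, false) y + a (true, true) y))) @ r --> C * (2 * e) ^+ n.*2 * (0 + 0 + (0 + 0)).
    by apply: cvgM; [exact: cvg_cst|apply: cvgD; apply: cvgD; exact: cj].
  by rewrite !addr0 mulr0 in cs; rewrite SE.
apply: (@squeeze_cvgr _ _ _ _ (fun=> 0) S); [|exact: cvg_cst|exact: cS].
near=> y; rewrite normr_ge0/=.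
have y0 : 0 < y by near: y; exact: near_gt.
by apply: (source_lip C0 np db) => // j; exact: ub.
Unshelve. all: by end_near. Qed.

Lemma reduced_decay :
  \sum_i ip (fun r => wt r ^+ 2 * u t i r) (fun r => wt r ^+ 2 * u t i r) @[t --> +oo] --> 0.
Proof.
have e21 : e ^+ 2 <= 1 by rewrite exprn_ile1 ?(ltW e0)//; move: e1 e0; lra.
apply: (local_energy_decay k1 k2 pu sg Ld _ _ _ cw N0 Nw _ _ eqn).
- by move=> t i t0; apply: le_trans e21; exact: nu.
- by move=> t i t0; apply: le_trans e21; exact: ng.
- by move=> t i r t0 r0; apply: le_trans (ub i t0 r0) _; move: e1 e0; lra.
- move=> t i r x y t0 r0 rx ry.
  rewrite /w /N; by apply: (source_lip C0 np db i _ _ (b1 r0)) => j; exact: ur.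
- move=> t i r x t0 r0 rx.
  rewrite /w /N; by apply: (source_le C0 np pb db i _ (b1 r0)) => j; exact: ur.
Qed.

End ReducedSystem.

(** * Spinors and their real components *)

Section Spinors.
Context {R : realType}.
Local Notation mu := (@lebesgue_measure R).
Local Notation H := (`]0%R, +oo[%classic : set R).
Implicit Types (a b e r t : R) (f : R -> spinor R).
Local Open Scope complex_scope.

Lemma spnorm_sqr (z : spinor R) : spnorm z ^+ 2 = \sum_i real_coord z i ^+ 2.
Proof.
rewrite -[in LHS](real_coordK z) spnormE sqr_sqrtr//.
by apply: sumr_ge0 => i _; exact: sqr_ge0.
Qed.

Lemma real_coord_le (z : spinor R) i : `|real_coord z i| <= spnorm z.
Proof.
rewrite -[leRHS]ger0_norm ?sqrtr_ge0// -[leLHS]sqrtr_sqr -[leRHS]sqrtr_sqr ler_wsqrtr//.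
by rewrite spnorm_sqr; apply: (le_sum1 (F := fun j => real_coord z j ^+ 2)) => j; exact: sqr_ge0.
Qed.

Lemma real_coord_meas (A : set R) f : forall_comp (measurable_fun A) f ->
  forall i, measurable_fun A (fun r => real_coord (f r) i).
Proof.
move=> [m11 m12 m21 m22] [[] []] //=.
by have := measurableT_comp (@oppr_measurable R setT) m21.
Qed.

Lemma spnorm_meas (A : set R) f : measurable A -> forall_comp (measurable_fun A) f ->
  measurable_fun A (fun r => spnorm (f r) ^+ 2 * r).
Proof.
move=> mA mf; apply: measurable_funM => //.
under eq_fun do rewrite spnorm_sqr sum_idx.
have mc i : measurable_fun A (fun r => real_coord (f r) i ^+ 2).
  by apply: measurable_funX; exact: real_coord_meas.
by apply: measurable_funD; apply: measurable_funD.
Qed.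

Lemma sq_dom (v Q : R -> R) b : measurable_fun H v -> measurable_fun H Q ->
  (forall r, 0 < r -> r * v r ^+ 2 <= Q r) ->
  (\int[mu]_(r in H) (Q r)%:E <= b%:E)%E -> sq v /\ N2 v <= b.
Proof.
move=> mv mQ vQ Qb; have mHR := mH (R := R).
have mv2 := measurable_wsq mv.
have v0 r : 0 < r -> 0 <= r * v r ^+ 2 by move=> r0; rewrite mulr_ge0 ?sqr_ge0// ltW.
have Ib : (\int[mu]_(r in H) (r * v r ^+ 2)%:E <= b%:E)%E.
  apply: le_trans Qb; apply: ge0_le_integral => //.
  - by move=> r; rewrite inH lee_fin; exact: v0.
  - exact/measurable_EFinP.
  - exact/measurable_EFinP.
  - by move=> r; rewrite inH lee_fin; exact: vQ.
have I : igr H (fun r => r * v r ^+ 2).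
  apply/integrableP; split; first exact/measurable_EFinP.
  apply: le_lt_trans (ltry b); apply: le_trans Ib.
  apply: ge0_le_integral => //.
  - by apply/measurable_EFinP; exact: measurableT_comp.
  - exact/measurable_EFinP.
  - by move=> r; rewrite inH => r0; rewrite /= lee_fin ger0_norm ?v0.
by split; [split|rewrite -lee_fin EFin_Rint].
Qed.

Lemma sqrte_le (X : \bar R) e : 0 <= e -> (sqrte X <= e%:E)%E -> (X <= (e ^+ 2)%:E)%E.
Proof.
move=> e0; have -> : e%:E = sqrte (e ^+ 2)%:E by rewrite /= sqrtr_sqr ger0_norm.
by rewrite lee_sqrt// lee_fin sqr_ge0.
Qed.

Lemma L2norm_sq f e i : forall_comp (measurable_fun H) f -> 0 <= e ->
  (L2norm H f <= e%:E)%E ->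
  sq (fun r => real_coord (f r) i) /\ N2 (fun r => real_coord (f r) i) <= e ^+ 2.
Proof.
move=> mf e0 fe; apply: (@sq_dom _ (fun r => spnorm (f r) ^+ 2 * r)).
- exact: real_coord_meas.
- exact: spnorm_meas.
- move=> r r0; rewrite mulrC ler_pM2r// spnorm_sqr.
  by apply: (le_sum1 (F := fun j => real_coord (f r) j ^+ 2)) => j; exact: sqr_ge0.
- exact: sqrte_le.
Qed.

Lemma fin_bound (X : \bar R) : (0 <= X)%E -> (X < +oo)%E -> exists2 e : R, 0 <= e & X = e%:E.
Proof. by case: X => [r||] //; rewrite lee_fin => r0 _; exists r. Qed.

Lemma in_L2_sq f i : in_L2 f -> sq (fun r => real_coord (f r) i).
Proof.
move=> [mf fy]; have [e e0 fe] := fin_bound (sqrte_ge0 _) fy.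
have fe' : (L2norm H f <= e%:E)%E by rewrite /L2norm fe.
by have [] := L2norm_sq i mf e0 fe'.
Qed.

Lemma wderivP (u : R -> R) : weakly_derivable u -> is_weak_derivative u (wderiv u).
Proof. exact: xgetPex. Qed.

Definition weak_gradient f := comp_map wderiv f.

Lemma weak_gradient_meas f : forall_comp weakly_derivable f -> forall_comp (measurable_fun H) (weak_gradient f).
Proof.
move=> [w1 w2 w3 w4].
have mw u : weakly_derivable u -> measurable_fun H (wderiv u).
  by move=> /wderivP [_ [? _ _] _].
by split; rewrite /comp11 /comp12 /comp21 /comp22 /weak_gradient /comp_map /=; exact: mw.
Qed.

Lemma H1norm_sq f e i : in_H1 f -> 0 <= e -> (H1norm f <= e%:E)%E ->
  [/\ sq (fun r => real_coord (f r) i), N2 (fun r => real_coord (f r) i) <= e ^+ 2,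
      sq (fun r => real_coord (weak_gradient f r) i) & N2 (fun r => real_coord (weak_gradient f r) i) <= e ^+ 2].
Proof.
move=> [[mf _] wf _] e0 fe; have mwf := weak_gradient_meas wf.
pose Q r := (spnorm (comp_map wderiv f r) ^+ 2 + spnorm (f r) ^+ 2) * r.
have mQ : measurable_fun H Q.
  have -> : Q = (fun r => spnorm (weak_gradient f r) ^+ 2 * r + spnorm (f r) ^+ 2 * r).
    by apply/funext => r; rewrite /Q mulrDl.
  by apply: measurable_funD; exact: spnorm_meas.
have Qe : (\int[mu]_(r in H) (Q r)%:E <= (e ^+ 2)%:E)%E by exact: sqrte_le.
have le1 z j : real_coord z j ^+ 2 <= spnorm z ^+ 2 :> R.
  by rewrite spnorm_sqr; apply: (le_sum1 (F := fun j => real_coord z j ^+ 2)) => l; exact: sqr_ge0.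
have [s1 n1] : sq (fun r => real_coord (f r) i) /\ N2 (fun r => real_coord (f r) i) <= e ^+ 2.
  apply: (sq_dom _ mQ _ Qe); first exact: real_coord_meas.
  move=> r r0; rewrite /Q mulrC ler_pM2r//; apply: le_trans (le1 _ _) _.
  by rewrite lerDr sqr_ge0.
have [s2 n2] : sq (fun r => real_coord (weak_gradient f r) i) /\ N2 (fun r => real_coord (weak_gradient f r) i) <= e ^+ 2.
  apply: (sq_dom _ mQ _ Qe); first exact: real_coord_meas.
  move=> r r0; rewrite /Q mulrC ler_pM2r//; apply: le_trans (le1 _ _) _.
  by rewrite lerDl sqr_ge0.
by [].
Qed.

Lemma in_H1_sq f i : in_H1 f -> sq (fun r => real_coord (weak_gradient f r) i).
Proof.
move=> hf; have [_ _ fy] := hf; have [e e0 fe] := fin_bound (sqrte_ge0 _) fy.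
have fe' : (H1norm f <= e%:E)%E by rewrite /H1norm fe.
by have [] := H1norm_sq i hf e0 fe'.
Qed.

Lemma in_H1_prim f i : in_H1 f -> exists U : R -> R, prim U (fun r => real_coord (weak_gradient f r) i) /\
  {ae mu, forall r : R, 0 < r -> real_coord (f r) i = U r}.
Proof.
move=> [_ [w1 w2 w3 w4] _]; case: i => [[] []] /=.
- have [U pU uU] := weak_derivative_prim (wderivP w3).
  exists (fun r => -1 * U r); split.
    by apply: prim_ext (primZ (-1) pU) => x x0 //; rewrite mulN1r.
  by apply: aeS uU => r hr r0; rewrite -hr// mulN1r.
- by have [U pU uU] := weak_derivative_prim (wderivP w2); exists U.
- by have [U pU uU] := weak_derivative_prim (wderivP w4); exists U.
- by have [U pU uU] := weak_derivative_prim (wderivP w1); exists U.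
Qed.

(** Smallness is assumed for the sum of the two norms; it bounds the H^1 norm alone because the
    essential supremum is nonnegative. *)
Lemma Linfnorm_ge0 f : (0 <= Linfnorm f)%E.
Proof.
apply: ess_sup_gee.
  have h : (0 < mu (`[0%R, 1%R]%classic : set R))%E.
    by rewrite lebesgue_measure_itv/= lte_fin ltr01 sube0 lte_fin.
  by apply: lt_le_trans h _; apply: le_measure; rewrite ?inE.
by apply: aeW => r; rewrite patchE lee_fin; case: ifP => // _ /=; exact: sqrtr_ge0.
Qed.

Lemma Linfnorm_le f e i : (Linfnorm f <= e%:E)%E ->
  {ae mu, forall r : R, 0 < r -> `|real_coord (f r) i| <= e}.
Proof.
move=> /ess_supP h; apply: aeS h => r; rewrite lee_fin => hr r0.
apply: le_trans (real_coord_le _ _) _; move: hr; rewrite patchE.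
by rewrite mem_set// inH.
Qed.

Lemma small_norms eps (phi : R -> R -> spinor R) t : small eps phi -> 0 <= t ->
  (H1norm (phi t) <= eps%:E)%E /\ (Linfnorm (phi t) <= eps%:E)%E.
Proof.
move=> sm t0.
have h : (H1Linfnorm (phi t) <= eps%:E)%E.
  apply: le_trans (ltW sm); apply: ereal_sup_ubound.
  by exists t => //=; rewrite in_itv/= t0.
split; apply: le_trans h; first by rewrite leeDl// Linfnorm_ge0.
by rewrite leeDr// sqrte_ge0.
Qed.

Lemma real_coord_diff h (z z' y : spinor R) i :
  real_coord (spscale h%:C (z - z') - y) i = h * (real_coord z i - real_coord z' i) - real_coord y i.
Proof.
case: z z' y => [[a1 a2] [a3 a4]] [[b1 b2] [b3 b4]] [[c1 c2] [c3 c4]].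
by case: i => [[] []] /=; ring.
Qed.

End Spinors.

(** * Radial solutions *)

Section Solutions.
Context {R : realType}.
Local Notation mu := (@lebesgue_measure R).
Local Notation H := (`]0%R, +oo[%classic : set R).
Implicit Types (a b e h r t : R).
Local Open Scope complex_scope.

(** The curves [u] are representatives of the coordinates of [phi], equal to them almost everywhere
    at each time; [N2] does not see the difference, so the derivative in L^2 is inherited. *)
Lemma C1_L2d (phi dphi : R -> R -> spinor R) (u : R -> idx -> R -> R) t i : C1_in_L2 phi dphi ->
  (forall s j, sq (u s j)) ->
  (forall s j, {ae mu, forall r : R, 0 < r -> real_coord (phi s r) j = u s j r}) ->
  L2d (fun s => u s i) (fun r => real_coord (dphi t r) i) t.
Proof.
move=> [pL2 [dL2 _] cphi] su pu; have sd := in_L2_sq i (dL2 t).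
split=> [s||]; [exact: su|exact: sd|].
pose D h r : spinor R := spscale (h^-1)%:C (phi (t + h) r - phi t r) - dphi t r.
have sD h : sq (fun r => h^-1 * (u (t + h) i r - u t i r) - real_coord (dphi t r) i).
  by apply: sqB => //; apply: sqZ; exact: sqB.
have cD h r j : real_coord (D h r) j = h^-1 * (real_coord (phi (t + h) r) j - real_coord (phi t r) j)
    - real_coord (dphi t r) j by exact: real_coord_diff.
have mD h : forall_comp (measurable_fun H) (D h).
  have mc j : measurable_fun H (fun r => real_coord (D h r) j).
    rewrite (_ : (fun r => _) = (fun r => h^-1 * (real_coord (phi (t + h) r) j - real_coord (phi t r) j)
      - real_coord (dphi t r) j)); last by apply/funext => r; rewrite cD.
    have mp s : measurable_fun H (fun r => real_coord (phi s r) j) by case: (in_L2_sq j (pL2 s)).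
    apply: measurable_funB; last by case: (in_L2_sq j (dL2 t)).
    by apply: measurable_funM => //; exact: measurable_funB.
  split; rewrite /comp11 /comp12 /comp21 /comp22.
  - exact: (mc (false, false)).
  - exact: (mc (true, false)).
  - rewrite (_ : (fun r => _) = (fun r => - real_coord (D h r) (true, true))).
      by have := measurableT_comp (@oppr_measurable R setT) (mc (true, true)).
    by apply/funext => r /=; rewrite opprK.
  - exact: (mc (false, true)).
have ND h : N2 (fun r => h^-1 * (u (t + h) i r - u t i r) - real_coord (dphi t r) i) =
    N2 (fun r => real_coord (D h r) i).
  rewrite /N2; apply: (ae_eq_Rint (mH (R := R))).
  - by apply: measurable_wsq; case: (sD h).
  - by apply: measurable_wsq; exact: real_coord_meas.
  - apply: aeS2 (pu (t + h) i) (pu t i) => r h1 h2; rewrite inH => r0.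
    by rewrite cD h1// h2.
(* [N2] is a squared norm, hence the threshold [sqrt e] for the norm of the difference quotient. *)
apply/cvgrPdist_le => e e0; have q0 : 0 < Num.sqrt e by rewrite sqrtr_gt0.
have /fine_cvgP[fin /cvgrPdist_le/(_ _ q0) hq] := cphi t.
near=> h; rewrite sub0r normrN ger0_norm ?N2_ge0// ND.
have fh : L2norm H (D h) \is a fin_num by near: h; exact: fin.
have qh : `|0 - fine (L2norm H (D h))| <= Num.sqrt e by near: h; exact: hq.
have Lh : (L2norm H (D h) <= (Num.sqrt e)%:E)%E.
  rewrite -(fineK fh) lee_fin; move: qh; rewrite sub0r normrN.
  by apply: le_trans; exact: ler_norm.
have [_] := L2norm_sq i (mD h) (ltW q0) Lh.
by rewrite sqr_sqrtr// ltW.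
Unshelve. all: by end_near. Qed.

Lemma real_system m (S : int) W1 W2 (z dt dr : spinor R) r : 0 < r ->
  'i * dt.1 = (dr.2 + ((S + 1)%:~R / r)%:C * z.2) - m%:C * z.1 + nonlin W1 z ->
  'i * dt.2 = - (dr.1 - (S%:~R / r)%:C * z.1) + m%:C * z.2 + nonlin W2 z ->
  forall i, real_coord dt i =
    LL S%:~R m (fun j _ => real_coord z j) (fun j _ => real_coord dr j) i r
    + source W1 W2 (real_coord z) i.
Proof.
move=> r0; rewrite rmorphD /= => E1 E2 i; rewrite /source real_coordK.
have R1 := congr1 (@complex.Re R) E1; have I1 := congr1 (@complex.Im R) E1.
have R2 := congr1 (@complex.Re R) E2; have I2 := congr1 (@complex.Im R) E2.
move: R1 I1 R2 I2 {E1 E2}.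
case: z => [[z1 z2] [z3 z4]]; case: dt => [[a1 a2] [a3 a4]]; case: dr => [[b1 b2] [b3 b4]] /=.
case: (nonlin W1 _) => [v1 v2]; case: (nonlin W2 _) => [v3 v4] /= R1 I1 R2 I2.
case: i => [[] []]; rewrite /LL /sgn /cc /=; lra.
Qed.

Lemma cis_norm (a : R) (z : spinor R) : spnorm (spscale (cis a) z) = spnorm z.
Proof.
rewrite /spnorm; congr Num.sqrt; case: z => [[z1 z2] [z3 z4]] /=.
have := cos2Dsin2 a; move: (cos a) (sin a) => c s E.
transitivity ((c ^+ 2 + s ^+ 2) * (z1 ^+ 2 + z2 ^+ 2 + z3 ^+ 2 + z4 ^+ 2)); first by ring.
by rewrite E mul1r.
Qed.

Lemma itv0H (rho : R) : `]0, rho[%classic `<=` H.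
Proof. by move=> r; rewrite inH /= in_itv/= => /andP[]. Qed.

Lemma L2norm_ae_eq (rho : R) (f g : R -> spinor R) : in_L2 f -> in_L2 g ->
  {ae mu, forall r, 0 < r < rho -> spnorm (f r) = spnorm (g r)} ->
  L2norm `]0, rho[%classic f = L2norm `]0, rho[%classic g.
Proof.
move=> [mf _] [mg _] fg; congr sqrte.
have ms (f' : R -> spinor R) : forall_comp (measurable_fun H) f' ->
    measurable_fun `]0, rho[%classic (fun r => (spnorm (f' r) ^+ 2 * r)%:E).
  move=> mf'; apply/measurable_EFinP; apply: measurable_funS (spnorm_meas (mH (R := R)) mf').
    exact: mH.
  exact: itv0H.
apply: ae_eq_integral; [exact: measurable_itv|exact: ms|exact: ms|].
by apply: aeS fg => r fg rr; rewrite fg//; move: rr; rewrite /= in_itv.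
Qed.

Lemma L2norm_eq0 (rho : R) (f : R -> spinor R) : in_L2 f ->
  L2norm `]0, rho[%classic f = 0%E -> {ae mu, forall r, 0 < r < rho -> spnorm (f r) = 0}.
Proof.
move=> [mf _] f0.
have F0 r : `]0, rho[%classic r -> 0 <= spnorm (f r) ^+ 2 * r.
  by move=> /itv0H; rewrite inH => r0; rewrite mulr_ge0 ?sqr_ge0// ltW.
have mF : measurable_fun `]0, rho[%classic (fun r => (spnorm (f r) ^+ 2 * r)%:E).
  apply/measurable_EFinP; apply: measurable_funS (spnorm_meas (mH (R := R)) mf).
    exact: mH.
  exact: itv0H.
have I0 : (\int[mu]_(r in (`]0%R, rho[%classic : set R)) (spnorm (f r) ^+ 2 * r)%:E = 0)%E.
  apply/eqP; rewrite eq_le; apply/andP; split; last by apply: integral_ge0 => r rr; rewrite lee_fin F0.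
  have := @sqrte_le R (\int[mu]_(r in (`]0%R, rho[%classic : set R)) (spnorm (f r) ^+ 2 * r)%:E)%E 0 (lexx 0).
  by rewrite expr0n/=; apply; rewrite -/(L2norm _ f) f0.
have Ia : (\int[mu]_(r in (`]0%R, rho[%classic : set R)) `|(spnorm (f r) ^+ 2 * r)%:E| = 0)%E.
  rewrite -[RHS]I0; apply: eq_integral => r; rewrite inE => rr.
  by rewrite gee0_abs// lee_fin F0.
have mI : measurable (`]0, rho[%classic : set R) by exact: measurable_itv.
have := (ae_eq_integral_abs mu mI mF).1 Ia; apply: aeS => r hr rr.
have := hr; rewrite /= in_itv/= => /(_ rr)[/eqP].
by rewrite mulf_eq0 expf_eq0/= [X in _ || X]gt_eqF ?orbF; [move/eqP|case/andP: rr].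
Qed.

Lemma spnorm_eq0 (z : spinor R) : spnorm z = 0 -> z = 0.
Proof.
move=> z0; rewrite -[LHS]real_coordK.
have c0 i : real_coord z i = 0 by apply/eqP; rewrite -normr_le0 -z0 real_coord_le.
by rewrite /to_spinor !c0 oppr0.
Qed.

(** * Local decay of small radial solutions *)

Section Decay.
Variables (m : R) (S : int) (W1 W2 : mpoly.mpoly 4 R[i]) (C p e : R).
Hypotheses (hS0 : S != 0) (hS1 : S != -1) (C0 : 0 < C) (cp : critical_power m <= p).
Hypotheses (pb : power_bound C p W1 W2) (db : derivative_bound C p W1 W2).
Hypotheses (e0 : 0 < e) (e1 : 8 * e <= 1).
Hypothesis (ke : (kap S%:~R + `|m|) * (C * (4 * e)) * 1536 <= 1).

Let k : R := S%:~R.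

(** The square of a nonzero integer is at least 1: the exclusion of [S = 0] enters here, that of
    [S = -1] in [k2], and both feed [coercive_coeff]. *)
Let k1 : 1 <= k ^+ 2.
Proof. by rewrite /k -rmorphXn /= ler1z -gtz0_ge1 exprn_even_gt0. Qed.

Let k2 : 1 <= (k + 1) ^+ 2.
Proof.
have -> : k + 1 = (S + 1)%:~R by rewrite rmorphD.
by rewrite -rmorphXn /= ler1z -gtz0_ge1 exprn_even_gt0//= addr_eq0.
Qed.

Let n : nat := if m == 0 then 2 else 3.

Let np : n.*2.+1%:R <= p.
Proof. by move: cp; rewrite /critical_power /n; case: ifP. Qed.

Variable (phi : R -> R -> spinor R).
Hypotheses (gl : radial_global_solution m S W1 W2 phi) (sm : small e phi).

(** On []0, rho[] the decreasing weight [wt] is at least [wt rho], so the squared local norm is at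
    most [wt rho ^- 4] times the energy that tends to 0 by [reduced_decay]. *)
Lemma local_decay (rho : R) : 0 < rho ->
  L2norm `]0, rho[%classic (phi t) @[t --> +oo] --> 0%E.
Proof.
move=> rho0; have [[hH1 _] [dphi [hC1 hD]]] := gl.
(* Continuous representatives of all coordinates at all times, chosen at once. *)
have [U hU] := choice (fun ti : R * idx => in_H1_prim ti.2 (hH1 ti.1)).
pose u t i := U (t, i); pose g t i r := real_coord (weak_gradient (phi t) r) i.
have pu t i : prim (u t i) (g t i) by have [] := hU (t, i).
have ue t i : {ae mu, forall r : R, 0 < r -> real_coord (phi t r) i = u t i r} by have [] := hU (t, i).
have mHR := mH (R := R).
have mphi t : forall_comp (measurable_fun H) (phi t) by have [[]] := hH1 t.
have N2u t i : sq (fun r => real_coord (phi t r) i) ->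
    sq (u t i) /\ N2 (u t i) = N2 (fun r => real_coord (phi t r) i).
  move=> [mc Ic]; have mu' := prim_meas (pu t i).
  have E : {ae mu, forall r : R, H r -> r * real_coord (phi t r) i ^+ 2 = r * u t i r ^+ 2}.
    by apply: aeS (ue t i) => r hr; rewrite inH => r0; rewrite hr.
  split; first by split=> //; apply: igr_ae_eq E Ic => //; exact: measurable_wsq.
  by apply/esym; apply: ae_eq_Rint E => //; exact: measurable_wsq.
have L2phi t : in_L2 (phi t) by have [] := hH1 t.
have su t i : sq (u t i) by have [] := N2u t i (in_L2_sq i (L2phi t)).
have sg t i : sq (g t i) by exact: in_H1_sq.
have Ld t i := C1_L2d t i hC1 su ue.
have nb t i : 0 <= t -> N2 (u t i) <= e ^+ 2 /\ N2 (g t i) <= e ^+ 2.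
  move=> t0; have [h1 _] := small_norms sm t0.
  have [s1 n1 s2 n2] := H1norm_sq i (hH1 t) (ltW e0) h1.
  by have [_ ->] := N2u t i s1.
(* The essential bound becomes a bound at every radius, by continuity of the representative. *)
have ub t i r : 0 <= t -> 0 < r -> `|u t i r| <= e.
  move=> t0 r0; have [_ h1] := small_norms sm t0.
  have cu := prim_cont (pu t i).
  have ae_u : {ae mu, forall x : R, 0 < x -> `|u t i x| <= e}.
    by apply: aeS2 (ue t i) (Linfnorm_le i h1) => x h2 h3 x0; rewrite -h2// h3.
  have cuN (x : R) : 0 < x -> {for x, continuous (fun y => - u t i y)}.
    by move=> x0; apply: cvgN; exact: cu x x0.
  have ae1 : {ae mu, forall x : R, 0 < x -> - u t i x <= e}.
    by apply: aeS ae_u => x h2 x0; apply: le_trans (h2 x0); rewrite -normrN ler_norm.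
  have ae2 : {ae mu, forall x : R, 0 < x -> u t i x <= e}.
    by apply: aeS ae_u => x h2 x0; apply: le_trans (h2 x0); exact: ler_norm.
  by rewrite ler_norml lerNl (cont_ae_le cuN ae1 r0) (cont_ae_le cu ae2 r0).
have eqn t i : 0 <= t -> {ae mu, forall r : R, 0 < r ->
    real_coord (dphi t r) i = LL k m (u t) (g t) i r + source W1 W2 (fun j => u t j r) i}.
  move=> _.
  apply: aeS2 (hD t) (ae_idx (ue t)) => r hr hu r0; have [E1 E2] := hr r0.
  have uE j : real_coord (phi t r) j = u t j r by exact: hu.
  have -> : (fun j => u t j r) = real_coord (phi t r) by apply/funext => j; rewrite uE.
  by rewrite (real_system r0 E1 E2 i) /LL !uE.
have nbu t i : 0 <= t -> N2 (u t i) <= e ^+ 2 by move=> t0; have [] := nb t i t0.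
have nbg t i : 0 <= t -> N2 (g t i) <= e ^+ 2 by move=> t0; have [] := nb t i t0.
have key := @reduced_decay R k m C p e n W1 W2 k1 k2 C0 np erefl pb db e0 e1 ke u g _ pu sg Ld nbu nbg ub eqn.
set be := (fun t => \sum_i _) in key.
have W0 : 0 < wt rho by exact: wt_gt0.
pose B t := Num.sqrt (wt rho ^- 4 * be t).
have cB : (B t)%:E @[t --> +oo] --> 0%E.
  apply: cvg_EFin; first by apply: nearW.
  have : wt rho ^- 4 * be t @[t --> +oo] --> 0.
    by rewrite -[X in _ --> X](mulr0 (wt rho ^- 4)); apply: cvgM; [exact: cvg_cst|exact: key].
  move=> cb; rewrite -[X in _ --> X]sqrtr0; apply: continuous_cvg => //; exact: sqrt_continuous.
apply: (squeeze_cvge _ (cvg_cst 0%E) cB).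
apply: nearW => t; apply/andP; split; first exact: sqrte_ge0.
have be0 : 0 <= be t.
  apply: sumr_ge0 => i _; apply: Rintegral_ge0 => r; rewrite inH => r0.
  by rewrite -expr2 mulr_ge0 ?sqr_ge0// ltW.
have W4 : 0 <= wt rho ^- 4 by rewrite invr_ge0 exprn_ge0 ?(ltW W0).
have -> : (B t)%:E = sqrte (wt rho ^- 4 * be t)%:E by [].
rewrite lee_sqrt ?lee_fin ?mulr_ge0//.
pose q i r := wt r ^+ 2 * u t i r.
have sq2 i : sq (q i).
  apply: (sqM (M := 1) _ _ (su t i)).1; first by apply: measurable_funX; exact: meas_wt.
  move=> r r0; rewrite ger0_norm ?sqr_ge0// exprn_ile1 ?wt_le1//; exact: ltW (wt_gt0 r0).
have Iq i : igr H (fun r => r * (q i r * q i r)) by exact: sq_prod.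
have Is := igr_sum (index_enum idx) mHR Iq.
have -> : (wt rho ^- 4 * be t)%:E =
    (\int[mu]_(r in H) (wt rho ^- 4 * \sum_i r * (q i r * q i r))%:E)%E.
  rewrite -(EFin_Rint mHR (igrZ _ mHR Is)) (RintZ _ mHR Is) (Rint_sum _ mHR Iq).
  by [].
have F0 r : H r -> (0%R <= (wt rho ^- 4 * \sum_i r * (q i r * q i r))%:E)%E.
  rewrite inH => r0; rewrite lee_fin mulr_ge0// sumr_ge0// => i _.
  by rewrite mulr_ge0 ?(ltW r0)// -expr2 sqr_ge0.
have mF : measurable_fun H (fun r => (wt rho ^- 4 * \sum_i r * (q i r * q i r))%:E).
  by apply/measurable_EFinP; exact: igr_meas (igrZ _ mHR Is).
have mI : measurable (`]0, rho[%classic : set R) by exact: measurable_itv.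
apply: le_trans (_ : _ <= \int[mu]_(r in (`]0%R, rho[%classic : set R)) (wt rho ^- 4 * \sum_i r * (q i r * q i r))%:E)%E _.
  apply: ae_ge0_le_integral => //.
  - move=> r /itv0H; rewrite inH => r0.
    by rewrite lee_fin mulr_ge0 ?sqr_ge0// ltW.
  - apply/measurable_EFinP; apply: measurable_funS (spnorm_meas mHR (mphi t)) => //.
    exact: itv0H.
  - by move=> r /itv0H; exact: F0.
  - by apply: measurable_funS mF => //; exact: itv0H.
  apply: aeS (ae_idx (ue t)) => r hu rr; have r0 : 0 < r by have := itv0H rr; rewrite inH.
  have rrho : r <= rho by move: rr; rewrite /= in_itv/= => /andP[_ /ltW].
  have uE j : real_coord (phi t r) j = u t j r by exact: hu.
  rewrite lee_fin spnorm_sqr mulr_suml mulr_sumr; apply: ler_sum => j _.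
  rewrite uE /q.
  have -> : wt rho ^- 4 * (r * (wt r ^+ 2 * u t j r * (wt r ^+ 2 * u t j r))) =
     (wt r / wt rho) ^+ 4 * (u t j r ^+ 2 * r) by field; rewrite gt_eqF.
  apply: ler_peMl; first by rewrite mulr_ge0 ?sqr_ge0 ?(ltW r0).
  rewrite exprn_ege1// ler_pdivlMr// mul1r.
  by rewrite /wt lef_pV2 ?posrE ?addr_gt0// lerD2l.
apply: ge0_subset_integral => //; exact: itv0H.
Qed.

End Decay.

(** The number 6144 is 4 times 1536, so that the last bound is the smallness condition required of
    the nonlinearity. *)
Lemma small_parameter (K : R) : 0 <= K ->
  exists eps : R, [/\ 0 < eps, 8 * eps <= 1 & 6144 * (eps * K) <= 1].
Proof.
move=> K0; have d0 : 0 < 8 + 6144 * K by lra.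
have h (x : R) : x <= 8 + 6144 * K -> x * (8 + 6144 * K)^-1 <= 1 by move=> xd; rewrite ler_pdivrMr ?mul1r.
exists (8 + 6144 * K)^-1; split; first by rewrite invr_gt0.
  by apply: h; lra.
by rewrite [_^-1 * K]mulrC mulrA; apply: h; lra.
Qed.

End Solutions.

(** * Decay, and absence of small solitons and breathers *)

Theorem theorem1p2 (R : realType) (m : R) (S : int)
    (W1 W2 : mpoly.mpoly 4 R[i])
    (hS0 : S != 0) (hS1 : S != -1)
    (hgauge : gauge_property S W1 W2)
    (hbound : exists C p : R,
      [/\ 0 < C, critical_power m <= p, power_bound C p W1 W2 &
          derivative_bound C p W1 W2]) :
  exists eps : R, 0 < eps /\
    [/\ forall phi : R -> R -> spinor R,
          radial_global_solution m S W1 W2 phi -> small eps phi ->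
          forall rho : R, 0 < rho ->
            L2norm `]0, rho[%classic (phi t) @[t --> +oo] --> 0%E,
        forall rho : R, 0 < rho ->
          ~ exists phi : R -> R -> spinor R,
              [/\ radial_global_solution m S W1 W2 phi, small eps phi &
                  standing_soliton_in_ball rho phi] &
        forall rho : R, 0 < rho ->
          ~ exists phi : R -> R -> spinor R,
              [/\ radial_global_solution m S W1 W2 phi, small eps phi &
                  breather_in_ball rho phi]].
Proof.
have [C [p [C0 cp pb db]]] := hbound.
have kp := kap_ge1 (S%:~R : R); have m0 := normr_ge0 m.
have K0 : 0 <= (kap (S%:~R : R) + `|m|) * C.
  by rewrite mulr_ge0 ?(ltW C0)// addr_ge0// (le_trans ler01).
have [eps [e0 e1 ke]] := small_parameter K0.
have {}ke : (kap (S%:~R : R) + `|m|) * (C * (4 * eps)) * 1536 <= 1.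
  by apply: le_trans ke; rewrite le_eqVlt; apply/orP; left; apply/eqP; ring.
exists eps; split=> //.
have decay phi : radial_global_solution m S W1 W2 phi -> small eps phi ->
    forall rho : R, 0 < rho -> L2norm `]0, rho[%classic (phi t) @[t --> +oo] --> 0%E.
  by move=> gl sm rho; exact: (local_decay hS0 hS1 C0 cp pb db e0 e1 ke gl sm).
split=> // rho rho0 [phi [gl sm]].
  move=> [omega [Q [Qn0 hQ]]]; apply: Qn0.
  have L2phi t : in_L2 (phi t) by have [[h _] _] := gl; have [] := h t.
  have nQ t : {ae lebesgue_measure, forall r, 0 < r < rho -> spnorm (phi t r) = spnorm (Q r)}.
    by apply: aeS (hQ t) => r h rr; rewrite h// cis_norm.
  have cst t : L2norm `]0, rho[%classic (phi t) = L2norm `]0, rho[%classic (phi 0).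
    apply: L2norm_ae_eq => //; apply: aeS2 (nQ t) (nQ 0) => r h1 h2 rr.
    by rewrite h1// h2.
  have L0 : L2norm `]0, rho[%classic (phi 0) = 0%E.
    have := decay phi gl sm rho rho0; under eq_fun do rewrite cst.
    by move/cvg_lim => <- //; rewrite lim_cst.
  apply: aeS2 (L2norm_eq0 (L2phi 0) L0) (nQ 0) => r h1 h2 rr.
  by apply: spnorm_eq0; rewrite -h2// h1.
move=> [phin0 [T T0 hT]]; apply: phin0 => t.
have L2phi s : in_L2 (phi s) by have [[h _] _] := gl; have [] := h s.
have per (j : nat) : L2norm `]0, rho[%classic (phi (t + j%:R * T)) = L2norm `]0, rho[%classic (phi t).
  elim: j => [|j IHj]; first by rewrite mul0r addr0.
  rewrite -IHj; apply: L2norm_ae_eq => //; apply: aeS (hT (t + j%:R * T)) => r h rr.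
  by rewrite -natr1 mulrDl mul1r addrA h.
have L0 : L2norm `]0, rho[%classic (phi t) = 0%E.
  (* The decay is read along the times [t + j T], at which the local norm equals its value at [t];
     the limit of this constant sequence is 0. *)
  have cT : t + j%:R * T @[j --> \oo] --> +oo%R.
    apply/cvgryPge => M; near=> j.
    have : (M - t) / T <= j%:R by near: j; exact: nbhs_infty_ger.
    by rewrite ler_pdivrMr// lerBlDl.
  have := cvg_comp _ _ cT (decay phi gl sm rho rho0).
  rewrite (_ : _ \o _ = (fun=> L2norm `]0, rho[%classic (phi t))); last first.
    by apply/funext => j /=; rewrite per.
  by move/cvg_lim => <- //; rewrite lim_cst.
apply: aeS (L2norm_eq0 (L2phi t) L0) => r h rr.
by apply: spnorm_eq0; exact: h.
Unshelve. all: by end_near. Qed.
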